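(* Let $G$ be a Sylow $2$-subgroup of the special unitary group $SU_3(4)$. Then the essential ideal $\operatorname{Ess}(G)\subseteq H^*(G,\mathbb{F}_2)$ satisfies $\operatorname{Ess}(G)^2\neq\{0\}$. More precisely, there exist essential classes $\theta\in H^4(G,\mathbb{F}_2)$ and $\eta\in H^{10}(G,\mathbb{F}_2)$ with $\theta\eta\neq 0$, and there exist essential classes $\phi\in H^6(G,\mathbb{F}_2)$ and $\psi\in H^8(G,\mathbb{F}_2)$ with $\phi\psi=\theta\eta$ (in particular $\phi\psi\neq 0$).
   Context: For a finite group $G$ and a field $k$ of characteristic $p$, a class $x\in H^*(G,k)$ is called essential if its restriction to every proper subgroup of $G$ is zero. The essential classes form an ideal $\operatorname{Ess}(G)$ of $H^*(G,k)$. *)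

(* Defs.v *)
From HB Require Import structures.
From mathcomp Require Import all_boot all_order all_algebra all_fingroup all_solvable all_field.
Set Implicit Arguments. Unset Strict Implicit. Unset Printing Implicit Defensive.
Import GRing.Theory.
Local Open Scope ring_scope.
Local Open Scope group_scope.

(* Special unitary group SU_3(q) over a field F with q^2 = #|F|, realised
   with the standard Hermitian form (identity matrix):
   SU_3 = { A in GL_3(F) : conj(A)^T A = 1, det A = 1 },  conj x = x^q. *)
Definition SU3 (F : finFieldType) (q : nat) : {set {'GL_3[F]}} :=
  [set g : {'GL_3[F]} |
     ((map_mx (fun x : F => (x ^+ q)%R) (GLval g))^T *m GLval g == 1%:M)%R
     && (\det (GLval g) == 1%R)].

(* Inhomogeneous standard cochains with trivial coefficients in k:
   an n-cochain is a function f : seq gT -> k, read on sequences of length n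
   of elements of the group. *)
Definition cochain (gT : finGroupType) (k : comNzRingType) := seq gT -> k.

Definition dcob (gT : finGroupType) (k : comNzRingType) (n : nat)
    (f : cochain gT k) : cochain gT k :=
  fun s =>
    (f (behead s)
     + \sum_(i < n) (-1) ^+ i.+1 *
          f (take i s ++ (nth 1%g s i * nth 1%g s i.+1)%g :: drop i.+2 s)
     + (-1) ^+ n.+1 * f (take n s))%R.

Definition tuple_in (gT : finGroupType) (H : {set gT}) (n : nat) (s : seq gT) :=
  (size s == n) && all (mem H) s.

Definition cocycle (gT : finGroupType) (k : comNzRingType) (H : {set gT}) (n : nat)
    (f : cochain gT k) : Prop :=
  forall s, tuple_in H n.+1 s -> dcob n f s = 0%R.

(* f is an n-coboundary on H (the restriction of f to H is a coboundary);
   for a cocycle f on G and H a subgroup, this says res^G_H [f] = 0. *)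
Definition coboundary (gT : finGroupType) (k : comNzRingType) (H : {set gT}) (n : nat)
    (f : cochain gT k) : Prop :=
  match n with
  | 0 => forall s, tuple_in H 0 s -> f s = 0%R
  | m.+1 => exists c : cochain gT k, forall s, tuple_in H n s -> f s = dcob m c s
  end.

Definition cup (gT : finGroupType) (k : comNzRingType) (p : nat)
    (f g : cochain gT k) : cochain gT k :=
  fun s => (f (take p s) * g (drop p s))%R.

Definition essential (gT : finGroupType) (k : comNzRingType) (G : {group gT}) (n : nat)
    (f : cochain gT k) : Prop :=
  cocycle G n f /\ forall H : {group gT}, H \proper G -> coboundary H n f.

(* Main.v *)
(* A Sylow 2-subgroup of SU_3(4) fixes an isotropic vector of F^3, so it is the group of pairs (a, b)
   in F with b^4 = b + a^5 and product (a, b)(a', b') = (a + a', b + b' + a^4 a').  The 64 monomials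
   a^i b^j (i < 16, j < 4) are a basis of the functions on it, and in the dual basis the group algebra
   has structure constants in F_2.  An explicit complex of free modules is a minimal resolution of F up
   to degree 14, since a contraction of it can be computed, and by minimality cohomology classes are
   linear forms on the generators.  With x_k the class of a^(2^k), products by x_k are read off from
   the linear parts of the differentials; one product of higher degree classes comes from a chain map.
   Let Y, W, g be the classes of suitable generators of degrees 4, 6, 10.  For the class e <> 0 of a
   generator of degree 14,
     x_0^3 x_1 g = e = x_2^3 x_3 g,   x_1^3 x_2 g = 0 = x_3^3 x_0 g,   x_0^3 x_1 Y W = e.
   Writing Tr for the trace to F_2 on coefficients, put
     theta = Tr(d x_0^3 x_1) with d + d^4 = 1,   eta = Tr(c g),
     phi = Tr(x_0^2 Y),                          psi = Tr(c x_0 x_1 W).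
   Both products are the class Tr(c e), which is nonzero for some c because e is a linear combination
   of its traces.  On a proper subgroup some Tr(lambda a) with lambda <> 0 vanishes, and for every such
   lambda the classes x_0^3 x_1, g, x_0^2 Y + (x_0^2 Y)^(4) and x_0 x_1 W are multiples of
   the sum of the lambda^(2^i) x_i; here (4) denotes the Frobenius twist of the coefficients. *)

Require Import Defs.
From Stdlib Require Import ZArith FMapPositive Classical.
From mathcomp Require Import all_boot all_order all_algebra all_fingroup all_solvable all_field.
From mathcomp Require Import zify ring.
Set Implicit Arguments. Unset Strict Implicit. Unset Printing Implicit Defensive.
Import Order.TTheory GRing.Theory Num.Theory.
Local Open Scope ring_scope.
Ltac Zify.zify_post_hook ::= Z.to_euclidean_division_equations.

(** * Equivariant cochains and resolutions *)

(** Both products collapse because Tr(u) lies in the prime field: Tr(u) Tr(c v) = Tr(c Tr(u) v), so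
    only the first factor has to be expanded into its four conjugates. For theta eta they add up to
    (d + d^4) e = e. For phi psi the relations x_0 x_1 x_k^2 = 0, k = 1, 2, 3, kill all conjugates
    but one, so no product of a conjugate of Y with W is ever computed. Essentiality of phi follows
    from Tr(d (u + u^(4))) = Tr((d + d^4) u) = Tr(u). The obstacle is size: degree 14 over a group
    algebra of dimension 64. The group basis would force arithmetic in F_16, whereas in the dual
    monomial basis everything is a symmetric difference of lists, run by [vm_compute]. The search
    for the contraction is not verified; only the identity dd s + s dd = 1 is, on basis elements.
    Divisibility is checked for all lambda at once, through weights that make every power of lambda
    except the zeroth cancel. Relations between classes need only the map from the bar complex to
    the resolution, built from the contraction. A map in the other direction serves solely to show
    that e is nonzero. *)

Module Bar.
Section Boundary.
Variables (T : Type) (M : zmodType).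
Hypothesis M2 : forall x : M, x + x = 0.
Implicit Types f g : seq T -> M.

(** The sum over the faces omitting one entry, without signs in characteristic 2. The empty list is
    an admissible argument, so the complex is the augmented one. *)
Fixpoint bnd (f : seq T -> M) (l : seq T) : M :=
  if l is x :: l' then f l' + bnd (fun z => f (x :: z)) l' else 0.

Lemma bnd_ext n f g : (forall l, size l = n -> f l = g l) ->
  forall l, size l = n.+1 -> bnd f l = bnd g l.
Proof.
elim: n f g => [|n IHn] f g fg [|x l] //= [sl].
  by rewrite (size0nil sl) /= fg.
by rewrite fg // (IHn _ (fun z => g (x :: z))) // => z sz; rewrite fg //= sz.
Qed.

Lemma eq_bnd f g l : f =1 g -> bnd f l = bnd g l.
Proof. by move=> fg; case: l => [|x l] //; apply: (@bnd_ext (size l)). Qed.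

Lemma bndD f g l : bnd (fun z => f z + g z) l = bnd f l + bnd g l.
Proof.
elim: l f g => [|x l IHl] f g /=; first by rewrite addr0.
by rewrite IHl addrACA.
Qed.

Lemma bnd_bnd f l : bnd (bnd f) l = 0.
Proof.
elim: l f => [|x l IHl] f //=.
by rewrite (bndD (fun z => f z)) IHl addr0 M2.
Qed.

End Boundary.

Lemma bnd_mapE (T U : Type) (M : zmodType) (h : U -> T) (f : seq T -> M) l :
  bnd f (map h l) = bnd (fun z => f (map h z)) l.
Proof. by elim: l f => [|x l IHl] f //=; rewrite IHl. Qed.

Lemma bnd_morph (T : Type) (M N : zmodType) (phi : M -> N) (f : seq T -> M) l :
  phi 0 = 0 -> {morph phi : x y / x + y} -> phi (bnd f l) = bnd (fun z => phi (f z)) l.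
Proof. by move=> p0 pD; elim: l f => [|x l IHl] f //=; rewrite pD IHl. Qed.

Lemma add2r_eq (M : zmodType) (x y : M) : (forall z : M, z + z = 0) -> x + y = 0 -> x = y.
Proof. by move=> M2 xy; rewrite -[x]addr0 -(M2 y) addrA xy add0r. Qed.

(** * Comparison of the bar complex with a free resolution *)

Section Resolution.
Variables (F : fieldType) (E : finGroupType).
Hypothesis F2 : forall x : F, x + x = 0.
(* [A 0] is the trivial module and [A n.+1] the [n]-th free module; cochains are homogeneous, so that
   degree [n] means lists of [n.+1] elements. *)
Variables (A : nat -> lmodType F) (act : forall n, E -> A n -> A n).
Variables (dd : forall n, A n -> A n.-1) (s : forall n, A n -> A n.+1) (one : A 0).
Hypothesis actD : forall n g, {morph @act n g : x y / x + y}.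
Hypothesis actZ : forall n g (k : F) x, act g (k *: x) = k *: act (n:=n) g x.
Hypothesis act1 : forall n x, act (n:=n) 1%g x = x.
Hypothesis actM : forall n g h x, act (n:=n) (g * h)%g x = act g (act h x).
Hypothesis act_one : forall g, act g one = one.
Hypothesis ddD : forall n, {morph @dd n : x y / x + y}.
Hypothesis ddZ : forall n (k : F) x, dd (k *: x) = k *: dd (n:=n) x.
Hypothesis dd_act : forall n g x, dd (act g x) = act g (dd (n:=n) x).
Hypothesis dd0 : forall x : A 0, dd x = 0.
Hypothesis ddd : forall n (x : A n.+1), dd (dd x) = 0.
Variable N : nat.
(** The contraction is used only as a section on cycles; neither linearity nor equivariance of [s]
    is assumed. *)
Hypothesis dds : forall n (x : A n), (n <= N)%N -> dd x = 0 -> dd (s x) = x.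

Lemma A2 n (x : A n) : x + x = 0.
Proof. by rewrite -[x]scale1r -scalerDl F2 scale0r. Qed.

Lemma actn0 n g : act g 0 = 0 :> A n.
Proof. by rewrite -(scale0r 0) actZ !scale0r. Qed.
Lemma ddn0 n : dd (0 : A n) = 0.
Proof. by rewrite -(scale0r 0) ddZ !scale0r. Qed.
#[local] Hint Resolve A2 : core.

Definition equivariant n (X : seq E -> A n) := forall g l, X (map (mulg g) l) = act g (X l).
Definition invariant (V : Type) (C : seq E -> V) := forall g l, C (map (mulg g) l) = C l.

Lemma map_mulg1 (l : seq E) : map (mulg 1) l = l.
Proof. by rewrite (eq_map (@mul1g _)) map_id. Qed.
Lemma map_mulgM (g h : E) l : map (mulg (g * h)) l = map (mulg g) (map (mulg h) l).
Proof. by rewrite -map_comp; apply: eq_map => x /=; rewrite mulgA. Qed.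

Lemma bnd_equivariant n (X : seq E -> A n) : equivariant X -> equivariant (bnd X).
Proof.
move=> eX g l; rewrite bnd_mapE (eq_bnd _ (eX g)) -bnd_morph //; first exact: actn0.
exact: actD.
Qed.

Lemma bnd_invariant (V : zmodType) (C : seq E -> V) : invariant C -> invariant (bnd C).
Proof. by move=> iC g l; rewrite bnd_mapE; apply: eq_bnd => z; apply: iC. Qed.

(** Lists starting with 1 form a basis of the bar complex over the group. The non-equivariant [s] is
    therefore applied after translating the first entry to 1, and the result is translated back. *)
Definition spread n (X : seq E -> A n) (l : seq E) : A n.+1 :=
  if l is g :: _ then act g (s (X (map (mulg g^-1) l))) else 0.

Lemma spread_equivariant n (X : seq E -> A n) : equivariant (spread X).
Proof.
move=> g [|h l] /=; first by rewrite actn0.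
rewrite actM; congr (act _ (act _ (s (X _)))).
by rewrite -map_comp; congr (_ :: _); [|apply: eq_map => x /=];
   rewrite invMg -!mulgA mulKg.
Qed.

Lemma dd_spread n k (X : seq E -> A n) : (n <= N)%N -> equivariant X ->
  (forall l, size l = k.+1 -> dd (X l) = 0) ->
  forall l, size l = k.+1 -> dd (spread X l) = X l.
Proof.
move=> nN eX X0 [|g l] // sl; rewrite -[spread _ _]/(act g (s (X (map (mulg g^-1) (g :: l))))) dd_act dds //.
  by rewrite eX -actM mulgV act1.
by rewrite X0 // size_map.
Qed.

(** The comparison map from the augmented bar complex to the resolution, kept as module-valued
    equivariant cochains. *)
Fixpoint sigma (n : nat) : seq E -> A n :=
  match n with
  | 0 => fun _ => one
  | n.+1 => spread (bnd (sigma n))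
  end.

Lemma sigma_equivariant n : equivariant (sigma n).
Proof. by case: n => [g l|n]; [rewrite act_one | apply: spread_equivariant]. Qed.

Lemma dd_sigma n l : (n <= N)%N -> size l = n.+1 -> dd (sigma n.+1 l) = bnd (sigma n) l.
Proof.
elim: n l => [|n IHn] l nN sl.
  by apply: (@dd_spread 0 0) => //; exact: (bnd_equivariant (@sigma_equivariant 0)).
apply: (@dd_spread n.+1 n.+1) => //.
  exact/bnd_equivariant/sigma_equivariant.
move=> {sl} l sl.
rewrite (bnd_morph _ _ (ddn0 _)); last exact: ddD.
rewrite -[RHS](bnd_bnd (@A2 n) (sigma n) l); apply: bnd_ext sl => z sz.
by rewrite IHn // ltnW.
Qed.

(** Uniqueness in the comparison theorem: a family of maps lowering degrees by [k] that commutes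
    with the differentials and vanishes after augmentation is null-homotopic, so a cocycle of the
    resolution pulls back along it to a coboundary. The shift [k] makes room for the degree of a
    second cup factor. *)
Lemma homotopy (V : zmodType) n k (D : forall i, seq E -> A i.+1) (f : A n.+1 -> V) :
  (n < N)%N -> (forall i, equivariant (D i)) ->
  (forall l, size l = k.+1 -> dd (D 0 l) = 0) ->
  (forall i l, (i < n)%N -> size l = (i.+1 + k).+1 -> dd (D i.+1 l) = bnd (D i) l) ->
  f 0 = 0 -> {morph f : x y / x + y} -> (forall g x, f (act g x) = f x) ->
  (forall x : A n.+2, f (dd x) = 0) -> (forall x : V, x + x = 0) ->
  exists2 C : seq E -> V, invariant C & forall l, size l = (n + k).+1 -> f (D n l) = bnd C l.
Proof.
move=> nN eD D0 DS f0 fD fG fd V2.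
have [H eH HP]: exists2 H : seq E -> A n.+1, equivariant H &
    forall l, size l = (n + k).+1 -> dd (D n l + bnd H l) = 0.
  elim: n nN {f f0 fD fG fd} DS => [|n IHn] nN DS.
    exists (fun _ => 0) => [g l|l sl]; first by rewrite actn0.
    rewrite ddD D0 // add0r (_ : bnd _ l = 0) ?ddn0 //.
    by elim: l {sl} => //= x l ->; rewrite addr0.
  have [||H eH HP] := IHn; first exact: ltnW.
    by move=> i l ni; apply: DS; apply: ltnW.
  have eX : equivariant (fun l => D n l + bnd H l).
    by move=> g l; rewrite eD bnd_equivariant // actD.
  exists (spread (fun l => D n l + bnd H l)) => [|l sl].
    exact: spread_equivariant.
  rewrite ddD DS // (bnd_morph _ _ (ddn0 _)); last exact: ddD.
  have -> : bnd (D n) l = bnd (fun l => D n l + bnd H l) l.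
    by rewrite bndD bnd_bnd ?addr0 //; apply: A2.
  rewrite -[RHS](A2 (bnd (fun l => D n l + bnd H l) l)); congr (_ + _).
  apply: bnd_ext sl => z sz; rewrite (@dd_spread n.+1 (n + k) (fun l => D n l + bnd H l)) //; exact: ltnW.
(* The sum of [D n l] and [bnd H l] is a cycle, hence [dd] of something, and [f] kills it. *)
exists (f \o H) => [g l|l sl]; first by rewrite /= eH fG.
apply: add2r_eq => //; rewrite (eq_bnd (g := fun z => f (H z))) // -bnd_morph //.
by rewrite -fD -(dds _ (HP l sl)) ?fd.
Qed.

(** The Alexander-Whitney product, both factors sharing the entry at position p. The first factor
    may be module-valued so that [sigma] itself can be multiplied by a scalar cocycle. *)
Definition vcup (V : lmodType F) p (f : seq E -> V) (g : seq E -> F) l : V :=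
  g (drop p l) *: f (take p.+1 l).

(** On the right, the face of f omitting its last entry and the face of g omitting its first one
    give the same term, and the two cancel. *)
Lemma bnd_vcup (V : lmodType F) p (f : seq E -> V) (g : seq E -> F) l :
  (p.+1 < size l)%N ->
  bnd (vcup p f g) l = vcup p.+1 (bnd f) g l + vcup p f (bnd g) l.
Proof.
have V2 (v : V) : v + v = 0 by rewrite -[v]scale1r -scalerDl F2 scale0r.
elim: p f l => [|p IHp] f [|a l] // sl.
  case: l sl => // b l _.
  rewrite -[LHS]/(vcup 0 f g (b :: l) + bnd (fun z => vcup 0 f g (a :: z)) (b :: l)).
  have -> : bnd (fun z => vcup 0 f g (a :: z)) (b :: l) =
            bnd (fun z => g (a :: z)) (b :: l) *: f [:: a].
    rewrite (bnd_morph (phi := fun c => c *: f [:: a])) ?scale0r //.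
      by apply: eq_bnd => z; rewrite /vcup /= take0.
    by move=> x y; rewrite scalerDl.
  rewrite /vcup /= ?take0 ?drop0 ?addr0 scalerDr !scalerDl -!addrA; congr (_ + _).
  by rewrite [in RHS]addrA V2 add0r.
rewrite -[LHS]/(vcup p.+1 f g l + bnd (vcup p (fun z => f (a :: z)) g) l) IHp //.
by rewrite addrA /vcup /= -scalerDr.
Qed.

Definition scup p (f g : seq E -> F) l : F := f (take p.+1 l) * g (drop p l).

Lemma bnd_scup p (f g : seq E -> F) l : (p.+1 < size l)%N ->
  bnd (scup p f g) l = scup p.+1 (bnd f) g l + scup p f (bnd g) l.
Proof.
move=> sl; have := @bnd_vcup F^o p f g l sl; rewrite /scup /vcup /= => {sl} H.
by rewrite mulrC [X in _ + X]mulrC -H; apply: eq_bnd => z; rewrite mulrC.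
Qed.

(** In degree 0 the value of [C] at the empty list makes every constant a coboundary, as in reduced
    cohomology. This is why the lemmas that multiply a coboundary start in degree 1. *)
Definition cob n (f : seq E -> F) : Prop :=
  exists2 C, invariant C & forall l, size l = n.+1 -> f l = bnd C l.

Definition cocyc n (f : seq E -> F) : Prop :=
  invariant f /\ forall l, size l = n.+2 -> bnd f l = 0.

Lemma cob0 n : cob n (fun _ => 0).
Proof. by exists (fun _ => 0) => // l _; elim: l => //= a l <-; rewrite addr0. Qed.

Lemma cob_ext n f g : (forall l, size l = n.+1 -> f l = g l) -> cob n f -> cob n g.
Proof. by move=> fg [C iC HC]; exists C => // l sl; rewrite -fg // HC. Qed.

Lemma cobD n f g : cob n f -> cob n g -> cob n (fun l => f l + g l).
Proof.
move=> [C iC HC] [D iD HD]; exists (fun l => C l + D l) => [h l|l sl].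
  by rewrite iC iD.
by rewrite HC // HD // bndD.
Qed.

Lemma cob_trans n f g h : cob n (fun l => f l + g l) -> cob n (fun l => g l + h l) ->
  cob n (fun l => f l + h l).
Proof.
move=> fg gh; apply: cob_ext (cobD fg gh) => l _.
by rewrite -addrA [g l + (_ + _)]addrA F2 add0r.
Qed.

Lemma cob_sym n f g : cob n (fun l => f l + g l) -> cob n (fun l => g l + f l).
Proof. by apply: cob_ext => l _; rewrite addrC. Qed.

Lemma cob_eq n f g : cob n (fun l => f l + g l) -> cob n f -> cob n g.
Proof.
move=> fg cf; apply: cob_ext (cobD fg cf) => l _.
by rewrite addrAC F2 add0r.
Qed.

Lemma cob_morph n (phi : F -> F) f :
  phi 0 = 0 -> {morph phi : x y / x + y} -> cob n f -> cob n (fun l => phi (f l)).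
Proof.
move=> p0 pD [C iC HC]; exists (fun l => phi (C l)) => [g l|l sl]; first by rewrite iC.
by rewrite HC // (bnd_morph _ _ p0).
Qed.

Lemma cobZ n k f : cob n f -> cob n (fun l => k * f l).
Proof. by apply: cob_morph => [|x y]; rewrite ?mulr0 ?mulrDr. Qed.

(** Only additivity is asked of [phi], which will be the squaring map or a trace. *)
Lemma cocyc_morph n (phi : F -> F) f :
  phi 0 = 0 -> {morph phi : x y / x + y} -> cocyc n f -> cocyc n (fun l => phi (f l)).
Proof.
move=> p0 pD [iF cF]; split=> [g l|l sl]; first by rewrite iF.
by rewrite -(bnd_morph _ _ p0) // cF.
Qed.

Lemma scup_invariant p f g : invariant f -> invariant g -> invariant (scup p f g).
Proof. by move=> iF iG h l; rewrite /scup -map_drop -map_take iF iG. Qed.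

Lemma cocyc_scup p q f g : cocyc p f -> cocyc q g -> cocyc (p + q) (scup p f g).
Proof.
move=> [iF cF] [iG cG]; split=> [|l sl]; first exact: scup_invariant.
rewrite bnd_scup ?sl ?ltnS ?leq_addr // /scup cF; last first.
  by rewrite size_takel // sl !ltnS leq_addr.
by rewrite cG ?mulr0 ?mul0r ?addr0 // size_drop sl -addnS -addnS addKn.
Qed.

Lemma cob_scupr p q f g : cob p.+1 f -> cocyc q g -> cob (p.+1 + q) (scup p.+1 f g).
Proof.
move=> [C iC HC] [iG cG]; exists (scup p C g) => [|l sl]; first exact: scup_invariant.
rewrite bnd_scup ?sl ?ltnS ?leq_addr // [X in _ = _ + X]/scup cG ?mulr0 ?addr0; last first.
  by rewrite size_drop sl addSn -2!addnS addKn.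
by rewrite /scup HC // size_takel // sl addSn !ltnS leq_addr.
Qed.

(** * Products with classes of degree 1 *)

Section Degree1.
Variable x : E -> F.
Hypothesis xM : forall g h, x (g * h)%g = x g + x h.

(** The function x is a non-invariant primitive of its own class; weighing by it gives a
    non-invariant primitive of the product of that class with a cocycle f. *)
Definition weigh (f : seq E -> F) (l : seq E) : F :=
  (if l is a :: _ then x a else 0) * f l.
(** In characteristic 2, x a + x b is x at the quotient of a and b, that is, the homogeneous
    1-cocycle of the homomorphism x; it is multiplied from the left. *)
Definition xcup (f : seq E -> F) (l : seq E) : F :=
  if l is a :: ((b :: _) as l') then (x a + x b) * f l' else 0.

Lemma bnd_weigh f l : (1 < size l)%N -> bnd (weigh f) l = xcup f l + weigh (bnd f) l.
Proof.
case: l => [|a [|b l]] // _.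
rewrite -[LHS]/(x b * f (b :: l) + bnd (fun z => x a * f (a :: z)) (b :: l)).
rewrite -(bnd_morph (phi := fun c => x a * c)) ?mulr0 //; last first.
  by move=> u v; rewrite mulrDr.
rewrite -[RHS]/((x a + x b) * f (b :: l) + x a * (f (b :: l) + bnd (fun z => f (a :: z)) (b :: l))).
by move: (bnd _ _) => B; rewrite mulrDr mulrDl addrACA F2 add0r.
Qed.

(** No faces are compared: the formula for [bnd (weigh f)] is substituted into [bnd_bnd] for
    [weigh f]. *)
Lemma bnd_xcup f l : (2 < size l)%N -> bnd (xcup f) l = xcup (bnd f) l.
Proof.
case: l => // a l sl; apply: add2r_eq => //.
rewrite -[RHS](bnd_bnd F2 (weigh f) (a :: l)).
rewrite [RHS](@bnd_ext _ _ (size l) _ (fun l => xcup f l + weigh (bnd f) l)) //; last first.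
  by move=> z sz; apply: bnd_weigh; rewrite sz.
rewrite bndD bnd_weigh; last exact: ltnW.
by rewrite [weigh _ _]/weigh bnd_bnd // mulr0 addr0.
Qed.

Lemma xcup_invariant f : invariant f -> invariant (xcup f).
Proof.
move=> iF g [|a [|b l]] //=; rewrite !xM addrACA F2 add0r.
by congr (_ * _); apply: (iF g (b :: l)).
Qed.

Lemma cocyc_xcup n f : cocyc n f -> cocyc n.+1 (xcup f).
Proof.
move=> [iF cF]; split=> [|l sl]; first exact: xcup_invariant.
rewrite bnd_xcup ?sl //; case: l sl => [|a [|b l]] // [sl].
by rewrite [xcup _ _]/xcup cF ?mulr0 //= sl.
Qed.

Lemma cob_xcup n f : cob n.+1 f -> cob n.+2 (xcup f).
Proof.
move=> [C iC HC]; exists (xcup C) => [|l sl]; first exact: xcup_invariant.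
rewrite bnd_xcup ?sl //; case: l sl => [|a [|b l]] // [sl].
by rewrite [xcup _ _]/xcup HC //= sl.
Qed.

(** Commutation with a class of degree 1. The two ways of weighing the product, at its entry p and
    at its first entry, are not invariant, but their sum is, and it bounds. *)
Lemma xcup_comm p q f g : cocyc p f -> cocyc q g ->
  cob (p + q.+1) (fun l => scup p f (xcup g) l + xcup (scup p f g) l).
Proof.
move=> cf cg; have [iF cF] := cf; have [iG cG] := cg.
pose T l : F := scup p f (weigh g) l + weigh (scup p f g) l.
(* On lists of length at most p the second factor sees the empty list, whose weight is 0 by default;
   this would break invariance, so such lists are cut off. *)
exists (fun l => if (p < size l)%N then T l else 0) => [h l|l sl].
  rewrite /T size_map; case: ltnP => // pl; rewrite /scup /weigh -map_drop -map_take iF iG.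
  case: l pl => // a l pl; case El: (drop _ _) => [|b l'].
    by have := size_drop p (a :: l); rewrite El => /esym/eqP; rewrite subn_eq0 leqNgt pl.
  move: (f _) (g _) => u v; rewrite /= !xM !(mulrCA u) -!mulrDl; congr (_ * _).
  by rewrite addrACA F2 add0r.
rewrite (@bnd_ext _ _ (p + q.+1) _ T) //; last first.
  by move=> z sz; rewrite sz addnS ltnS leq_addr.
rewrite bndD bnd_scup ?sl ?addnS ?ltnS ?leq_addr //.
rewrite [scup p.+1 _ _ _]/scup cF ?mul0r ?add0r; last by rewrite size_takel ?sl // addnS !ltnS leq_addr.
rewrite [in RHS]bnd_weigh ?sl ?addnS // [weigh (bnd _) _]/weigh.
have [_ ->] := cocyc_scup cf cg; last by rewrite sl addnS.
rewrite mulr0 addr0; congr (_ + _); rewrite /scup; congr (_ * _).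
by rewrite bnd_weigh ?[in weigh _ _]/weigh ?cG ?mulr0 ?addr0 // size_drop sl addnS -2!addnS addKn.
Qed.
End Degree1.

(** * Invariant forms on a minimal resolution *)

Variables (I : nat -> finType) (e : forall n, I n -> A n.+1).
Variables (co : forall n, A n.+1 -> I n -> E -> F) (aug : A 0 -> F).
Hypothesis coD : forall n x y i h, co (n:=n) (x + y) i h = co x i h + co y i h.
Hypothesis coZ : forall n k x i h, co (n:=n) (k *: x) i h = k * co x i h.
Hypothesis co_act : forall n g x i h, co (n:=n) (act g x) i h = co x i (g^-1 * h)%g.
Hypothesis co_sum : forall n x, x = \sum_i \sum_h co (n:=n) x i h *: act h (e i).
Hypothesis co_e : forall n i j h, co (e (n:=n) i) j h = ((i == j) && (h == 1%g))%:R.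
Hypothesis augE : forall x, x = aug x *: one.
Hypothesis augD : {morph aug : x y / x + y}.
Hypothesis augZ : forall k x, aug (k *: x) = k * aug x.
Hypothesis aug1 : aug one = 1.
Hypothesis minimal : forall n (j : I n.+1) k, \sum_h co (dd (e j)) k h = 0.

Definition linear_map (V W : lmodType F) (f : V -> W) :=
  {morph f : x y / x + y} /\ forall k x, f (k *: x) = k *: f x.

Lemma linear_map0 (V W : lmodType F) (f : V -> W) : linear_map f -> f 0 = 0.
Proof. by move=> [_ fZ]; rewrite -(scale0r 0) fZ !scale0r. Qed.

Lemma linear_map_comp (U V W : lmodType F) (f : V -> W) (g : U -> V) :
  linear_map f -> linear_map g -> linear_map (fun x => f (g x)).
Proof. by move=> [fD fZ] [gD gZ]; split=> [x y|k x]; rewrite (gD, gZ) (fD, fZ). Qed.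

Lemma linear_map_sum (V W : lmodType F) (f : V -> W) (T : finType) (g : T -> V) :
  linear_map f -> f (\sum_t g t) = \sum_t f (g t).
Proof. by move=> lf; apply: (big_morph f); [case: lf | apply: linear_map0]. Qed.

Lemma linear_co n (W : lmodType F) (f : A n.+1 -> W) x : linear_map f ->
  f x = \sum_i \sum_h co x i h *: f (act h (e i)).
Proof.
move=> lf; rewrite {1}(co_sum x) (linear_map_sum _ lf); apply: eq_bigr => i _.
rewrite (linear_map_sum _ lf); apply: eq_bigr => h _.
by case: lf => _ ->.
Qed.

Lemma linear_dd n : linear_map (dd (n:=n)).
Proof. by split. Qed.

Definition extend n (W : lmodType F) (v : I n -> E -> W) (x : A n.+1) : W :=
  \sum_i \sum_h co x i h *: v i h.

Lemma linear_extend n (W : lmodType F) (v : I n -> E -> W) : linear_map (extend v).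
Proof.
split=> [x y|k x]; rewrite /extend.
  rewrite -big_split; apply: eq_bigr => i _; rewrite -big_split; apply: eq_bigr => h _.
  by rewrite coD scalerDl.
rewrite scaler_sumr; apply: eq_bigr => i _; rewrite scaler_sumr; apply: eq_bigr => h _.
by rewrite coZ scalerA.
Qed.

Lemma extend_e n (W : lmodType F) (v : I n -> E -> W) i : extend v (e i) = v i 1%g.
Proof.
rewrite /extend (bigD1 i) //= (bigD1 1%g) //= co_e !eqxx scale1r !big1 ?addr0 //.
  move=> j /negbTE ji; rewrite big1 // => h _.
  by rewrite co_e eq_sym ji scale0r.
by move=> h /negbTE h1; rewrite co_e h1 andbF scale0r.
Qed.

Lemma extend_act n (W : lmodType F) (v : I n -> E -> W) g x :
  extend v (act g x) = extend (fun i h => v i (g * h)%g) x.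
Proof.
apply: eq_bigr => i _; rewrite (reindex_inj (mulgI g)); apply: eq_bigr => h _ /=.
by rewrite co_act mulKg.
Qed.

Lemma eq_extend n (W : lmodType F) (v w : I n -> E -> W) x :
  (forall i h, v i h = w i h) -> extend v x = extend w x.
Proof. by move=> vw; apply: eq_bigr => i _; apply: eq_bigr => h _; rewrite vw. Qed.

Lemma extend_id n (W : lmodType F) (f : A n.+1 -> W) x : linear_map f ->
  f x = extend (fun i h => f (act h (e i))) x.
Proof. exact: linear_co. Qed.

Lemma extend_comp n (W U : lmodType F) (f : W -> U) (v : I n -> E -> W) x :
  linear_map f -> f (extend v x) = extend (fun i h => f (v i h)) x.
Proof.
move=> lf; rewrite (linear_map_sum _ lf); apply: eq_bigr => i _.
by rewrite (linear_map_sum _ lf); apply: eq_bigr => h _; case: lf => _ ->.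
Qed.

Definition lin n (v : I n -> F) : A n.+1 -> F^o := extend (W := F^o) (fun i _ => v i).
(** The counterpart of [weigh] on the resolution: translation by g changes it by x g times [lin v].
    Its values on boundaries of generators, recorded by [xmul], are the coordinates of the product
    by x. *)
Definition xlin (x : E -> F) n (v : I n -> F) : A n.+1 -> F^o :=
  extend (W := F^o) (fun i h => x h * v i).
Definition xmul (x : E -> F) n (v : I n -> F) (j : I n.+1) : F := xlin x v (dd (e j)).

Lemma lin_minimal n (v : I n -> F) j : lin v (dd (e j)) = 0.
Proof.
apply: big1 => i _; rewrite -scaler_suml minimal.
exact: (scale0r (v i : F^o)).
Qed.

Lemma invariant_lin n (f : A n.+1 -> F^o) x : linear_map f ->
  (forall g y, f (act g y) = f y) -> f x = lin (fun i => f (e i)) x.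
Proof. by move=> lf fG; rewrite (extend_id x lf); apply: eq_extend => i h; rewrite fG. Qed.

Definition pcocycle n (f : A n.+1 -> F^o) :=
  [/\ linear_map f, forall g x, f (act g x) = f x & forall x : A n.+2, f (dd x) = 0].

Lemma pcocycle_lin n (v : I n -> F) : pcocycle (lin v).
Proof.
have iv g x : lin v (act g x) = lin v x by rewrite /lin extend_act.
split=> // [|x]; first exact: linear_extend.
rewrite (@invariant_lin n.+1 (fun x => lin v (dd x))); first last.
- by move=> g y; rewrite dd_act.
- exact: (@linear_map_comp (A n.+2) (A n.+1) F^o (lin v) (@dd n.+2) (linear_extend _) (linear_dd _)).
rewrite [LHS](@eq_extend _ F^o _ (fun _ _ => 0)) => [|i h]; last exact: lin_minimal.
by rewrite /extend big1 // => i _; rewrite big1 // => h _; rewrite scaler0.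
Qed.

Definition cls n (f : A n.+1 -> F^o) (l : seq E) : F := f (sigma n.+1 l).

Lemma cls_invariant n f : pcocycle (n:=n) f -> invariant (cls f).
Proof. by move=> [_ fG _] g l; rewrite /cls sigma_equivariant fG. Qed.

Lemma cocyc_cls n f : (n < N)%N -> pcocycle (n:=n) f -> cocyc n (cls f).
Proof.
move=> nN pf; split=> [|l sl]; first exact: cls_invariant.
case: pf => lf _ fd; have f0 := linear_map0 lf; case: lf => fD _.
by rewrite -(bnd_morph _ _ f0) // -dd_sigma.
Qed.

(** The weighted cochain of the class and [xlin] composed with [sigma] fail to be invariant by the
    same amount, so their sum is an invariant bounding cochain. *)
Lemma xcup_cls n (x : E -> F) (v : I n -> F) :
  (forall g h, x (g * h)%g = x g + x h) -> (n < N)%N ->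
  cob n.+1 (fun l => xcup x (cls (lin v)) l + cls (lin (xmul x v)) l).
Proof.
move=> xM nN; have pf := pcocycle_lin v; have [iF cF] := cocyc_cls nN pf.
have [lD lZ] : linear_map (xlin x v) by exact: linear_extend.
have l0 : xlin x v 0 = 0 by apply: linear_map0; split.
have xG g y : xlin x v (act g y) = x g * lin v y + xlin x v y.
  rewrite /xlin extend_act /lin /extend -[x g * _]/(x g *: (_ : F^o)) scaler_sumr -big_split.
  apply: eq_bigr => i _ /=; rewrite scaler_sumr -big_split; apply: eq_bigr => h _ /=.
  rewrite xM mulrDl scalerDr; congr (_ + _).
  exact: mulrCA.
exists (fun l => weigh x (cls (lin v)) l + xlin x v (sigma n.+1 l)) => [g [|a l]|l sl] //.
  rewrite sigma_equivariant xG {1}/weigh iF /= xM mulrDl.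
  by rewrite addrACA F2 add0r.
rewrite bndD bnd_weigh ?sl // [weigh _ (bnd _) _]/weigh cF // mulr0 addr0 -(bnd_morph (phi := xlin x v)) //.
rewrite -dd_sigma // (@invariant_lin n.+1 (fun y => xlin x v (dd y))) //.
- exact: (@linear_map_comp (A n.+2) (A n.+1) F^o (xlin x v) (@dd n.+2) (linear_extend _) (linear_dd _)).
by move=> g y; rewrite dd_act xG; case: pf => _ _ ->; rewrite mulr0 add0r.
Qed.

(** [W] is a chain map covering w. The product of [sigma] with the cocycle of w, and [W] after
    [sigma], both lower degrees by q and have the same augmentation, so [homotopy] applies to their
    sum. *)
Lemma scup_cls n q (f : A n.+1 -> F^o) (w : A q.+1 -> F^o) (W : forall i, A (i + q).+1 -> A i.+1) :
  (n + q <= N)%N -> (n < N)%N -> (q < N)%N -> pcocycle f -> pcocycle w ->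
  (forall i, linear_map (W i)) -> (forall i g x, W i (act g x) = act g (W i x)) ->
  (forall x, dd (W 0 x) = w x *: one) ->
  (forall i x, (i < n)%N -> dd (W i.+1 x) = W i (dd x)) ->
  cob (n + q) (fun l => scup n (cls f) (cls w) l + cls (fun x => f (W n x)) l).
Proof.
move=> nqN nN qN pf pw lW WG W0 WS; have [lf fG fd] := pf; have [lw _ _] := pw.
have [iw cw] := cocyc_cls qN pw.
pose D i l := vcup i (sigma i.+1) (cls w) l + W i (sigma (i + q).+1 l).
have [||||C iC HC] := @homotopy F^o n q D f nN _ _ _ (linear_map0 lf) _ fG fd F2.
- move=> i g l; rewrite /D /vcup -map_drop -map_take iw !sigma_equivariant WG actD actZ //.
- move=> l sl; rewrite /D ddD W0 /vcup ddZ drop0 dd_sigma //; last by rewrite size_takel ?sl.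
  by case: l sl => // a l _; rewrite /= take0 addr0 -scalerDl F2 scale0r.
- move=> i l ni sl; rewrite /D ddD bndD WS //; congr (_ + _).
    rewrite [in LHS]/vcup ddZ dd_sigma ?(leq_trans ni (ltnW nN)) //; last first.
      by rewrite size_takel // sl !ltnS leq_addr.
    rewrite -[LHS]/(vcup i.+1 (bnd (sigma i.+1)) (cls w) l).
    have -> : bnd (vcup i (sigma i.+1) (cls w)) l = vcup i.+1 (bnd (sigma i.+1)) (cls w) l.
      rewrite bnd_vcup ?sl ?addSn ?ltnS ?leq_addr // [X in _ + X]/vcup cw ?scale0r ?addr0 //.
      by rewrite size_drop sl addSn -2!addnS addKn.
    by [].
  rewrite dd_sigma //; last exact: leq_trans (leq_add (ni : (i.+1 <= n)%N) (leqnn q)) nqN.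
  rewrite (bnd_morph _ _ (linear_map0 (lW i))) //; by case: (lW i).
- by case: lf.
exists C => // l sl; rewrite -HC // /D; case: lf => fD fZ; rewrite fD; congr (_ + _).
by rewrite /vcup fZ /scup mulrC.
Qed.

(** [sigma] and [G] after [sigma] are equivariant lifts of the same map on constants. Only
    additivity of [G] enters, so it may be semilinear for a Frobenius power. *)
Lemma cls_twist n (f : A n.+1 -> F^o) (G : forall i, A i -> A i) :
  (n < N)%N -> pcocycle f -> (forall i, {morph G i : x y / x + y}) ->
  (forall i g x, G i (act g x) = act g (G i x)) -> G 0 one = one ->
  (forall i x, (i <= n)%N -> dd (G i.+1 x) = G i (dd x)) ->
  cob n (fun l => cls f l + cls (fun x => f (G n.+1 x)) l).
Proof.
move=> nN [lf fG fd] GD GG G1 GS.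
have G0 i : G i 0 = 0 by apply: (addrI (G i 0)); rewrite -GD !addr0.
have [fD _] := lf.
pose D i l := sigma i.+1 l + G i.+1 (sigma i.+1 l).
have [|||C iC HC] := @homotopy F^o n 0 D f nN _ _ _ (linear_map0 lf) fD fG fd F2.
- by move=> i g l; rewrite /D !sigma_equivariant GG actD.
- move=> l sl; rewrite /D ddD GS // dd_sigma //.
  by case: l sl => // a [|b l] // _ /=; rewrite addr0 G1 A2.
- move=> i l ni; rewrite addn0 => sl.
  have iN : (i.+1 <= N)%N by apply: leq_trans ni (ltnW nN).
  rewrite /D ddD bndD GS // dd_sigma //; congr (_ + _).
  exact: bnd_morph (G0 _) (GD _).
exists C => // l sl; rewrite -HC ?addn0 //; exact/esym/fD.
Qed.

(** * Pulling bar cochains back to the resolution *)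

Lemma linear_act n g : linear_map (act (n:=n) g).
Proof. by split=> [x y|k x]; rewrite (actD, actZ). Qed.

(** Composition of f with the comparison map from the resolution to the bar complex: a generator
    goes to the image of its boundary with 1 prepended, prepending 1 being the standard contraction
    of the bar complex. Bar chains themselves are never formed. *)
Fixpoint R (V : lmodType F) n (f : seq E -> V) : A n -> V :=
  match n with
  | 0 => fun x => aug x *: f [::]
  | n'.+1 => extend (fun i h => R (fun l => f (h :: map (mulg h) l)) (dd (e i)))
  end.

Lemma linear_R (V : lmodType F) n (f : seq E -> V) : linear_map (R (n := n) f).
Proof.
case: n f => [|n] f; last exact: linear_extend.
by split=> [x y|k x] /=; rewrite (augD, augZ) (scalerDl, scalerA).
Qed.

Lemma R_ext (V : lmodType F) n (f g : seq E -> V) (x : A n) :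
  (forall l, size l = n -> f l = g l) -> R f x = R g x.
Proof.
elim: n f g x => [|n IHn] f g x fg /=; first by rewrite fg.
by apply: eq_extend => i h; apply: IHn => l sl; rewrite fg //= size_map sl.
Qed.

Lemma R_morph (V W : lmodType F) n (phi : V -> W) (f : seq E -> V) (x : A n) :
  linear_map phi -> phi (R f x) = R (fun l => phi (f l)) x.
Proof.
move=> lphi; elim: n f x => [|n IHn] f x /=; first by case: lphi => _ ->.
by rewrite (extend_comp _ _ lphi); apply: eq_extend => i h; apply: IHn.
Qed.

Lemma R_add (V : lmodType F) n (f g : seq E -> V) (x : A n) :
  R (fun l => f l + g l) x = R f x + R g x.
Proof.
elim: n f g x => [|n IHn] f g x /=; first by rewrite scalerDr.
rewrite /extend -big_split; apply: eq_bigr => i _; rewrite -big_split; apply: eq_bigr => h _.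
by rewrite /= -scalerDr -IHn.
Qed.

Lemma R_act (V : lmodType F) n (f : seq E -> V) g (x : A n.+1) :
  R f (act g x) = R (fun l => f (map (mulg g) l)) x.
Proof.
rewrite /= extend_act; apply: eq_extend => i h; apply: R_ext => l _ /=.
by rewrite map_mulgM.
Qed.

Lemma linear_Rdd (V : lmodType F) n (f : seq E -> V) :
  linear_map (fun y : A n.+1 => R (n := n) f (dd y)).
Proof.
have [RD RZ] := linear_R n f.
by split=> [x y|k x]; rewrite (ddD, ddZ) (RD, RZ).
Qed.

Lemma R_bnd (V : lmodType F) n (f : seq E -> V) (x : A n.+1) :
  R (bnd f) x = R f (dd x).
Proof.
elim: n f x => [|n IHn] f x.
  rewrite [RHS](linear_co (f := fun y => R f (dd y))); last exact: linear_Rdd.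
  rewrite /= /extend; apply: eq_bigr => i _; apply: eq_bigr => h _.
  congr (_ *: (_ *: _)); last by rewrite addr0.
  rewrite dd_act (augE (dd (e i))) actZ act_one //.
rewrite [RHS](linear_co (f := fun y => R f (dd y))); last exact: linear_Rdd.
rewrite [LHS]/= {1}/extend; apply: eq_bigr => i _; apply: eq_bigr => h _; congr (_ *: _).
rewrite dd_act R_act.
rewrite -[LHS]/(R (fun l => bnd f (h :: map (mulg h) l)) (dd (e i))).
rewrite (@R_ext _ _ _ (fun l => f (map (mulg h) l) + bnd (fun z => f (h :: map (mulg h) z)) l)).
  by rewrite R_add IHn ddd (linear_map0 (linear_R _ _)) addr0.
by move=> l sl; rewrite /= bnd_mapE.
Qed.

(** Going to the bar complex and back is homotopic to the identity. The homotopy relation is stated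
    as a cycle condition on the error, because this is what the induction consumes: the next
    homotopy takes a generator to [s] of its error. *)
Lemma R_sigma_homotopy n : (n <= N)%N -> exists2 H : A n -> A n.+1,
  linear_map H /\ (forall g x, H (act g x) = act g (H x)) &
  forall x : A n.+1, dd (R (sigma n.+1) x + x + H (dd x)) = 0.
Proof.
have dS m (x : A m.+1) : (m <= N)%N -> dd (R (sigma m.+1) x) = R (sigma m) (dd x).
  move=> mN; rewrite (R_morph _ _ (linear_dd m.+1)) -R_bnd; apply: R_ext => l sl.
  exact: dd_sigma.
have SG m g (x : A m.+1) : R (sigma m.+1) (act g x) = act g (R (sigma m.+1) x).
  rewrite R_act (R_morph _ _ (linear_act _ g)); apply: R_ext => l _.
  exact: sigma_equivariant.
elim: n => [|n IHn] nN.
  exists (fun _ => 0) => [|x].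
    split=> [|g x]; last by rewrite actn0.
    by split=> [x y|k x]; rewrite ?addr0 ?scaler0.
  by rewrite addr0 ddD dS //= -augE A2.
have [H [lH HG] HP] := IHn (ltnW nN).
pose u i := s (R (sigma n.+1) (e i) + e i + H (dd (e i))).
have du i : dd (u i) = R (sigma n.+1) (e i) + e i + H (dd (e i)) by rewrite /u dds.
have lSH : linear_map (fun x : A n.+1 => R (sigma n.+1) x + x + H (dd x)).
  have [RD RZ] := linear_R n.+1 (sigma n.+1); have [HD HZ] := lH.
  split=> [x y|k x].
    by rewrite RD ddD HD (addrACA (R (sigma n.+1) x)) [LHS]addrACA.
  by rewrite RZ ddZ HZ !scalerDr.
exists (extend (fun i h => act h (u i))) => [|x].
  split=> [|g x]; first exact: linear_extend.
  rewrite extend_act (extend_comp _ _ (linear_act _ g)).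
  by apply: eq_extend => i h; rewrite actM.
have dE : dd (extend (fun i h => act h (u i)) (dd x)) =
    R (sigma n.+1) (dd x) + dd x + H (dd (dd x)).
  rewrite (extend_comp _ _ (linear_dd n.+2)) (extend_id _ lSH); apply: eq_extend => i h.
  by rewrite dd_act du SG dd_act HG !actD.
rewrite ddD [X in X + _]ddD dE dS // ddd (linear_map0 lH) addr0.
exact: A2.
Qed.

(** Coordinates of a class: by minimality, coboundaries read 0 in positive degrees and [cls (lin v)]
    reads v. This is the detector of nonzero classes. *)
Definition reading n (f : seq E -> F) (i : I n) : F := R (V := F^o) f (e i).

Lemma reading_cob n (f : seq E -> F) i : cob n.+1 f -> reading (n := n.+1) f i = 0.
Proof.
move=> [C iC HC]; rewrite /reading (@R_ext F^o _ _ (bnd (C : seq E -> F^o))) //.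
rewrite (@R_bnd F^o) (@invariant_lin n (R (V := F^o) C)).
- exact: lin_minimal.
- exact: linear_R.
by move=> g y; rewrite R_act; apply: R_ext => l _; apply: iC.
Qed.

Lemma reading_xcup n x (f : seq E -> F) i : cocyc n f ->
  reading (n := n.+1) (xcup x f) i = xmul x (reading f) i.
Proof.
move=> [iF cF]; rewrite /reading (@R_ext F^o _ _ (bnd (weigh x f : seq E -> F^o))).
  rewrite (@R_bnd F^o) /xmul; move: (dd (e i) : A n.+1) => y.
  apply: (@eq_extend n F^o) => k h.
  have -> : R (V := F^o) (n := n.+1) f (e k) =
      R (V := F^o) (fun l => f (1%g :: map (mulg 1) l)) (dd (e k)) by exact: (@extend_e n F^o).
  have lx : linear_map (fun c : F^o => x h * c : F^o).
    by split=> [a b|a b]; [apply: mulrDr | apply: mulrCA].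
  rewrite (@R_morph _ _ _ _ _ _ lx); apply: (@R_ext F^o) => l _.
  by rewrite /weigh map_mulg1 -(iF h (1%g :: l)) /= mulg1.
move=> l sl; rewrite bnd_weigh ?sl // [weigh _ (bnd _) _]/weigh cF // mulr0 addr0; reflexivity.
Qed.

Lemma reading_cls n (v : I n.+1 -> F) i : (n.+1 < N)%N -> reading (cls (lin v)) i = v i.
Proof.
move=> nN; have [lf fG fd] := pcocycle_lin v; have [fD fZ] := lf.
have [H [lH HG] HP] := R_sigma_homotopy (ltnW nN).
rewrite /reading -(@R_morph _ F^o _ (lin v)) //.
have fE : lin v (e i) = v i by apply: (@extend_e n.+1 F^o).
rewrite -[RHS]fE; apply: add2r_eq => //.
have fH : lin v (H (dd (e i))) = 0.
  rewrite (@invariant_lin n (fun y => lin v (H y))); first exact: lin_minimal.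
    by split=> [x y|k x]; case: lH => HD HZ; rewrite (HD, HZ) (fD, fZ).
  by move=> g y; rewrite HG fG.
have := fd (s (R (sigma n.+2) (e i) + e i + H (dd (e i)))).
by rewrite dds // !fD fH addr0.
Qed.

End Resolution.

End Bar.
Import Bar.

(** * Sparse linear algebra over the dual monomial basis *)

(** A pair (m, k) stands for the element dual to monomial number m times generator number k, both
    counted from 1. Lists are meant to be sorted, but soundness does not depend on it: unsorted
    lists could only make [veq] fail. *)
Definition vec := seq (positive * positive).

Definition pcmp (x y : positive * positive) : comparison :=
  match Pos.compare x.1 y.1 with Eq => Pos.compare x.2 y.2 | c => c end.

Fixpoint vxor (u : vec) : vec -> vec :=
  match u with
  | [::] => fun v => v
  | p :: u' =>
    fix aux (v : vec) : vec :=
      match v with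
      | [::] => u
      | q :: v' =>
        match pcmp p q with
        | Eq => vxor u' v'
        | Lt => p :: vxor u' v
        | Gt => q :: aux v'
        end
      end
  end.

Definition vsum (s : seq vec) : vec := foldr vxor [::] s.
Definition veq (u v : vec) : bool := if vxor u v is [::] then true else false.
Definition peq (x y : positive * positive) : bool := if pcmp x y is Eq then true else false.

Definition tree := PositiveMap.t (PositiveMap.t vec).
Definition tempty : tree := PositiveMap.empty _.

Definition tget (t : tree) (x : positive * positive) : vec :=
  if PositiveMap.find x.1 t is Some t1 then
    if PositiveMap.find x.2 t1 is Some v then v else [::]
  else [::].

Definition tset (t : tree) (x : positive * positive) (v : vec) : tree :=
  PositiveMap.add x.1
    (PositiveMap.add x.2 v
       (if PositiveMap.find x.1 t is Some t1 then t1 else PositiveMap.empty vec)) t.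

Definition tapp (t : tree) (v : vec) : vec := vsum (map (tget t) v).

Lemma peqP x y : reflect (x = y) (peq x y).
Proof.
case: x y => [x1 x2] [y1 y2]; rewrite /peq /pcmp /=.
case E1: (Pos.compare x1 y1).
- move/Pos.compare_eq: E1 => ->; case E2: (Pos.compare x2 y2).
  + by move/Pos.compare_eq: E2 => ->; constructor.
  + by constructor => -[e2]; rewrite e2 Pos.compare_refl in E2.
  + by constructor => -[e2]; rewrite e2 Pos.compare_refl in E2.
- by constructor => -[e1]; rewrite e1 Pos.compare_refl in E1.
- by constructor => -[e1]; rewrite e1 Pos.compare_refl in E1.
Qed.

Lemma pcmp_eq x y : pcmp x y = Eq -> x = y.
Proof. by move=> xy; apply/peqP; rewrite /peq xy. Qed.

Lemma tget_set t x v y : tget (tset t x v) y = if peq x y then v else tget t y.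
Proof.
case: x y => [x1 x2] [y1 y2]; case: peqP => [[<- <-]|nxy]; rewrite /tget /tset /=.
  by rewrite !PositiveMap.gss.
have [e1|ne1] := Pos.eq_dec x1 y1; last by rewrite PositiveMap.gso // => /esym.
rewrite -{}e1 in nxy *; rewrite PositiveMap.gss PositiveMap.gso; last by move=> e2; case: nxy; rewrite e2.
by case: (PositiveMap.find x1 t) => // ; rewrite PositiveMap.gempty.
Qed.

Lemma tget_empty x : tget tempty x = [::].
Proof. by rewrite /tget PositiveMap.gempty. Qed.

Section Eval.
Variables (V : zmodType) (val : positive * positive -> V).
Hypothesis V2 : forall v : V, v + v = 0.

Definition veval (v : vec) : V := \sum_(x <- v) val x.

Lemma veval_cons x v : veval (x :: v) = val x + veval v.
Proof. exact: big_cons. Qed.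

Lemma veval_xor u v : veval (vxor u v) = veval u + veval v.
Proof.
elim: u v => [|p u IHu] v /=; first by rewrite [veval [::]]big_nil add0r.
elim: v => [|q v IHv]; first by rewrite [veval [::]]big_nil addr0.
case E: (pcmp p q); rewrite ?veval_cons.
- by rewrite (pcmp_eq E) IHu addrACA V2 add0r.
- by rewrite IHu veval_cons addrA.
- by rewrite IHv veval_cons addrCA.
Qed.

Lemma veval_sum s : veval (vsum s) = \sum_(v <- s) veval v.
Proof.
elim: s => [|v s IHs]; first by rewrite [LHS]big_nil big_nil.
by rewrite /= veval_xor IHs big_cons.
Qed.

Lemma veval_eq u v : veq u v -> veval u = veval v.
Proof.
rewrite /veq => uv; have : veval (vxor u v) = 0 by case: (vxor u v) uv => // _; exact: big_nil.
by rewrite veval_xor => /add2r_eq; apply.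
Qed.

End Eval.

(** * Structure constants of the group algebra in the dual monomial basis *)

Definition idx (m : positive) : N := N.pred (Npos m).
Definition ex (m : positive) : nat := N.to_nat (N.modulo (idx m) 16).
Definition ey (m : positive) : nat := N.to_nat (N.div (idx m) 16).
(** Multiplication by a; the relation a^16 = a takes exponent 15 to exponent 1, hence the shift by
    14. *)
Definition upA (m : positive) : positive :=
  if N.eqb (N.modulo (idx m) 16) 15 then (m - 14)%positive else Pos.succ m.
(** Multiplication by b. From a^i b^3 it produces a^i b^4 = a^i b + a^(i+5), the two indices of the
    last case. *)
Definition upB (m : positive) : seq positive :=
  if N.ltb (idx m) 48 then [:: (m + 16)%positive]
  else [:: (m - 32)%positive; upA (upA (upA (upA (upA (m - 48)%positive))))].

Definition norm (v : vec) : vec := vsum [seq [:: x] | x <- v].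
(** Here a pair (m, m') is the function m(u) m'(v) of two group elements. [dA] and [dB] multiply by
    a(uv) and b(uv), so iterating them from 1 yields the coproducts of all monomials. *)
Definition dA (D : vec) : vec :=
  norm ([seq (upA x.1, x.2) | x <- D] ++ [seq (x.1, upA x.2) | x <- D]).
Definition dB (D : vec) : vec :=
  norm ([seq (m, x.2) | x <- D, m <- upB x.1] ++ [seq (x.1, m) | x <- D, m <- upB x.2]
        ++ [seq (upA (upA (upA (upA x.1))), upA x.2) | x <- D]).

Fixpoint traj (T : Type) (f : T -> T) (n : nat) (x : T) : seq T :=
  if n is n'.+1 then x :: traj f n' (f x) else [::].

Definition mon (i j : nat) : positive := Pos.of_succ_nat (i + 16 * j).

Definition coptab : seq (positive * vec) :=
  flatten [seq [seq (mon p.1 q.1, p.2) | p <- zip (iota 0 16) (traj dA 16 q.2)]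
          | q <- zip (iota 0 4) (traj dB 4 [:: (1, 1)%positive])].

Lemma zip_traj (T : Type) (f : T -> T) n k x :
  zip (iota k n) (traj f n x) = [seq (k + i, iter i f x)%N | i <- iota 0 n].
Proof.
elim: n k x => //= n IHn k x; rewrite IHn addn0; congr (_ :: _).
rewrite (iotaDl 1 0) -map_comp; apply: eq_map => i /=.
by rewrite addSnnS -iterSr.
Qed.

Lemma coptabE : coptab = flatten [seq [seq (mon i j, iter i dA (iter j dB [:: (1, 1)%positive]))
   | i <- iota 0 16] | j <- iota 0 4].
Proof.
rewrite /coptab zip_traj -map_comp; congr flatten; apply: eq_map => j.
Qed.

Definition bump (m : positive) (k : positive * positive) (t : tree) : tree :=
  tset t k (vxor [:: (m, 1%positive)] (tget t k)).

(** The transpose of the coproduct: at (m, m') it lists the monomials whose coproduct contains that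
    pair, which is the product of the two dual basis elements. *)
Definition prodt : tree := foldr (fun mD t => foldr (bump mD.1) t mD.2) tempty coptab.

Lemma veval_bump (V : zmodType) (val : positive * positive -> V) m x k t :
  (forall v : V, v + v = 0) -> veval val (tget (bump m x t) k) =
  (if peq x k then val (m, 1%positive) else 0) + veval val (tget t k).
Proof.
move=> V2; rewrite /bump tget_set; case: ifP => [/peqP <-|_]; last by rewrite add0r.
by rewrite veval_xor // {1}/veval big_seq1.
Qed.

Section Monomials.
Variables (F : fieldType) (E : finGroupType) (al be : E -> F).
Hypothesis F2 : forall x : F, x + x = 0.
Hypothesis alM : forall g h, al (g * h)%g = al g + al h.
Hypothesis beM : forall g h, be (g * h)%g = be g + be h + al g ^+ 4 * al h.
Hypothesis al16 : forall g, al g ^+ 16 = al g.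
Hypothesis be4 : forall g, be g ^+ 4 = be g + al g ^+ 5.

Definition mono (m : positive) (u : E) : F := al u ^+ ex m * be u ^+ ey m.

Lemma mono_upA m u : mono (upA m) u = al u * mono m u.
Proof.
rewrite /mono mulrA -exprS.
have [e15|n15] := N.eqb_spec (N.modulo (idx m) 16) 15.
  have -> : ey (upA m) = ey m by rewrite /upA e15 /= /ey; congr N.to_nat; move: e15; rewrite /idx; lia.
  have -> : ex (upA m) = 1 by rewrite /upA e15 /= /ex; move: e15; rewrite /idx; lia.
  have -> : ex m = 15 by rewrite /ex e15.
  by rewrite al16.
have -> : ey (upA m) = ey m.
  by rewrite /upA; case: N.eqb_spec => // _; rewrite /ey; congr N.to_nat; move: n15; rewrite /idx; lia.
have -> // : ex (upA m) = (ex m).+1.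
by rewrite /upA; case: N.eqb_spec => // _; rewrite /ex; move: n15; rewrite /idx; lia.
Qed.

Lemma mono_upB m u : \sum_(m' <- upB m) mono m' u = be u * mono m u.
Proof.
rewrite /upB; case: N.ltb_spec => m48.
  rewrite big_seq1 /mono mulrCA -exprS; congr (_ ^+ _ * _ ^+ _); rewrite /ex /ey /idx; lia.
pose a := al u ^+ ex m; pose z := be u ^+ (ey m - 3).
have e3 : ey m = (ey m - 3).+3 by move: m48; rewrite /ey /idx; lia.
have -> : mono m u = a * (z * be u ^+ 3).
  by rewrite /mono {1}e3 /z -exprD addn3.
have m32 : mono (m - 32) u = a * (z * be u).
  rewrite -exprSr; congr (_ ^+ _ * _ ^+ _); rewrite /ex /ey /idx; move: m48; rewrite /idx; lia.
have m48' : mono (m - 48) u = a * z.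
  congr (_ ^+ _ * _ ^+ _); rewrite /ex /ey /idx; move: m48; rewrite /idx; lia.
rewrite big_cons big_seq1 !mono_upA m32 m48'.
have -> : be u * (a * (z * be u ^+ 3)) = a * z * be u ^+ 4 by ring.
by rewrite be4; ring.
Qed.

Definition ev2 (u v : E) (D : vec) : F := veval (fun x => mono x.1 u * mono x.2 v) D.

Lemma ev2_norm u v D : ev2 u v (norm D) = ev2 u v D.
Proof.
rewrite /ev2 /norm veval_sum // big_map; apply: eq_bigr => x _; exact: big_seq1.
Qed.

Lemma ev2_dA u v D : ev2 u v (dA D) = al (u * v)%g * ev2 u v D.
Proof.
rewrite /dA ev2_norm /ev2 /veval big_cat !big_map alM mulrDl !big_distrr /=.
by congr (_ + _); apply: eq_bigr => x _; rewrite mono_upA; ring.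
Qed.

Lemma ev2_dB u v D : ev2 u v (dB D) = be (u * v)%g * ev2 u v D.
Proof.
rewrite /dB ev2_norm /ev2 /veval !big_cat beM !mulrDl !big_distrr /= -addrA.
rewrite !big_allpairs_dep /= big_map; congr (_ + (_ + _)); apply: eq_bigr => x _.
- by rewrite -big_distrl /= mono_upB mulrA.
- by rewrite -big_distrr /= mono_upB mulrCA.
by rewrite !mono_upA; ring.
Qed.

Definition cop i j : vec := iter i dA (iter j dB [:: (1, 1)%positive]).

Lemma mono_mon i j u : (i < 16)%N -> mono (mon i j) u = al u ^+ i * be u ^+ j.
Proof. by move=> i16; congr (_ ^+ _ * _ ^+ _); rewrite /mon /ex /ey /idx; lia. Qed.

Lemma ev2_cop i j u v : (i < 16)%N -> ev2 u v (cop i j) = mono (mon i j) (u * v)%g.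
Proof.
move=> i16; rewrite mono_mon // /cop.
have -> : ev2 u v (iter i dA (iter j dB [:: (1, 1)%positive])) =
          al (u * v)%g ^+ i * ev2 u v (iter j dB [:: (1, 1)%positive]).
  elim: i {i16} => [|i IHi]; first by rewrite mul1r.
  by rewrite iterS ev2_dA IHi exprS mulrA.
congr (_ * _); elim: j => [|j IHj]; last by rewrite iterS ev2_dB IHj exprS.
by rewrite /ev2 /veval big_seq1 /mono /ex /ey /= !expr0 !mul1r.
Qed.

Lemma veval_prodt (V : zmodType) (val : positive * positive -> V) k :
  (forall v : V, v + v = 0) ->
  veval val (tget prodt k) =
  \sum_(j <- iota 0 4) \sum_(i <- iota 0 16) \sum_(x <- cop i j)
    if peq x k then val (mon i j, 1%positive) else 0.
Proof.
move=> V2.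
have -> : veval val (tget prodt k) =
    \sum_(mD <- coptab) \sum_(x <- mD.2) if peq x k then val (mD.1, 1%positive) else 0.
  rewrite /prodt; elim: coptab => [|[m D] l IHl] /=.
    by rewrite tget_empty /veval !big_nil.
  rewrite big_cons -{}IHl /=; elim: D => [|x D IHD]; first by rewrite big_nil add0r.
  by rewrite big_cons -addrA -IHD -veval_bump.
by rewrite coptabE big_flatten big_map; apply: eq_bigr => j _; rewrite big_map.
Qed.
End Monomials.

Definition inm (m : positive) : bool := N.ltb (Npos m) 65.
Lemma coptab_range : all (fun mD => all (fun x => inm x.1 && inm x.2) mD.2) coptab.
Proof. by vm_compute. Qed.

Lemma all_flatten_map (S T : Type) (p : pred T) (f : S -> seq T) (l : seq S) :
  all p (flatten (map f l)) = all (fun x => all p (f x)) l.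
Proof. by elim: l => //= x l IHl; rewrite all_cat IHl. Qed.

Lemma all_table (p : pred (positive * positive)) (f : nat -> nat -> vec) i j :
  all (fun mD => all p mD.2)
    (flatten [seq [seq (mon i j, f i j) | i <- iota 0 16] | j <- iota 0 4]) ->
  (i < 16)%N -> (j < 4)%N -> all p (f i j).
Proof.
rewrite all_flatten_map => /allP tab i16 j4.
have /tab : j \in iota 0 4 by rewrite mem_iota.
rewrite all_map => /allP tabj.
by apply: (tabj i); rewrite mem_iota.
Qed.

Lemma cop_range i j : (i < 16)%N -> (j < 4)%N -> all (fun x => inm x.1 && inm x.2) (cop i j).
Proof. by apply: all_table; rewrite -coptabE; apply: coptab_range. Qed.

Definition exps : seq (nat * nat) := [seq (i, j) | j <- iota 0 4, i <- iota 0 16].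
Definition basis (r : nat) : vec :=
  [seq (mon p.1 p.2, Pos.of_succ_nat k) | p <- exps, k <- iota 0 r].

Definition mulv (m : positive) (v : vec) : vec :=
  vsum [seq [seq (x.1, q.2) | x <- tget prodt (m, q.1)] | q <- v].

Definition gnth (L : seq vec) (k : positive) : vec := nth [::] L (Pos.to_nat k).-1.

Definition table (f : positive * positive -> vec) (ks : vec) : tree :=
  foldr (fun k t => tset t k (f k)) tempty ks.

(** The full matrix, over the basis of dual monomials, of the module map sending the generators to
    the entries of L. *)
Definition rows (L : seq vec) : tree :=
  table (fun k => mulv k.1 (gnth L k.2)) (basis (size L)).

Lemma tget_table f ks k : tget (table f ks) k = if has (peq k) ks then f k else [::].
Proof.
elim: ks => [|x ks IHks] /=; first by rewrite tget_empty.
rewrite tget_set IHks; case: (peqP x k) => [<-|nxk]; first by case: peqP.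
by case: peqP => [kx|//]; case: nxk.
Qed.

Lemma mem_exps p : (p \in exps) = (p.1 < 16)%N && (p.2 < 4)%N.
Proof.
case: p => i j; apply/allpairsP/andP => [[[j' i'] [jP iP [-> ->]]]|[i16 j4]].
  by move: jP iP; rewrite !mem_iota.
by exists (j, i); rewrite !mem_iota.
Qed.

Lemma mon_inm p : p \in exps -> inm (mon p.1 p.2).
Proof. by rewrite mem_exps /inm /mon; case: p => i j /= /andP[i16 j4]; apply/N.ltb_spec0; lia. Qed.

Lemma inm_mon m : inm m -> exists2 p, p \in exps & m = mon p.1 p.2.
Proof.
rewrite /inm => /N.ltb_spec0 m65; exists (ex m, ey m); last by rewrite /mon /ex /ey /idx /=; lia.
by rewrite mem_exps /ex /ey /idx /=; lia.
Qed.

Lemma all_basis (p : pred (positive * positive)) r :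
  reflect (forall q k, q \in exps -> (k < r)%N -> p (mon q.1 q.2, Pos.of_succ_nat k))
    (all p (basis r)).
Proof.
apply: (iffP all_allpairsP) => H q k; first by move=> qe kr; apply: H; rewrite ?mem_iota.
by rewrite mem_iota => qe /andP[_ kr]; apply: H.
Qed.

Lemma has_basis r q k : q \in exps -> (k < r)%N ->
  has (peq (mon q.1 q.2, Pos.of_succ_nat k)) (basis r).
Proof.
move=> qe kr; apply: contraT; rewrite -all_predC => /all_basis/(_ _ _ qe kr) /=.
by case: peqP.
Qed.

Lemma basis_range r k : has (peq k) (basis r) -> inm k.1 && ((Pos.to_nat k.2).-1 < r)%N.
Proof.
have : all (fun k => inm k.1 && ((Pos.to_nat k.2).-1 < r)%N) (basis r).
  by apply/all_basis => q i qe ir; rewrite mon_inm //= SuccNat2Pos.id_succ.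
by elim: (basis r) => //= x l IHl /andP[xP lP] /orP[/peqP -> //|]; apply: IHl.
Qed.

Section Modules.
Variables (F : fieldType) (E : finGroupType) (al be : E -> F).
Hypothesis F2 : forall x : F, x + x = 0.
Hypothesis alM : forall g h, al (g * h)%g = al g + al h.
Hypothesis beM : forall g h, be (g * h)%g = be g + be h + al g ^+ 4 * al h.
Hypothesis al16 : forall g, al g ^+ 16 = al g.
Hypothesis be4 : forall g, be g ^+ 4 = be g + al g ^+ 5.
Local Notation c := (mono al be).
(** [mu m] gives the coordinates in the group basis of the element dual to monomial m. They are
    elements of [F]; the passage to F_2 happens in the structure constants. *)
Variable mu : positive -> E -> F.
Hypothesis mu_mono : forall m m', inm m' -> \sum_h mu m h * c m' h = (Pos.eqb m m')%:R.
Hypothesis mono_mu : forall h h', \sum_(p <- exps) c (mon p.1 p.2) h * mu (mon p.1 p.2) h' = (h == h')%:R.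
Hypothesis mu_out : forall m h, ~~ inm m -> mu m h = 0.

Lemma big_exps (V : zmodType) (f : nat * nat -> V) :
  \sum_(p <- exps) f p = \sum_(j <- iota 0 4) \sum_(i <- iota 0 16) f (i, j).
Proof. exact: big_allpairs_dep. Qed.

(** A function is recovered from its pairings with the monomials, by [mono_mu]; the pairing of a
    convolution with a monomial is the coproduct of that monomial evaluated on the two factors. *)
Lemma convolution m m' w :
  \sum_h mu m h * mu m' (h^-1 * w)%g = \sum_(x <- tget prodt (m, m')) mu x.1 w.
Proof.
pose phi w := \sum_h mu m h * mu m' (h^-1 * w)%g.
have -> : \sum_(x <- tget prodt (m, m')) mu x.1 w =
    \sum_(p <- exps) (\sum_u phi u * c (mon p.1 p.2) u) * mu (mon p.1 p.2) w.
  rewrite -[LHS]/(veval (fun x => mu x.1 w) _) veval_prodt // -(big_exps (fun p =>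
    \sum_(x <- cop p.1 p.2) if peq x (m, m') then mu (mon p.1 p.2) w else 0)).
  rewrite big_seq [RHS]big_seq; apply: eq_bigr => p; rewrite mem_exps => /andP[i16 j4].
  have -> : \sum_u phi u * c (mon p.1 p.2) u =
      \sum_(x <- cop p.1 p.2) (\sum_h mu m h * c x.1 h) * (\sum_h mu m' h * c x.2 h).
    transitivity (\sum_h \sum_h' mu m h * mu m' h' * c (mon p.1 p.2) (h * h')%g).
      rewrite /phi (eq_bigr _ (fun u _ => big_distrl _ _ _)) exchange_big /=.
      apply: eq_bigr => h _; rewrite (reindex_inj (mulgI h)) /=.
      by apply: eq_bigr => h' _; rewrite mulKg.
    transitivity (\sum_h \sum_h' \sum_(x <- cop p.1 p.2) (mu m h * c x.1 h) * (mu m' h' * c x.2 h')).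
      apply: eq_bigr => h _; apply: eq_bigr => h' _.
      rewrite -(ev2_cop F2 alM beM al16 be4) // /ev2 /veval big_distrr.
      by apply: eq_bigr => x _; apply: mulrACA.
    transitivity (\sum_h \sum_(x <- cop p.1 p.2) \sum_h' (mu m h * c x.1 h) * (mu m' h' * c x.2 h')).
      by apply: eq_bigr => h _; apply: exchange_big.
    rewrite exchange_big /=.
    apply: eq_bigr => x _; rewrite big_distrl; apply: eq_bigr => h _ /=.
    by rewrite big_distrr.
  have := cop_range i16 j4; elim: (cop _ _) => [|x l IHl] /=; first by rewrite !big_nil mul0r.
  move=> /andP[/andP[x1 x2] /IHl lE]; rewrite !big_cons mulrDl -lE; congr (_ + _).
  rewrite !mu_mono //; case: peqP => [->|nx] /=; first by rewrite !Pos.eqb_refl !mul1r.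
  case: Pos.eqb_spec => [e1|]; case: Pos.eqb_spec => [e2|]; rewrite ?mulr0 ?mul0r //.
  by case: nx; case: (x) e1 e2 => a b /= -> ->.
transitivity (\sum_u phi u * \sum_(p <- exps) c (mon p.1 p.2) u * mu (mon p.1 p.2) w).
  rewrite -/(phi w) [RHS](bigD1 w) //= mono_mu eqxx mulr1 big1 ?addr0 // => u uw.
  by rewrite mono_mu (negbTE uw) mulr0.
rewrite (eq_bigr _ (fun u _ => big_distrr _ _ _)) exchange_big /=.
apply: eq_bigr => p _; rewrite big_distrl; apply: eq_bigr => u _ /=; exact: mulrA.
Qed.
End Modules.

(** * Free modules over the group algebra *)

Module Free.
Lemma of_succ_to_nat k : Pos.of_succ_nat (Pos.to_nat k).-1 = k.
Proof. lia. Qed.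

Section Free.
Variables (F : fieldType) (E : finGroupType) (al be : E -> F).
Hypothesis F2 : forall x : F, x + x = 0.
Hypothesis alM : forall g h, al (g * h)%g = al g + al h.
Hypothesis beM : forall g h, be (g * h)%g = be g + be h + al g ^+ 4 * al h.
Hypothesis al16 : forall g, al g ^+ 16 = al g.
Hypothesis be4 : forall g, be g ^+ 4 = be g + al g ^+ 5.
Local Notation c := (mono al be).
Variable mu : positive -> E -> F.
Hypothesis mu_mono : forall m m', inm m' -> \sum_h mu m h * c m' h = (Pos.eqb m m')%:R.
Hypothesis mono_mu : forall h h', \sum_(p <- exps) c (mon p.1 p.2) h * mu (mon p.1 p.2) h' = (h == h')%:R.
Hypothesis mu_out : forall m h, ~~ inm m -> mu m h = 0.

Variable rk : nat -> nat.
Definition P n : lmodType F := {ffun 'I_(rk n) * E -> F^o}.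
Definition A n : lmodType F := if n is n'.+1 then P n' else F^o.
Definition act n (g : E) : A n -> A n :=
  if n is n'.+1 then fun x : P n' => [ffun p => x (p.1, (g^-1 * p.2)%g)] : P n' else fun x => x.
Definition I n : finType := 'I_(rk n).
Definition co n (x : A n.+1) (i : I n) (h : E) : F := (x : P n) (i, h).
Definition e n (i : I n) : A n.+1 := [ffun p => (p == (i, 1%g))%:R] : P n.
Definition one : A 0 := (1 : F).
Definition aug (x : A 0) : F := x.

Lemma actD n g : {morph @act n g : x y / x + y}.
Proof. by case: n => // n x y; apply/ffunP => p; rewrite !ffunE. Qed.
Lemma actZ n g (k : F) x : act g (k *: x) = k *: act (n:=n) g x.
Proof. by case: n x => // n x; apply/ffunP => p; rewrite !ffunE. Qed.
Lemma act1 n x : act (n:=n) 1%g x = x.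
Proof. by case: n x => // n x; apply/ffunP => -[i h]; rewrite !ffunE invg1 mul1g. Qed.
Lemma actM n g h x : act (n:=n) (g * h)%g x = act g (act h x).
Proof. by case: n x => // n x; apply/ffunP => -[i k]; rewrite !ffunE invMg mulgA. Qed.
Lemma act_one g : act g one = one. Proof. by []. Qed.

Lemma coD n x y i h : co (n:=n) (x + y) i h = co x i h + co y i h.
Proof. by rewrite /co ffunE. Qed.
Lemma coZ n k x i h : co (n:=n) (k *: x) i h = k * co x i h.
Proof. by rewrite /co ffunE. Qed.
Lemma co_act n g x i h : co (n:=n) (act g x) i h = co x i (g^-1 * h)%g.
Proof. by rewrite /co ffunE. Qed.
Lemma co_e n i j h : co (e (n:=n) i) j h = ((i == j) && (h == 1%g))%:R.
Proof. by rewrite /co ffunE xpair_eqE eq_sym. Qed.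
Lemma co_sum n x : x = \sum_i \sum_h co (n:=n) x i h *: act h (e i).
Proof.
apply/ffunP => -[j k]; rewrite sum_ffunE (bigD1 j) //= [X in _ + X]big1 => [|i ij].
  rewrite addr0 sum_ffunE (bigD1 k) //= big1 => [|h hk].
    by rewrite !ffunE /= mulVg eqxx addr0 /GRing.scale /= mulr1.
  rewrite !ffunE /= xpair_eqE eqxx /= -eq_mulVg1 (negbTE hk); exact: scaler0.
rewrite sum_ffunE big1 // => h _.
rewrite !ffunE /= xpair_eqE eq_sym (negbTE ij); exact: scaler0.
Qed.

Lemma augE x : x = aug x *: one. Proof. by rewrite /aug /GRing.scale /= mulr1. Qed.
Lemma augD : {morph aug : x y / x + y}. Proof. by []. Qed.
Lemma augZ k x : aug (k *: x) = k * aug x. Proof. by []. Qed.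
Lemma aug1 : aug one = 1. Proof. by []. Qed.

Lemma P2 n (x : P n) : x + x = 0.
Proof. by apply/ffunP => p; rewrite !ffunE F2. Qed.

Definition vval n (q : positive * positive) : P n :=
  [ffun p : 'I_(rk n) * E => if Pos.eqb (Pos.of_succ_nat p.1) q.2 then mu q.1 p.2 else 0].
Local Notation vv n := (veval (vval n)).

Lemma act_sum n h (J : Type) (r : seq J) (f : J -> A n) :
  act h (\sum_(j <- r) f j) = \sum_(j <- r) act h (f j).
Proof.
by apply: (big_morph (act h)) => [x y|]; [exact: actD | rewrite -(scale0r 0) actZ !scale0r].
Qed.

Lemma mulvE n m v : \sum_h mu m h *: act (n := n.+1) h (vv n v) = vv n (mulv m v).
Proof.
rewrite /mulv veval_sum; last exact: P2.
rewrite big_map (eq_bigr (fun h => \sum_(q <- v) mu m h *: act (n := n.+1) h (vval n q))); last first.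
  by move=> h _; rewrite /veval act_sum scaler_sumr.
rewrite exchange_big /=; apply: eq_bigr => q _; rewrite /veval big_map.
apply/ffunP => -[i w]; rewrite !sum_ffunE.
transitivity (if Pos.eqb (Pos.of_succ_nat i) q.2 then \sum_h mu m h * mu q.1 (h^-1 * w)%g else 0).
  case: ifP => iq; last first.
    by rewrite big1 // => h _; rewrite !ffunE iq scaler0.
  by apply: eq_bigr => h _; rewrite !ffunE iq.
rewrite (convolution F2 alM beM al16 be4 mu_mono mono_mu).
case: ifP => iq; last by rewrite big1 // => x _; rewrite ffunE iq.
by apply: eq_bigr => x _; rewrite ffunE iq.
Qed.

Definition bar n n' (L : seq vec) : A n.+1 -> A n'.+1 :=
  @extend F E A I co n (A n'.+1) (fun i h => act h (vv n' (nth [::] L i) : A n'.+1)).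

Arguments bar : clear implicits.

Lemma linear_bar n n' L : linear_map (bar n n' L).
Proof. exact: (linear_extend coD coZ). Qed.

Lemma bar_e n n' L i : bar n n' L (e i) = vv n' (nth [::] L i).
Proof. by rewrite /bar (extend_e co_e) act1. Qed.

Lemma bar_act n n' L g x : bar n n' L (act g x) = act g (bar n n' L x).
Proof.
rewrite /bar (extend_act co_act) /extend act_sum; apply: eq_bigr => i _.
by rewrite act_sum; apply: eq_bigr => h _; rewrite actZ actM.
Qed.

Lemma nth_gnth (L : seq vec) i : nth [::] L i = gnth L (Pos.of_succ_nat i).
Proof. by rewrite /gnth SuccNat2Pos.id_succ. Qed.

Lemma bar_vval n n' L q : size L = rk n -> bar n n' L (vval n q) = vv n' (tget (rows L) q).
Proof.
move=> sL; rewrite /rows tget_table; have [qb|] := boolP (has (peq q) _).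
  have /andP[q1 qr] := basis_range qb; rewrite sL in qr.
  rewrite -mulvE /bar /extend (bigD1 (Ordinal qr)) //= [X in _ + X]big1 ?addr0 => [|i iq].
    have qE : Pos.of_succ_nat (Pos.to_nat q.2).-1 = q.2 by exact: of_succ_to_nat.
    by apply: eq_bigr => h _; rewrite /co ffunE /= nth_gnth qE Pos.eqb_refl.
  rewrite big1 // => h _; rewrite /co ffunE; case: Pos.eqb_spec => [iE|_]; last exact: scale0r.
  by case/eqP: iq; apply: val_inj => /=; rewrite -iE SuccNat2Pos.id_succ.
move=> qb; rewrite [RHS]big_nil /bar /extend big1 // => i _; rewrite big1 // => h _.
rewrite /co ffunE; case: Pos.eqb_spec => [iE|_]; last exact: scale0r.
rewrite mu_out ?scale0r //; apply: contra qb => /inm_mon[p pe q1].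
have ir : (i < size L)%N by rewrite sL.
by have := has_basis pe ir; rewrite -q1 /= iE; case: (q).
Qed.

Lemma linear_vv n (W : lmodType F) (f : A n.+1 -> W) v : linear_map f ->
  f (vv n v) = \sum_(q <- v) f (vval n q).
Proof.
move=> lf; have [fD _] := lf; rewrite /veval; apply: (big_morph f fD (linear_map0 lf)).
Qed.

Lemma bar_vv n n' L v : size L = rk n -> bar n n' L (vv n v) = vv n' (tapp (rows L) v).
Proof.
move=> sL; rewrite (linear_vv _ (linear_bar _ _ _)) /tapp veval_sum; last exact: P2.
by rewrite big_map; apply: eq_bigr => q _; apply: bar_vval.
Qed.

(** The augmentation is the pairing with the constant monomial, number 1. Minimality of the
    resolution thus means that index 1 does not occur in the boundaries. *)
Lemma aug_vval n q i : \sum_h co (vval n q : A n.+1) i h =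
  (Pos.eqb (Pos.of_succ_nat i) q.2 && Pos.eqb q.1 1)%:R.
Proof.
transitivity (\sum_h if Pos.eqb (Pos.of_succ_nat i) q.2 then mu q.1 h else 0).
  by apply: eq_bigr => h _; rewrite /co ffunE.
case: (Pos.eqb _ q.2); last exact: big1.
rewrite /=.
rewrite -(mu_mono q.1 (m' := 1)) //; apply: eq_bigr => h _.
by rewrite /mono /ex /ey /= !expr0 !mulr1.
Qed.

Lemma co_bigsum n (J : Type) (r : seq J) (f : J -> A n.+1) i h :
  co (\sum_(j <- r) f j) i h = \sum_(j <- r) co (f j) i h.
Proof.
apply: (big_morph (fun x => co x i h)) => [x y|]; first exact: coD.
by rewrite /co ffunE.
Qed.

Definition coef n (p : nat * nat) (i : I n) (x : A n.+1) : F := \sum_h c (mon p.1 p.2) h * co x i h.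

Definition vval_at n (p : nat * nat) (i : I n) : A n.+1 := vval n (mon p.1 p.2, Pos.of_succ_nat i).

Lemma coef_sum n (x : A n.+1) : x = \sum_i \sum_(p <- exps) coef p i x *: vval_at p i.
Proof.
apply/ffunP => -[j k]; rewrite sum_ffunE (bigD1 j) //= [X in _ + X]big1 ?addr0 => [|i ij]; last first.
  rewrite sum_ffunE big1_seq // => p _; rewrite !ffunE /=.
  case: Pos.eqb_spec => [ijE|_]; last exact: scaler0.
  case/eqP: ij; apply: val_inj => /=; by apply: SuccNat2Pos.inj; rewrite ijE.
rewrite -[RHS]/(co _ j k) (co_bigsum (n := n)); transitivity (\sum_h (h == k)%:R * co x j h).
  rewrite (bigD1 k) //= eqxx mul1r big1 ?addr0 // => h hk.
  by rewrite (negbTE hk) mul0r.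
rewrite (eq_bigr (fun h => \sum_(p <- exps) c (mon p.1 p.2) h * mu (mon p.1 p.2) k * co x j h)).
  rewrite exchange_big /=; apply: eq_bigr => p _.
  rewrite coZ {2}/co ffunE /= Pos.eqb_refl /coef big_distrl; apply: eq_bigr => h _ /=; exact: mulrAC.
by move=> h _; rewrite -mono_mu big_distrl.
Qed.

Lemma linear_coef n p i : @linear_map F (A n.+1) F^o (coef p i).
Proof.
split=> [x y|k x]; rewrite /coef.
  by rewrite -big_split; apply: eq_bigr => h _; rewrite coD mulrDr.
rewrite scaler_sumr; apply: eq_bigr => h _; rewrite coZ; exact: mulrCA.
Qed.

Lemma linear_mapD (V W : lmodType F) (f g : V -> W) :
  linear_map f -> linear_map g -> linear_map (fun x => f x + g x).
Proof.
move=> [fD fZ] [gD gZ]; split=> [x y|k x]; first by rewrite fD gD addrACA.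
by rewrite fZ gZ scalerDr.
Qed.

Lemma linear_eq0 n (W : lmodType F) (f : A n.+1 -> W) x : linear_map f ->
  (forall p i, p \in exps -> f (vval_at p i) = 0) -> f x = 0.
Proof.
move=> lf f0; have [fD fZ] := lf; rewrite [x]coef_sum (linear_map_sum _ lf) big1 // => i _.
rewrite (big_morph f fD (linear_map0 lf)) big1_seq // => p /andP[_ pe].
by rewrite fZ f0 ?scaler0.
Qed.

Variables (gens : nat -> seq vec) (S : nat -> tree) (N : nat).
Hypothesis size_gens : forall n, size (gens n) = rk n.+1.
Hypothesis rk0 : rk 0 = 1%N.
Hypothesis gens_gens : forall n, all (fun v => veq (tapp (rows (gens n)) v) [::]) (gens n.+1).
Hypothesis gens_minimal : forall n, all (all (fun q => ~~ Pos.eqb q.1 1)) (gens n).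
Hypothesis S_out : forall n q, ~~ has (peq q) (basis (rk n)) -> tget (S n) q = [::].
Hypothesis gens_S0 :
  all (fun q => veq (tapp (rows (gens 0)) (tget (S 0) q))
                    (if Pos.eqb q.1 1 then [::] else [:: q])) (basis (rk 0)).
Hypothesis gens_S : forall n, (n.+1 < N)%N ->
  all (fun q => veq (tapp (rows (gens n.+1)) (tget (S n.+1) q))
                    (vxor [:: q] (tapp (S n) (tget (rows (gens n)) q)))) (basis (rk n.+1)).

Definition dd n : A n -> A n.-1 :=
  match n with
  | 0 => fun _ => 0
  | 1 => fun x : A 1 => \sum_i \sum_h co x i h
  | n.+2 => bar n.+1 n (gens n)
  end.

Definition s n : A n -> A n.+1 :=
  match n with
  | 0 => fun x : A 0 => x *: (vval 0 (1, 1)%positive : A 1)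
  | n.+1 => fun x : A n.+1 => \sum_i \sum_(p <- exps)
      coef p i x *: (vv n.+1 (tget (S n) (mon p.1 p.2, Pos.of_succ_nat i)) : A n.+2)
  end.

Lemma ddl n : linear_map (@dd n).
Proof.
case: n => [|[|n]] /=; last exact: linear_bar.
  by split=> [x y|k x]; rewrite ?addr0 ?scaler0.
split=> [x y|k x].
  rewrite -big_split; apply: eq_bigr => i _; rewrite -big_split; apply: eq_bigr => h _; exact: coD.
rewrite scaler_sumr; apply: eq_bigr => i _; rewrite scaler_sumr; apply: eq_bigr => h _; exact: coZ.
Qed.

Lemma ddD n : {morph @dd n : x y / x + y}. Proof. by case: (ddl n). Qed.
Lemma ddZ n (k : F) x : dd (k *: x) = k *: dd (n:=n) x. Proof. by case: (ddl n). Qed.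
Lemma dd_act n g x : dd (act g x) = act g (dd (n:=n) x).
Proof.
case: n x => [|[|n]] x //=; last exact: bar_act.
apply: eq_bigr => i _; rewrite (reindex_inj (mulgI g)); apply: eq_bigr => h _.
by rewrite co_act mulKg.
Qed.
Lemma dd0 (x : A 0) : dd x = 0. Proof. by []. Qed.

Lemma sl n : linear_map (@s n).
Proof.
case: n => [|n] /=.
  by split=> [x y|k x]; [apply: scalerDl | rewrite scalerA].
split=> [x y|k x].
  rewrite -big_split; apply: eq_bigr => i _; rewrite -big_split; apply: eq_bigr => p _.
  by have [-> _] := @linear_coef n p i; apply: scalerDl.
rewrite scaler_sumr; apply: eq_bigr => i _; rewrite scaler_sumr; apply: eq_bigr => p _.
by have [_ ->] := @linear_coef n p i; rewrite scalerA.
Qed.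

Lemma count_mon : all (fun p0 => count (fun p => Pos.eqb (mon p0.1 p0.2) (mon p.1 p.2)) exps == 1%N) exps.
Proof. by vm_compute. Qed.

Lemma coef_vval n p i q : p \in exps -> coef (n := n) p i (vval n q) =
  (Pos.eqb (Pos.of_succ_nat i) q.2 && Pos.eqb q.1 (mon p.1 p.2))%:R.
Proof.
move=> pe; transitivity (\sum_h if Pos.eqb (Pos.of_succ_nat i) q.2 then mu q.1 h * c (mon p.1 p.2) h else 0).
  by apply: eq_bigr => h _; rewrite /co ffunE; case: ifP => _; rewrite ?mulr0 // mulrC.
case: (Pos.eqb _ q.2); last exact: big1.
by rewrite mu_mono // mon_inm.
Qed.

Lemma s_vval n q : s (vval n q : A n.+1) = vv n.+1 (tget (S n) q).
Proof.
rewrite /s; transitivity (\sum_(i < rk n) \sum_(p <- exps)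
   (Pos.eqb (Pos.of_succ_nat i) q.2 && Pos.eqb q.1 (mon p.1 p.2))%:R *: (vv n.+1 (tget (S n) q))).
  apply: eq_bigr => i _; rewrite big_seq [RHS]big_seq; apply: eq_bigr => p pe.
  rewrite coef_vval //; case: Pos.eqb_spec => [i2|_]; last by rewrite !scale0r.
  case: Pos.eqb_spec => [i1|_]; last by rewrite !scale0r.
  by rewrite i2 -i1; case: (q).
have [qb|/S_out ->] := boolP (has (peq q) (basis (rk n))); last first.
  by rewrite [RHS]big_nil big1 // => i _; rewrite big1 // => p _; rewrite /veval big_nil scaler0.
have /andP[q1 qr] := basis_range qb.
rewrite (bigD1 (Ordinal qr)) //= [X in _ + X]big1 => [|i iq]; last first.
  rewrite big1 // => p _; case: Pos.eqb_spec => [iE|_]; last exact: scale0r.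
  by case/eqP: iq; apply: val_inj => /=; rewrite -iE SuccNat2Pos.id_succ.
have -> : Pos.of_succ_nat (Pos.to_nat q.2).-1 = q.2 by exact: of_succ_to_nat.
rewrite Pos.eqb_refl /= addr0 -scaler_suml -[RHS]scale1r; congr (_ *: _).
have [p pe ->] := inm_mon q1.
have /eqP cnt := allP count_mon p pe; rewrite -sum1_count big_mkcond in cnt.
by rewrite -[RHS]/(1%:R) -[X in _ = X%:R]cnt natr_sum; apply: eq_bigr => q' _; case: ifP.
Qed.

Lemma s_vv n v : s (vv n v : A n.+1) = vv n.+1 (tapp (S n) v).
Proof.
rewrite (linear_vv _ (sl _)) /tapp veval_sum; last exact: P2.
by rewrite big_map; apply: eq_bigr => q _; apply: s_vval.
Qed.

Lemma all_has_peq (p : pred (positive * positive)) v q : all p v -> has (peq q) v -> p q.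
Proof.
by elim: v => //= x v IHv /andP[px /IHv pv] /orP[/peqP -> //|].
Qed.

Lemma gens_nth n (i : I n.+1) v (p : pred vec) : all p (gens n) -> p (nth v (gens n) i).
Proof. by move=> /all_nthP; apply; rewrite size_gens ltn_ord. Qed.

Lemma big1_all (T : Type) (V : zmodType) (p : pred T) (f : T -> V) (v : seq T) :
  all p v -> (forall q, p q -> f q = 0) -> \sum_(q <- v) f q = 0.
Proof.
move=> pv f0; elim: v pv => [|q v IHv] /=; first by rewrite big_nil.
by move=> /andP[/f0 q0 /IHv v0]; rewrite big_cons q0 v0 addr0.
Qed.

Lemma gens_minimal_sum n (j : I n.+1) k : \sum_h co (dd (e j)) k h = 0.
Proof.
rewrite /= bar_e (eq_bigr _ (fun h _ => co_bigsum _ _ _ _)) exchange_big /=.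
have vP := gens_nth j [::] (gens_minimal n).
by apply: big1_all vP _ => q /negbTE q1; rewrite aug_vval q1 andbF.
Qed.

Lemma act0 n h : act h (0 : A n) = 0.
Proof. by rewrite -(scale0r (0 : A n)) actZ !scale0r. Qed.

Lemma eq0_on_e n m (f : A n.+1 -> A m) x : linear_map f ->
  (forall g y, f (act g y) = act g (f y)) -> (forall i, f (e i) = 0) -> f x = 0.
Proof.
move=> lf fG f0; rewrite (extend_id co_sum x lf) /extend big1 // => i _; rewrite big1 // => h _.
by rewrite fG f0 act0 scaler0.
Qed.

Lemma ddd n (x : A n.+1) : dd (dd x) = 0.
Proof.
case: n x => [|n] x //; apply: (@eq0_on_e n.+1 n (fun x => dd (dd x))) => [|g y|i].
- exact: linear_map_comp (ddl _) (ddl _).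
- by rewrite !dd_act.
(* At the bottom, [dd] is the augmentation, and it vanishes on boundaries by minimality. *)
case: n i {x} => [|n] i; first by apply: big1 => k _; apply: gens_minimal_sum.
rewrite -[dd _]/(bar n.+1 n (gens n) (bar n.+2 n.+1 (gens n.+1) (e i))).
rewrite bar_e bar_vv; last by rewrite size_gens.
have := gens_nth i [::] (gens_gens n); move/(veval_eq (vval n) (@P2 n)) ->.
exact: big_nil.
Qed.

Lemma ord_rk0 (i : 'I_(rk 0)) : i = 0%N :> nat.
Proof. by apply/eqP; rewrite -leqn0 -ltnS -[X in (_ < X)%N]rk0 ltn_ord. Qed.

(** The identity dd s + s dd = 1 is linear, hence follows from the check on basis vectors, and on a
    cycle it gives the claim. In the lowest degree s dd is the augmentation times the element dual
    to the constant monomial. *)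
Lemma dds n (x : A n) : (n <= N)%N -> dd x = 0 -> dd (s x) = x.
Proof.
case: n x => [|n] x nN.
  move=> _; rewrite /dd /s; transitivity (\sum_(i < rk 0) x * (Pos.eqb (Pos.of_succ_nat i) 1)%:R).
    apply: eq_bigr => i _; rewrite (eq_bigr _ (fun h _ => coZ _ _ _ _)) -big_distrr /=.
    by rewrite aug_vval andbT.
  by rewrite rk0 big_ord_recl big_ord0 addr0 mulr1.
move=> dx; apply: add2r_eq; first exact: P2.
case: n x nN dx => [|n] x nN dx.
  have -> : dd (s x) + x = dd (s x) + (x + (dd x : F) *: (vval 0 (1, 1)%positive : A 1)).
    by rewrite dx scale0r addr0.
apply: (@linear_eq0 0 (A 1) (fun x => dd (s x) + (x + (dd x : F) *: (vval 0 (1, 1)%positive : A 1)))).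
    apply: (@linear_mapD (A 1) (A 1)); first exact: linear_map_comp (ddl _) (sl _).
    apply: (@linear_mapD (A 1) (A 1)); first by split.
    by have [lD lZ] := ddl 1; split=> [y z|k y]; rewrite ?lD ?lZ ?scalerDl ?scalerA.
  move=> p i pe; rewrite /vval_at; set q := (_, _).
  have qb : has (peq q) (basis (rk 0)) by apply: has_basis.
  have -> : dd (s (vval 0 q : A 1)) = vv 0 (if Pos.eqb q.1 1 then [::] else [:: q]).
    rewrite s_vval -[dd _]/(bar 1 0 (gens 0) _) bar_vv ?size_gens //.
    apply: veval_eq; first exact: P2.
    exact: (all_has_peq gens_S0 qb).
  have -> : dd (vval 0 q : A 1) = (Pos.eqb q.1 1)%:R.
    rewrite /dd (bigD1 i) //= [X in _ + X]big1 ?addr0 => [|j ji]; first by rewrite aug_vval Pos.eqb_refl.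
    by case/eqP: ji; apply: val_inj; exact: etrans (ord_rk0 j) (esym (ord_rk0 i)).
  case: Pos.eqb_spec => [q1|_].
    rewrite scale1r /veval big_nil add0r; have -> : q = (1, 1)%positive.
      by move: q1; rewrite /q /= (ord_rk0 i) => ->.
    exact: P2.
  by rewrite scale0r addr0 /veval big_seq1; apply: P2.
have -> : dd (s x) + x = dd (s x) + (x + s (dd x)).
  by rewrite dx (linear_map0 (sl _)) addr0.
apply: (@linear_eq0 n.+1 (A n.+2) (fun x => dd (s x) + (x + s (dd x)))).
  apply: (@linear_mapD (A n.+2) (A n.+2)); first exact: linear_map_comp (ddl _) (sl _).
  apply: (@linear_mapD (A n.+2) (A n.+2)); first by split.
  exact: linear_map_comp (sl _) (ddl n.+2).
move=> p i pe; rewrite /vval_at; set q := (_, _).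
have qb : has (peq q) (basis (rk n.+1)) by apply: has_basis.
have -> : dd (s (vval n.+1 q : A n.+2)) =
    vv n.+1 (vxor [:: q] (tapp (S n) (tget (rows (gens n)) q))).
  rewrite s_vval -[dd _]/(bar n.+2 n.+1 (gens n.+1) _) bar_vv ?size_gens //.
  by apply: veval_eq; [exact: P2 | exact: (all_has_peq (gens_S nN) qb)].
have -> : s (dd (vval n.+1 q : A n.+2)) = vv n.+1 (tapp (S n) (tget (rows (gens n)) q)).
  by rewrite -[dd _]/(bar n.+1 n (gens n) _) bar_vval ?size_gens // s_vv.
by rewrite veval_xor ?{1}/veval ?big_seq1 => [|v]; exact: P2.
Qed.

(** * Cohomology classes in coordinates *)

Local Notation lin := (@lin F E A I co).
Local Notation cls := (@cls F E A act s one).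
Local Notation pcocycle := (@pcocycle F E A act dd).
Local Notation cob := (@cob F E).
Local Notation cocyc := (@cocyc F E).

Definition at_pos n (v : I n -> F) (k : positive) : F :=
  \sum_(i < rk n) if Pos.eqb (Pos.of_succ_nat i) k then v i else 0.

Lemma sum_co_vval n (x : E -> F) (v : I n -> F) m q : inm m -> (forall h, x h = c m h) ->
  \sum_i \sum_h co (vval n q : A n.+1) i h * (x h * v i) =
  if Pos.eqb q.1 m then at_pos v q.2 else 0.
Proof.
move=> mi xE; transitivity (\sum_(i < rk n)
    if Pos.eqb (Pos.of_succ_nat i) q.2 then (Pos.eqb q.1 m)%:R * v i else 0).
  apply: eq_bigr => i _; rewrite -(mu_mono _ mi) big_distrl /=.
  transitivity (\sum_h if Pos.eqb (Pos.of_succ_nat i) q.2 then mu q.1 h * (x h * v i) else 0).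
    by apply: eq_bigr => h _; rewrite /co ffunE; case: ifP; rewrite ?mul0r.
  case: (Pos.eqb _ q.2); last by rewrite big1.
  by apply: eq_bigr => h _; rewrite xE mulrA.
case: (Pos.eqb q.1 m).
  by apply: eq_bigr => i _; rewrite mul1r.
by rewrite big1 // => i _; rewrite mul0r if_same.
Qed.

Lemma linear_lin n (v : I n -> F) : linear_map (lin v).
Proof. exact: (linear_extend coD coZ). Qed.

Lemma eq_lin n (v w : I n -> F) x : v =1 w -> lin v x = lin w x.
Proof. by move=> vw; apply: eq_bigr => i _; apply: eq_bigr => h _; rewrite vw. Qed.

Lemma lin_vval n (v : I n -> F) q : lin v (vval n q) = if Pos.eqb q.1 1 then at_pos v q.2 else 0.
Proof.
rewrite -(@sum_co_vval n (fun _ => 1)) // => [|h]; last by rewrite /mono /ex /ey /= !expr0 mulr1.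
by apply: eq_bigr => i _; apply: eq_bigr => h _; rewrite mul1r.
Qed.

Lemma lin_vv n (v : I n -> F) u :
  lin v (vv n u) = \sum_(q <- u) if Pos.eqb q.1 1 then at_pos v q.2 else 0.
Proof.
rewrite (linear_vv _ (linear_lin v)); apply: eq_bigr => q _; exact: lin_vval.
Qed.

(** When x is monomial number m, pairing with x selects the terms of index m in the boundary. *)
Lemma xmul_vval (x : E -> F) m n (v : I n -> F) j : inm m -> (forall h, x h = c m h) ->
  xmul dd e co x v j = \sum_(q <- nth [::] (gens n) j) if Pos.eqb q.1 m then at_pos v q.2 else 0.
Proof.
move=> mi xE; rewrite /xmul -[dd _]/(bar n.+1 n (gens n) _) bar_e.
have lx : linear_map (xlin co x v) by exact: (linear_extend coD coZ).
rewrite (linear_vv _ lx); apply: eq_bigr => q _; exact: sum_co_vval.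
Qed.

Definition pcocycle_cl n (v : I n -> F) : pcocycle (lin v) :=
  pcocycle_lin ddD ddZ dd_act coD coZ co_act co_sum gens_minimal_sum v.

Lemma cocyc_cl n (v : I n -> F) : (n < N)%N -> cocyc n (cls (lin v)).
Proof.
move=> nN; exact: (cocyc_cls F2 actD actZ act1 actM act_one ddD ddZ dd_act dd0 dds nN (pcocycle_cl v)).
Qed.

Lemma xcup_cl n x (v : I n -> F) w : (forall g h, x (g * h)%g = x g + x h) -> (n < N)%N ->
  (forall j, xmul dd e co x v j = w j) -> cob n.+1 (fun l => xcup x (cls (lin v)) l + cls (lin w) l).
Proof.
move=> xM nN vw.
have := xcup_cls F2 actD actZ act1 actM act_one ddD ddZ dd_act dd0 dds coD coZ co_act co_sum gens_minimal_sum v xM nN.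
apply: cob_ext => l _; congr (_ + _); exact: eq_lin.
Qed.

Lemma reading_cl n (v : I n.+1 -> F) i : (n.+1 < N)%N -> reading dd e co aug (cls (lin v)) i = v i.
Proof.
exact: (reading_cls F2 actD actZ act1 actM act_one ddD ddZ dd_act dd0 ddd dds coD coZ co_act co_sum co_e augE augD augZ gens_minimal_sum).
Qed.

Lemma dd_vv0 u : dd (vv 0 u : A 1) = \sum_(x <- u) (Pos.eqb x.2 1 && Pos.eqb x.1 1)%:R.
Proof.
rewrite (linear_vv _ (ddl 1)); apply: eq_bigr => x _; rewrite /dd.
rewrite (eq_bigr _ (fun i _ => aug_vval _ _)).
transitivity (\sum_(i < rk 0) (Pos.eqb x.2 1 && Pos.eqb x.1 1)%:R : F).
  by apply: eq_bigr => i _; rewrite (ord_rk0 i) Pos.eqb_sym.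
by rewrite rk0 big_ord_recl big_ord0 addr0.
Qed.

Section Product.
Variables (q : nat) (wgens : nat -> seq vec) (w : I q -> F).
Hypothesis wgens0 : forall j,
  w j = \sum_(x <- nth [::] (wgens 0) j) (Pos.eqb x.2 1 && Pos.eqb x.1 1)%:R.

Lemma scup_cl n (v : I n -> F) (u : I (n + q) -> F) :
  (n + q <= N)%N -> (n < N)%N -> (q < N)%N ->
  (forall i, (i < n)%N -> size (wgens i) = rk (i + q)%N) ->
  (forall i, (i < n)%N -> all2 (fun x y => veq (tapp (rows (gens i)) x) (tapp (rows (wgens i)) y))
      (wgens i.+1) (gens (i + q)%N)) ->
  (forall j, u j = \sum_(x <- nth [::] (wgens n) j) if Pos.eqb x.1 1 then at_pos v x.2 else 0) ->
  cob (n + q) (fun l => scup n (cls (lin v)) (cls (lin w)) l + cls (lin u) l).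
Proof.
move=> nqN nN qN size_wgens wP uE; pose W i : A (i + q).+1 -> A i.+1 := bar (i + q) i (wgens i).
have lW i : linear_map (W i) by exact: linear_bar.
have GW i g x : W i (act g x) = act g (W i x) by exact: bar_act.
have := scup_cls F2 actD actZ act1 actM act_one ddD ddZ dd_act dd0 dds nqN nN qN
  (pcocycle_cl v) (pcocycle_cl w) lW GW.
move=> H; apply: cob_ext (H _ _).
- move=> l _; congr (_ + _); rewrite /Bar.cls.
  rewrite (invariant_lin co_sum _ (linear_map_comp (linear_lin v) (lW n))).
    apply: eq_lin => j; rewrite /W bar_e lin_vv uE //.
  by move=> g x; rewrite GW; case: (pcocycle_cl v).
- move=> x; transitivity (lin w x : A 0); last exact: augE.
  rewrite (invariant_lin co_sum _ (linear_map_comp (ddl 1) (lW 0))).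
    by apply: eq_lin => j; rewrite /W bar_e dd_vv0 wgens0.
  by move=> g y; rewrite GW dd_act.
- move=> i x lin_; apply: add2r_eq => [|//]; first exact: P2.
  apply: (@eq0_on_e (i.+1 + q) i.+1 (fun x => dd (W i.+1 x) + W i (dd x))).
  + apply: (@linear_mapD (A (i.+1 + q).+1) (A i.+1)); first exact: linear_map_comp (ddl _) (lW _).
    exact: linear_map_comp (lW i) (ddl (i + q).+2).
  + by move=> g y; rewrite GW dd_act actD; congr (_ + _); rewrite -GW; congr (W i _); exact: (@dd_act (i + q).+2 g y).
  move=> j.
  rewrite -[dd _]/(bar i.+1 i (gens i) (bar (i.+1 + q) i.+1 (wgens i.+1) (e j))).
  rewrite -[W i _]/(bar (i + q) i (wgens i) (bar (i + q).+1 (i + q) (gens (i + q)) (e j))).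
  rewrite !bar_e bar_vv ?size_gens // bar_vv ?size_wgens //.
  have := wP i lin_; rewrite all2E => /andP[/eqP sz] /(all_nthP ([::], [::]))/(_ j).
  rewrite size_zip sz minnn size_gens nth_zip // => /(_ (ltn_ord j)) /=.
  move/(veval_eq (vval i) (@P2 _)) => ->; exact: P2.
Qed.
End Product.

(** * The Frobenius twist *)

Definition pw (p : nat * nat) : seq positive :=
  iter (4 * p.1) (map upA)
    (iter p.2 (fun l => flatten (map upB l) ++ iter 5 (map upA) l) [:: 1%positive]).

Definition pwtab : seq (positive * seq positive) := [seq (mon p.1 p.2, pw p) | p <- exps].
(** The transpose of the fourth power map: the monomials whose fourth power contains m with odd
    multiplicity. *)
Definition frobm (m : positive) : seq positive :=
  [seq w.1 | w <- pwtab & odd (count (Pos.eqb m) w.2)].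

Definition frobv (v : vec) : vec := flatten [seq [seq (m, q.2) | m <- frobm q.1] | q <- v].

Lemma pw_range : all (fun p => all inm (pw p)) exps.
Proof. by vm_compute. Qed.

Lemma sum_map_upA n l h : \sum_(m <- iter n (map upA) l) c m h = al h ^+ n * \sum_(m <- l) c m h.
Proof.
elim: n => [|n IHn]; first by rewrite mul1r.
rewrite iterS big_map exprS -mulrA -IHn big_distrr /=; apply: eq_bigr => m _.
exact: mono_upA.
Qed.

Lemma sqrrD2 (x y : F) : (x + y) ^+ 2 = x ^+ 2 + y ^+ 2.
Proof. by rewrite sqrrD mulr2n F2 addr0. Qed.

Lemma frobD (x y : F) : (x + y) ^+ 4 = x ^+ 4 + y ^+ 4.
Proof. by rewrite !(exprM _ 2 2) !sqrrD2. Qed.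

Lemma frob_sum (J : Type) (r : seq J) (f : J -> F) :
  (\sum_(j <- r) f j) ^+ 4 = \sum_(j <- r) f j ^+ 4.
Proof. by apply: (big_morph (fun x => x ^+ 4) frobD); rewrite expr0n. Qed.

Lemma sum_pw p h : p \in exps -> \sum_(m <- pw p) c m h = c (mon p.1 p.2) h ^+ 4.
Proof.
rewrite mem_exps => /andP[i16 _]; rewrite sum_map_upA mono_mon // exprMn -!exprM mulnC.
congr (_ * _); rewrite mulnC exprM be4; elim: (p.2) => [|j IHj].
  by rewrite big_seq1 /mono /ex /ey /= !expr0 mulr1.
rewrite iterS exprS -IHj mulrDl big_cat sum_map_upA /=; congr (_ + _).
rewrite big_flatten big_map big_distrr /=; apply: eq_bigr => m _; exact: mono_upB.
Qed.

Lemma natr_odd n : n%:R = (odd n)%:R :> F.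
Proof.
elim: n => // n IHn; rewrite -addn1 natrD {}IHn addn1 /=.
by case: (odd n); rewrite /= ?add0r // F2.
Qed.

Lemma mu_frob m h : mu m h ^+ 4 = \sum_(m' <- frobm m) mu m' h.
Proof.
have be16 g : be g ^+ 16 = be g.
  by rewrite (exprM _ 4 4) be4 frobD be4 -exprM (exprD _ 16 4) al16 -exprS -addrA F2 addr0.
transitivity (\sum_h' mu m h' ^+ 4 * (h' == h)%:R).
  rewrite (bigD1 h) //= eqxx mulr1 big1 ?addr0 // => h' /negbTE ->; exact: mulr0.
transitivity (\sum_h' \sum_(p <- exps) mu m h' ^+ 4 * (c (mon p.1 p.2) h' * mu (mon p.1 p.2) h)).
  by apply: eq_bigr => h' _; rewrite -mono_mu big_distrr.
rewrite exchange_big /frobm big_map big_filter big_map [RHS]big_mkcond /=.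
rewrite big_seq [RHS]big_seq; apply: eq_bigr => p pe.
transitivity ((\sum_(x <- pw p) (Pos.eqb m x)%:R) ^+ 4 * mu (mon p.1 p.2) h).
  have pr := allP pw_range p pe.
  transitivity ((\sum_h' mu m h' * \sum_(x <- pw p) c x h') ^+ 4 * mu (mon p.1 p.2) h).
    rewrite frob_sum big_distrl; apply: eq_bigr => h' _ /=; rewrite exprMn sum_pw //.
    rewrite -exprM mono_mon ?exprMn; last by move: pe; rewrite mem_exps => /andP[].
    by rewrite -!exprM ![(_ * 16)%N]mulnC !exprM al16 be16 mulrA.
  congr (_ ^+ 4 * _); rewrite (eq_bigr _ (fun h' _ => big_distrr _ _ _)) exchange_big /=.
  elim: (pw p) pr => [|x l IHl] /=; first by rewrite !big_nil.
  by move=> /andP[xi /IHl lE]; rewrite !big_cons lE mu_mono.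
have -> : \sum_(x <- pw p) (Pos.eqb m x)%:R = (count (Pos.eqb m) (pw p))%:R :> F.
  by rewrite -natr_sum -sum1_count [in RHS]big_mkcond; congr (_%:R); apply: eq_bigr => x _; case: ifP.
rewrite natr_odd.
by case: (odd _); rewrite ?expr1n ?mul1r // expr0n mul0r.
Qed.

Definition frobP n (x : A n) : A n :=
  match n return A n -> A n with
  | 0 => fun x => (x : F) ^+ 4
  | n'.+1 => fun x : P n' => [ffun p => (x p : F) ^+ 4] : P n'
  end x.

Lemma frobP_D n : {morph @frobP n : x y / x + y}.
Proof. by case: n => [|n] x y /=; [apply: frobD | apply/ffunP => p; rewrite !ffunE frobD]. Qed.

Lemma frobPZ n k x : frobP (k *: x) = k ^+ 4 *: frobP (n := n) x.
Proof. by case: n x => [|n] x /=; [apply: exprMn | apply/ffunP => p; rewrite !ffunE; apply: exprMn]. Qed.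

Lemma frobP_act n g x : frobP (act g x) = act g (frobP (n := n) x).
Proof. by case: n x => [|n] x //=; apply/ffunP => p; rewrite !ffunE. Qed.

Lemma frobP0 n : frobP (0 : A n) = 0.
Proof. by rewrite -(scale0r 0) frobPZ expr0n !scale0r. Qed.

Lemma frobP_sum n (J : Type) (r : seq J) (f : J -> A n) :
  frobP (\sum_(j <- r) f j) = \sum_(j <- r) frobP (f j).
Proof. by apply: (big_morph (@frobP n)); [apply: frobP_D | apply: frobP0]. Qed.

Lemma frobP_vv n v : frobP (vv n v : A n.+1) = vv n (frobv v).
Proof.
rewrite /veval frobP_sum /frobv big_flatten big_map; apply: eq_bigr => q _; rewrite big_map.
apply/ffunP => p; rewrite sum_ffunE !ffunE; case: ifP => qp.
  by rewrite mu_frob; apply: eq_bigr => m _; rewrite ffunE qp.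
by rewrite expr0n big1 // => m _; rewrite ffunE qp.
Qed.

Lemma frobP_bar n n' L (x : A n.+1) :
  frobP (bar n n' L x) = bar n n' (map frobv L) (frobP x).
Proof.
rewrite /bar /extend frobP_sum; apply: eq_bigr => i _.
rewrite frobP_sum; apply: eq_bigr => h _; rewrite frobPZ frobP_act frobP_vv /co ffunE.
congr (_ *: act _ _); have [iL|Li] := ltnP i (size L); first by rewrite (nth_map [::]).
by rewrite !nth_default ?size_map.
Qed.

Section Twist.
Variable kgens : nat -> seq vec.
Hypothesis kgens0 : forall j : I 0,
  \sum_(x <- nth [::] (kgens 0) j) (Pos.eqb x.2 1 && Pos.eqb x.1 1)%:R = 1 :> F.

(** Raising coefficients to the fourth power turns the differential into the one given by [frobv];
    the linear maps of [kgens] then lead back to the original resolution. The composite is the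
    semilinear lift asked for by [cls_twist]. *)
Lemma frob_cl n (v w : I n -> F) : (n < N)%N ->
  (forall i, (i < n)%N -> size (kgens i) = rk i) ->
  (forall i, (i < n)%N -> all2 (fun x y => veq (tapp (rows (gens i)) x) (tapp (rows (kgens i)) (frobv y)))
      (kgens i.+1) (gens i)) ->
  (forall j, w j ^+ 4 = \sum_(x <- nth [::] (kgens n) j) if Pos.eqb x.1 1 then at_pos v x.2 else 0) ->
  cob n (fun l => cls (lin v) l + cls (lin w) l ^+ 4).
Proof.
move=> nN size_kgens kP wE.
pose G i : A i -> A i := match i with 0 => @frobP 0 | i'.+1 => fun x => bar i' i' (kgens i') (frobP x) end.
have GD i : {morph G i : x y / x + y}.
  case: i => [|i] x y; first exact: frobD.
  by have [bD _] := linear_bar i i (kgens i); rewrite -bD -frobP_D.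
have GG i g x : G i (act g x) = act g (G i x).
  by case: i x => [|i] x //; rewrite -bar_act -frobP_act.
have G1 : G 0 one = one by apply: expr1n.
have := cls_twist F2 actD actZ act1 actM act_one ddD ddZ dd_act dd0 dds nN (pcocycle_cl v) GD GG G1.
move=> H; apply: cob_ext (H _).
  suff key x : lin v (bar n n (kgens n) (frobP x)) = lin w x ^+ 4 by move=> l _; congr (_ + _); apply: key.
  rewrite (invariant_lin co_sum _ (linear_map_comp (linear_lin v) (linear_bar n n (kgens n)))); last first.
    by move=> g y; rewrite bar_act; case: (pcocycle_cl v).
  rewrite {1 3}/Bar.lin /extend frob_sum; apply: eq_bigr => j _; rewrite frob_sum; apply: eq_bigr => h _.
  by rewrite [RHS]exprMn wE {1}/co ffunE bar_e lin_vv.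
move=> [|i] x lin_.
  have lk := linear_map_comp (ddl 1) (linear_bar 0 0 (kgens 0)).
  rewrite -[LHS]/(dd (bar 0 0 (kgens 0) (frobP x)) : F) (invariant_lin co_sum _ lk); last first.
    by move=> g y; rewrite bar_act dd_act.
  have -> : G 0 (dd x) = (\sum_j \sum_h co x j h) ^+ 4 by [].
  rewrite /Bar.lin /extend frob_sum; apply: eq_bigr => j _; rewrite frob_sum; apply: eq_bigr => h _.
  by rewrite bar_e dd_vv0 kgens0 /co ffunE; apply: mulr1.
rewrite -[dd _]/(bar i.+1 i (gens i) (bar i.+1 i.+1 (kgens i.+1) (frobP x))).
rewrite -[RHS]/(bar i i (kgens i) (frobP (bar i.+1 i (gens i) x))) frobP_bar.
move: (frobP x) => y; apply: add2r_eq => [|//]; first exact: P2.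
apply: (@eq0_on_e i.+1 i.+1 (fun y => bar i.+1 i (gens i) (bar i.+1 i.+1 (kgens i.+1) y) + bar i i (kgens i) (bar i.+1 i (map frobv (gens i)) y))).
- by apply: (@linear_mapD (A i.+2) (A i.+1)); apply: linear_map_comp; apply: linear_bar.
- by move=> g z; rewrite !bar_act actD.
move=> j; rewrite !bar_e bar_vv ?size_gens // bar_vv ?size_kgens //.
have := kP i lin_; rewrite all2E => /andP[/eqP sz] /(all_nthP ([::], [::]))/(_ j).
rewrite size_zip sz minnn size_gens nth_zip // => /(_ (ltn_ord j)) /=.
rewrite (nth_map [::]) ?size_gens //.
move/(veval_eq (vval i) (@P2 _)) => ->; exact: P2.
Qed.
End Twist.

(** * Products and divisibility on lists of generators *)

Definition ind n (l : seq positive) (i : I n) : F := (odd (count (Pos.eqb (Pos.of_succ_nat i)) l))%:R.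

Definition hit n (m : positive) (l : seq positive) (q : positive * positive) : bool :=
  [&& Pos.eqb q.1 m, odd (count (Pos.eqb q.2) l) & ((Pos.to_nat q.2).-1 < rk n)%N].

Definition xstep n (i : nat) (l : seq positive) : seq positive :=
  [seq Pos.of_succ_nat j | j <- iota 0 (rk n.+1) &
     odd (count (hit n (Pos.of_succ_nat (2 ^ i)) l) (nth [::] (gens n) j))].

Fixpoint xsteps n (t : seq nat) (l : seq positive) : seq positive :=
  if t is i :: t' then xstep (size t' + n) i (xsteps n t' l) else l.

Definition xk (i : nat) (h : E) : F := al h ^+ (2 ^ i).
Definition xs (t : seq nat) (f : seq E -> F) : seq E -> F := foldr (fun i => xcup (xk i)) f t.

Lemma at_pos_weight n (wt : positive -> F) l k :
  at_pos (fun i : I n => ind l i * wt (Pos.of_succ_nat i)) k =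
  if odd (count (Pos.eqb k) l) && ((Pos.to_nat k).-1 < rk n)%N then wt k else 0.
Proof.
have [kr|kr] := ltnP; last first.
  rewrite andbF /at_pos big1 // => i _; case: Pos.eqb_spec => // ik.
  by move: kr; rewrite leqNgt -ik SuccNat2Pos.id_succ ltn_ord.
have kE : Pos.of_succ_nat (Pos.to_nat k).-1 = k by exact: of_succ_to_nat.
rewrite /at_pos (bigD1 (Ordinal kr)) //= big1 ?addr0 => [|i ik].
  rewrite kE Pos.eqb_refl /ind /= kE andbT.
  by case: (odd _); rewrite ?mul1r ?mul0r.
case: Pos.eqb_spec => // iE; case/eqP: ik; apply: val_inj => /=.
by rewrite -iE SuccNat2Pos.id_succ.
Qed.

Lemma at_pos_ind n l k :
  at_pos (ind (n := n) l) k = (odd (count (Pos.eqb k) l) && ((Pos.to_nat k).-1 < rk n)%N)%:R.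
Proof.
have := @at_pos_weight n (fun _ => 1) l k.
have -> : at_pos (fun i : I n => ind l i * 1) k = at_pos (ind (n := n) l) k.
  by apply: eq_bigr => i _; rewrite mulr1.
by move=> ->; case: (_ && _).
Qed.

Lemma odd_count_filter (p : pred nat) r j : (j < r)%N ->
  odd (count (Pos.eqb (Pos.of_succ_nat j)) [seq Pos.of_succ_nat i | i <- iota 0 r & p i]) = p j.
Proof.
move=> jr; rewrite count_map count_filter.
rewrite (@eq_count _ _ (fun i => (i == j) && p j)) => [|i] /=.
  case: (p j); last by rewrite (@eq_count _ _ pred0) ?count_pred0 // => i; rewrite andbF.
  rewrite (@eq_count _ _ (pred1 j)) => [|i]; last by rewrite andbT.
  by rewrite count_uniq_mem ?iota_uniq // mem_iota jr.
have [->|ij] := eqVneq i j; first by rewrite Pos.eqb_refl.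
by case: Pos.eqb_spec => // /SuccNat2Pos.inj ji; case/eqP: ij.
Qed.

Lemma ind_xstep n i l j : (i < 4)%N -> xmul dd e co (xk i) (ind (n := n) l) j = ind (xstep n i l) j.
Proof.
move=> i4; rewrite (@xmul_vval _ (Pos.of_succ_nat (2 ^ i))).
- rewrite /ind odd_count_filter ?ltn_ord // -natr_odd -sum1_count natr_sum big_mkcond.
  rewrite [RHS]big_mkcond /=; apply: eq_bigr => q _.
  by rewrite at_pos_ind /hit; case: Pos.eqb => //=; case: (_ && _).
- by case: i i4 => [|[|[|[|]]]].
by move=> h; rewrite /xk /mono; case: i i4 => [|[|[|[|]]]] // _; rewrite /ex /ey /= ?mulr1.
Qed.

Lemma xkM i g h : xk i (g * h)%g = xk i g + xk i h.
Proof.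
rewrite /xk alM; elim: i => [|i IHi]; first by rewrite !expr1.
by rewrite expnSr !exprM IHi sqrrD2.
Qed.

Local Notation cl n l := (cls (lin (ind (n := n) l))).

Lemma xcupD (x : E -> F) f g l : xcup x (fun z => f z + g z) l = xcup x f l + xcup x g l.
Proof. by case: l => [|a [|b l]] //=; rewrite ?addr0 // mulrDr. Qed.

Lemma xsD t f g l : xs t (fun z => f z + g z) l = xs t f l + xs t g l.
Proof.
elim: t l => //= i t IHt [|a [|b l]] //=; rewrite ?addr0 //.
by rewrite IHt mulrDr.
Qed.

Lemma cob_xs n t f : cob n.+1 f -> cob (size t + n.+1) (xs t f).
Proof.
elim: t => //= i t IHt /IHt; rewrite [X in cob X]addnS => /(cob_xcup F2 (xkM i)).
by rewrite addSn addnS.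
Qed.

Lemma xs_ext n t f g : (forall l, size l = n.+1 -> f l = g l) ->
  forall l, size l = (size t + n).+1 -> xs t f l = xs t g l.
Proof.
move=> fg; elim: t => //= i t IHt [|a [|b l]] // [sl].
by rewrite /= IHt //= sl.
Qed.

Lemma xs_cl n t l : all (fun i => i < 4)%N t -> (size t + n <= N)%N ->
  cob (size t + n) (fun z => xs t (cl n l) z + cl (size t + n) (xsteps n t l) z).
Proof.
elim: t => [|i t IHt] /=.
  by move=> _ _; apply: cob_ext (cob0 F E _) => z _; rewrite F2.
move=> /andP[i4 t4] tN.
apply: (@cob_trans F E F2 _ _ (xcup (xk i) (cl (size t + n) (xsteps n t l)))); last first.
  by apply: xcup_cl => // [g h|j]; [apply: xkM | apply: ind_xstep].
case: t IHt t4 tN => [|i' t] IHt t4 tN.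
  by apply: cob_ext (cob0 F E _) => z _; rewrite F2.
have /(cob_xcup F2 (xkM i)) := IHt t4 (ltnW tN).
by apply: cob_ext => z _; rewrite xcupD.
Qed.

Lemma xs_rep n t f l l' : cob n.+1 (fun z => f z + cl n.+1 l z) ->
  all (fun i => i < 4)%N t -> (size t + n.+1 <= N)%N -> xsteps n.+1 t l = l' ->
  cob (size t + n.+1) (fun z => xs t f z + cl (size t + n.+1) l' z).
Proof.
move=> fl t4 tN <-; apply: (cob_trans F2) (xs_cl _ t4 tN).
by apply: cob_ext (cob_xs t fl) => z _; rewrite xsD.
Qed.

Lemma cl0 z : size z = 1 -> cl 0 [:: 1%positive] z = 1.
Proof.
move=> sz; transitivity (dd (sigma act s one 1 z) : F).
  apply: eq_bigr => i _; apply: eq_bigr => h _.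
  by rewrite /ind (ord_rk0 i) /=; apply: mulr1.
rewrite (dd_sigma F2 actD actZ act1 actM act_one ddD ddZ dd_act dd0 dds) //.
by case: z sz => [|a []] // _; apply: addr0.
Qed.

Lemma xs_one t l' : all (fun i => i < 4)%N t -> (size t <= N)%N -> xsteps 0 t [:: 1%positive] = l' ->
  cob (size t) (fun z => xs t (fun _ => 1) z + cl (size t) l' z).
Proof.
move=> t4 tN <-; have := @xs_cl 0 t [:: 1%positive] t4; rewrite addn0 => /(_ tN).
apply: cob_ext => z sz; congr (_ + _); apply: (@xs_ext 0) => [l|]; first exact: cl0.
by rewrite addn0.
Qed.

Lemma reading_xs n t f l i : cocyc n f -> (forall i, reading dd e co aug (n := n) f i = ind l i) ->
  all (fun i => i < 4)%N t ->
  reading dd e co aug (n := size t + n) (xs t f) i = ind (xsteps n t l) i.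
Proof.
move=> cf fl; elim: t i => //= k t IHt i /andP[k4 t4].
have ct : cocyc (size t + n) (xs t f).
  elim: (t) => //= k' t' ct; exact: (cocyc_xcup F2 (xkM k')).
rewrite (reading_xcup F2 actZ act_one ddD ddZ dd_act ddd coD coZ co_act co_sum co_e augE augD augZ _ _ ct).
rewrite -ind_xstep // /xmul /xlin /extend; apply: eq_bigr => a _; apply: eq_bigr => b _.
by rewrite IHt.
Qed.

Definition xl (lam : F) (h : E) : F := \sum_(i <- iota 0 4) (lam * al h) ^+ (2 ^ i).

(** Give generator k of g the coordinate lam^(wt k). The product with [xl lam] takes on each
    generator a sum of powers of lam; these are the exponents, modulo 15 because lam^15 = 1. *)
Definition ess_exps n (wt : positive -> nat) (g : seq positive) (v : vec) : seq nat :=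
  flatten [seq [seq ((2 ^ i + wt q.2) %% 15)%N | i <- iota 0 4 & hit n (Pos.of_succ_nat (2 ^ i)) g q] | q <- v].

(** Every exponent but 0 has to cancel, so the product is the class l' independently of lam, and one
    computation settles all admissible values of lam. *)
Definition ess_check n wt g l' : bool :=
  all (fun j => let t := ess_exps n wt g (nth [::] (gens n) j) in
    all (fun a => odd (count_mem a t) == ((a == 0) && odd (count (Pos.eqb (Pos.of_succ_nat j)) l')))
      (iota 0 15)) (iota 0 (rk n.+1)).

Lemma xlM lam g h : xl lam (g * h)%g = xl lam g + xl lam h.
Proof.
rewrite /xl -big_split; apply: eq_bigr => i _.
by rewrite !exprMn -!/(xk i _) xkM mulrDr.
Qed.

Lemma sum_pow_count (lam : F) (r t : seq nat) : uniq r -> all (mem r) t ->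
  \sum_(a <- t) lam ^+ a = \sum_(a <- r) (odd (count_mem a t))%:R * lam ^+ a.
Proof.
move=> ur; elim: t => [|b t IHt] /=; first by rewrite big_nil big1 // => a _; apply: mul0r.
move=> /andP[br /IHt tE]; rewrite big_cons {}tE.
transitivity (\sum_(a <- r) ((b == a)%:R * lam ^+ a + (odd (count_mem a t))%:R * lam ^+ a)).
  rewrite big_split /=; congr (_ + _); rewrite (bigD1_seq b) //= eqxx mul1r.
  by rewrite big1 ?addr0 // => a ab; rewrite eq_sym (negbTE ab) mul0r.
by apply: eq_bigr => a _; rewrite -mulrDl -[(odd (count_mem a t))%:R]natr_odd -natrD natr_odd.
Qed.

Lemma ess_rep n f wt g l' lam : cob n.+1 (fun z => f z + cl n.+1 l' z) -> (n < N)%N ->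
  ess_check n wt g l' -> lam ^+ 15 = 1 ->
  exists k, cob n.+1 (fun z => f z + xcup (xl lam) k z).
Proof.
move=> fl nN chk lam15; pose v (i : I n) := ind g i * lam ^+ wt (Pos.of_succ_nat i).
exists (cls (lin v)); apply: (cob_trans F2 fl); apply: cob_sym.
apply: xcup_cl => // [x y|j]; first exact: xlM.
have -> : xmul dd e co (xl lam) v j = \sum_(i <- iota 0 4) lam ^+ (2 ^ i) * xmul dd e co (xk i) v j.
  rewrite /xmul /xlin /extend; move: (dd _) => y.
  transitivity (\sum_a \sum_h \sum_(i <- iota 0 4) lam ^+ (2 ^ i) * (co y a h * (xk i h * v a))).
    apply: eq_bigr => a _; apply: eq_bigr => h _.
    rewrite /xl /GRing.scale /= big_distrl big_distrr; apply: eq_bigr => i _ /=.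
    by rewrite exprMn /xk; ring.
  transitivity (\sum_a \sum_(i <- iota 0 4) \sum_h lam ^+ (2 ^ i) * (co y a h * (xk i h * v a))).
    by apply: eq_bigr => a _; apply: exchange_big.
  rewrite exchange_big; apply: eq_bigr => i _; rewrite big_distrr; apply: eq_bigr => a _.
  by rewrite big_distrr.
transitivity (\sum_(a <- ess_exps n wt g (nth [::] (gens n) j)) lam ^+ a).
  rewrite /ess_exps big_flatten big_map.
  transitivity (\sum_(i <- iota 0 4) \sum_(q <- nth [::] (gens n) j)
     if hit n (Pos.of_succ_nat (2 ^ i)) g q then lam ^+ (2 ^ i + wt q.2)%N else 0).
    rewrite big_seq [RHS]big_seq; apply: eq_bigr => i; rewrite mem_iota => /andP[_ i4].
    rewrite (@xmul_vval _ (Pos.of_succ_nat (2 ^ i))).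
    - rewrite big_distrr; apply: eq_bigr => q _ /=; rewrite (@at_pos_weight n (fun p => lam ^+ wt p)) /hit.
      case: (Pos.eqb q.1 _) => /=; last by rewrite mulr0.
      by case: ifP => _; rewrite ?mulr0 ?exprD.
    - by case: i i4 => [|[|[|[|]]]].
    by move=> h; rewrite /xk /mono; case: i i4 => [|[|[|[|]]]] // _; rewrite /ex /ey /= ?mulr1.
  rewrite exchange_big; apply: eq_bigr => q _; rewrite big_map big_filter big_mkcond.
  apply: eq_bigr => i _; case: ifP => // _.
  by rewrite {1}(divn_eq (2 ^ i + wt q.2) 15) exprD mulnC exprM lam15 expr1n mul1r.
rewrite (@sum_pow_count _ (iota 0 15)) ?iota_uniq //; last first.
  rewrite /ess_exps all_flatten_map; elim: (nth _ _ _) => //= q u ->; rewrite andbT all_map.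
  apply/allP => i _; have m15 : ((2 ^ i + wt q.2) %% 15)%N \in iota 0 15 by rewrite mem_iota ltn_mod.
  exact: m15.
have /(allP chk) : nat_of_ord j \in iota 0 (rk n.+1) by rewrite mem_iota ltn_ord.
move=> /allP tP; rewrite big_seq (eq_bigr (fun a => if a == 0 then ind l' j else 0)).
  by rewrite -big_seq (bigD1_seq 0) ?iota_uniq //= big1 ?addr0 // => a /negbTE ->.
move=> a /tP/eqP ->; case: eqVneq => [->|_] /=; last by rewrite mul0r.
by rewrite mulr1.
Qed.

Definition pull n r (L : seq vec) (l : seq positive) : seq positive :=
  [seq Pos.of_succ_nat j | j <- iota 0 r & odd (count (hit n 1 l) (nth [::] L j))].

Lemma ind_pull n m L l (j : I m) :
  \sum_(x <- nth [::] L j) (if Pos.eqb x.1 1 then at_pos (ind (n := n) l) x.2 else 0) =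
  ind (n := m) (pull n (rk m) L l) j.
Proof.
rewrite /ind odd_count_filter ?ltn_ord // -natr_odd -sum1_count natr_sum [RHS]big_mkcond.
apply: eq_bigr => q _; rewrite at_pos_ind /hit.
by case: (Pos.eqb q.1 1) => //=; case: (_ && _).
Qed.

Definition unit_gen (v : vec) : bool := odd (count (fun x => Pos.eqb x.2 1 && Pos.eqb x.1 1) v).

Lemma unit_genE v : (unit_gen v)%:R = \sum_(x <- v) (Pos.eqb x.2 1 && Pos.eqb x.1 1)%:R :> F.
Proof.
rewrite -natr_odd -sum1_count natr_sum big_mkcond; apply: eq_bigr => x _.
by case: (_ && _).
Qed.

(** Readings follow the products by degree 1 classes, whereas a coboundary reads 0 on all
    generators. *)
Lemma xs_cl_neq0 n t l (j : I (size t + n.+1)) : (n.+1 < N)%N -> all (fun i => i < 4)%N t ->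
  odd (count (Pos.eqb (Pos.of_succ_nat j)) (xsteps n.+1 t l)) ->
  ~ cob (size t + n.+1) (xs t (cl n.+1 l)).
Proof.
move=> nN t4 jl cc; have : reading dd e co aug (xs t (cl n.+1 l)) j = 0.
  have tn : (0 < size t + n.+1)%N by rewrite addnS.
  move: (_ + _)%N tn j cc {jl} => [|m] // _ j.
  exact: (reading_cob actZ act_one ddD ddZ dd_act ddd coD coZ co_act co_sum augE augD augZ gens_minimal_sum).
rewrite (@reading_xs n.+1 _ _ l) //.
- by rewrite /ind jl; apply/eqP/oner_neq0.
- exact: cocyc_cl.
by move=> i; apply: reading_cl.
Qed.

End Free.

End Free.
Import Free.

(** * The minimal resolution of the trivial module *)

(* [64 * (i + 16 * j) + k] encodes the multiple of the [k]-th generator, counted from 0, by the element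
   dual to the monomial [a^i b^j].  [dcode] lists the boundaries of the generators in each degree,
   [kcode] a chain map from the Frobenius twist of the resolution, [wcode] one covering the class W. *)
Definition dcode : seq (seq (seq N)) := [::[::[::64];[::256];[::128];[::512]];
[::[::515;2177];[::130;2115];[::64;1283];[::257;448];[::66;128;2051];[::259;513;2050];
[::129;258;320];[::67;512;1025]];
[::[::261;455;515;1219;1602;2054];[::68;130;1157;1542;1794;1856;2055;2498];[::64;325;
519;579;833;900;962;1029;1537;3136;3651];[::134;257;386;1028;2117;2754;2816];[::66;
1287;3200];[::199;259;642];[::129;320;581;3392];[::512;2181;3139];[::65;132;256;517;
2119];[::71;131;262;514;1156;2882]];
[::[::261;393;836;960;1473;1602;2368];[::68;1157;1289;1411;3202;3657];[::519;710;
1728;2184;3136;3651;3905];[::134;200;1667;1921;2311;2568;2754;3075;3329;3520];[::322;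
645;777;1026;1088;1603;1857;2053;2307;2752;3394;3456];[::201;323;644;768;1158;1281;
1410;2176;2691];[::195;392;578;640;901;1030;1344;1859;2694];[::327;387;584;641;708;
832;1091;2049;2178;2240;2755;3009;3842];[::194;256;517;902;1221;2057;2179];[::65;
132;256;517;649;771;1606;2179;2624;3137];[::131;262;576;837;1032;1218;2439];[::71;
131;262;328;385;514;576;1089;1280;1795;2630;2820;3648]];
[::[::66;263;522;523;897;1158;1412;2248;2434;3397];[::70;138;259;324;642;704;839;
1346;2112;2881];[::72;73;129;517;646;714;1159;1419;1604;1793;2054];[::132;264;512;
838;1216;1731;2117;2818];[::322;384;519;581;710;778;2187;2752;3076;3394];[::134;202;
203;577;1027;1092;1281;1410;2311;2889;3077];[::260;392;1096;1541;2048;2245;2628;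
2817];[::69;198;585;1156;2049;2240;2375;2566;3079];[::65;256;836;1157;1540;2562;
3080];[::131;514;1415;1674];[::133;262;330;331;451;705;1035;1409;2304];[::262;330;
451;516;648;896;1034;2113;2304;2439];[::71;133;451;649;834;1409;1538;2056;2057;
2242;2304]];
[::[::76;135;197;1097;1284;1799;2050;2120;2565;2625;3523];[::267;327;449;518;1031;
1093;1153;1347;2051;2242;2817;3136;3715;3906];[::138;199;261;390;644;776;896;1025;
1348;1985;2114;2883];[::68;200;320;522;523;524;705;774;1024;1349;1409;1794;2113;
3140;3392];[::202;385;840;1029;1158;1664;2116;2572;2753];[::324;576;839;961;1859;
2188;2692;2754;3267;3648];[::394;455;646;771;900;962;1099;1281;1475;1856;2054;2179;
3649];[::194;647;1290;1413;1667;2752;3456];[::581;641;777;835;1285;1345;1730;1800;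
1920;2049;2243;3328];[::201;388;450;640;1154;1224;1729;2373;2569;3712];[::322;392;
775;1026;1420;1795;1986;2245;2441;3203;3332];[::198;323;584;1288;1611;2497;2566;
2691;2820;3776];[::71;262;1675;1857;2056;2380;2755;3083;3840];[::71;387;578;648;
1220;1282;1797;2630;2755;3083;3265;3459];[::193;262;329;387;516;1472;1797;1857;2176;
2378;2561;2630;2755];[::133;387;516;578;768;1033;1282;1472;2056;2176;2439;2946;3459;
3650;3840]];
[::[::77;139;201;646;1034;1540;1602;1740;2054;2883];[::76;78;139;201;261;515;584;
769;960;1219;1473;1602;2306;2368];[::268;269;331;522;647;1411;2184;2369;2821;3202];
[::68;130;270;271;522;776;1411;1665;1856;2498;2560;2821];[::140;141;142;143;265;
325;710;1098;2056;3215];[::64;141;325;519;579;833;962;1283;1537;1666;2693;2947];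
[::72;134;257;324;448;526;649;778;963;1090;1152;2371;2625;2754;3144;3329];[::134;
257;324;386;448;524;525;963;1152;1667;1921;2371;2625;2816;3075;3144;3329];[::260;
322;899;1026;1857;2307;2561;2690;3456];[::70;322;523;714;1164;1543;1857;1986;2628;
2690];[::69;969;2176];[::138;263;454;844;2437];[::135;901;1282;1421;2946;3008;3650];
[::135;264;326;516;578;841;1030;1282;2127;2187;2563;2817];[::73;133;327;910;1675;
2318;2379];[::518;770;1091;1536;1612;2178;2755;3904];[::132;395;517;586;771;840;
1039;1796;1858;3137;3328;3843];[::71;262;385;576;837;1089;1280;1541;2060;2499;2944;
3586];[::137;520;1679;2382];[::75;137;266;391;520;1286;2242;2634;3777;3906]];
[::[::82;142;203;518;519;584;585;771;1036;1037;1605;1664;1665;2178;2179;2368;2570;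
2887;3073];[::132;192;274;334;395;524;525;710;711;776;777;962;1099;1414;1666;1796;
1857;2118;2119;2371;2501;3205;3265];[::64;146;147;267;582;583;649;834;964;1101;
1287;1353;1668;1728;2057;2242;2243;2634;3076;3137];[::73;258;448;530;531;651;781;
1093;1152;1670;1671;1922;2374;2626;2627;2756;2757;2816;2817;3078];[::69;128;271;529;
647;898;899;1035;1350;1417;1602;1792;1793;2055;2120;2121;2437;2496;2698;3014;3140;
3200;3718;3971];[::76;145;263;328;329;514;645;906;1032;1218;1408;2195;2696;3586;
3716;3777];[::80;130;131;260;320;321;462;522;653;838;1608;1794;2061;2246;2247;2313;
2628;2629;2688;2890;3393];[::70;71;136;272;452;453;512;513;654;1026;1027;1156;1157;
1217;1801;1986;1987;2439;2690;2820;2821;2881;3142];[::527;586;903;969;1088;1089;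
1607;1672;1859;2693;2753;2954;3267;3456;3457];[::140;709;1096;1282;1283;1412;1413;
2117;2760;2946;2947;3650;3651;3840];[::264;450;451;1345;1862;1929;2191;2567;2632;
2818;2948;3712];[::74;204;832;833;1347;1476;1477;1536;1537;2181;2241;2442;2758;3714;
3845];[::2706;3268];[::1220;1363;1612;1613;3459;3588;3648];[::139;268;337;706;837;
1600;1601;1802;2114;2507;2823;3526;3592];[::78;138;268;269;454;520;1224;1601;2064;
2115;2245;2447;2506;3211;3908;3909];[::79;139;268;454;455;521;707;836;897;1041;
1158;1225;1600;1601;2114;2115;2244;2245;2446;3779;3968];[::268;269;454;455;520;656;
706;707;836;837;897;1225;1410;1540;1541;1600;1601;2245;2305;2446;3778;3779;3968;
3969]];
[::[::79;81;139;201;455;646;769;836;898;960;1159;1602;2054;2177;2306;2698;2883;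
3072;3527;3841];[::192;273;393;522;647;707;838;1097;1665;2184;2436;2498;2821;3140;
3202;3594;3779;3910];[::142;265;325;579;648;900;1098;1352;1604;1666;2241;2308;2633;
2887;2947;3074;3972];[::72;324;386;448;526;528;903;1028;1090;1152;1413;1667;2117;
2311;2371;2440;2502;3075;3144;3206;3329;3396;3520;3781];[::525;1347;1601;3138;3655;
3846];[::208;389;643;712;1033;1668;1730;1870;2372;3200];[::141;1217;1346;1738;3010;
3331;3714];[::328;580;642;704;782;843;965;1284;1346;1408;1738;2050;2112;2192;2373;
2627;2881;2948;3010;3271;3331;3462;3585;3652];[::76;2688;3201];[::320;399;775;835;
966;1024;1103;1479;1539;1860;1984;2058;2949;3268;3330;3392];[::268;1985;2689;2880;
3393];[::198;321;450;591;967;1671;1985;2059;2566;2689;2756;2818;3079;3139;3270;3393;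
3460;3584;3845];[::140];[::524;3649;3778];[::77;2249;3267;3712];[::269;1345;3713];
[::194;336;771;1038;1040;1415;1475;1858;2179;2500;2825;2885;3137;3266;3328;3843;
3974];[::385;576;655;715;1089;1735;1926;2063;2065;2439;2753;2820;2944;3203;3272;
3457;3524;3586;3648];[::75;520;1801;2180;2565;2634;3086;3269;3463;3654;3844];[::75;
137;266;520;1476;1801;1861;2242;2384;2634;3968];[::75;137;975;1095;1286;1409;2759;
3089;3463;3654;3968]];
[::[::143;262;334;1473;2245];[::82;263;515;898;960;1219;1541;1602;1664;2368;2883;
3072];[::68;526;1039;1856;1939;2644];[::69;130;192;274;275;455;651;707;1411;1665;
1794;2115;2498;2823;3202];[::269;522;652;712;3651];[::64;148;523;713;1417;1537;1728;
2695;2947;3136];[::76;136;2061];[::137;257;531;532;907;963;1152;1667;2119;2315;2371;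
2625;2754;2816;3458];[::271;462;1290];[::78;1284;1809;1867;3585];[::525;2186];[::140;
2125];[::72;1293;2193];[::260;527;1857;2054;3265;3971];[::144;261;647;1026;1603;1925;
2629;2690];[::70;142;2052;3778];[::266;456;2577;3649;3840];[::71;323;528;644;1027;
2439;2691;3778];[::138;268;328];[::516;783;1104;1606;2885];[::81;139;724;1344;2048;
2817;2946;3521;3650];[::77;520;1034];[::134;1296;2116];[::273;521;914;1225;2049;2117;
2178;3459];[::133;338;519;1044;1475;1729;1858;1920;2179;2624;3266;3328];[::194;338;
340;519;1223;1475;1609;1797;2179;2562;2624;3266;3843];[::75;576;658;1280;2753;3586;
3648];[::75;265;385;453;576;659;1280;2066;2067;2633;3203;3457;3586;3648]];
[::[::150;339;589;961;1294;1665;2368;2633];[::531;1105;1485;1666;1857;2189;3783];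
[::272;402;2372;2583;3655];[::76;656;786;1092;2064;2196;2315;2444;2757];[::128;278;
335;1602;1672;1792;2125;2306;3200];[::279;468;538;539;647;718;1422;1602;1603;1793;
2126;2307;2496;2705;3351;3971];[::84;154;332;472;645;705;855;1036;1559;1998;2053;
2702;2883;3013;3335;3587;3716;3777];[::83;203;394;514;584;644;1037;1348;1408;1926;
1927;2112;2319;2377;2630;3013;3334;3335;3716;3776;3777];[::89;321;529;1025;1613;
1752;1925;2067;2317;2318;2629;2689;3601];[::260;469;528;585;658;838;908;1289;1794;
1984;2498;2628;3393;3910];[::70;140;1156;1554;1804;2069;2258;2260;2438;3525];[::142;
280;281;322;323;453;777;1026;1096;1367;1735;2129;2690;2691;2821;2881;3143;3214;
3394];[::194;264;649];[::74;324;533;592;902;972;1028;1988;3146;3396];[::152;153;325;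
794;903;1029;1239;1428;1607;1678;2311;2563;2693;2753;3086;3397;3457];[::146;267;396;
458;708;1030;1100;1990;2116;3780];[::73;397;648;1100;1282;1412;1472;1623;2176;2946;
3399;3651;3780];[::219;327;397;537;579;648;977;1100;1283;1412;1991;2117;2176;2177;
2327;3780;3841];[::90;409;641;1285;3713];[::139;330;580;1932;3652];[::269;450;520;
1224;1284;1682;2048;3008;3653];[::522;2180;3152];[::282;283;600;643;833;1095;1347;
1876;2051;2391;3845];[::79;137;212;1165;1346;1536;2050;2181;2505;2759;3011;3463;
3904];[::66;136;256;463;521;1168;1731;1920;1921;2434;2435;3269];[::197;596;666;667;
775;1111;1861;2075;2183;2833;2964;3139;3329;3847;3918];[::75;134;266;516;1798;2133;
2572];[::206;387;577;785;1048;1221;1489;1870;2193;2503;2573;2885;3459;3589];[::85;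
144;274;524;1158;2245;2644;2892];[::86;143;275;525;706;896;1410;1600;2114;3598]];
[::[::207;410;458;589;649;1043;1162;1353;2244;2368;2631;2883;3016;3660;3720];[::192;
341;399;602;650;707;1103;1354;1355;1856;2058;2115;2189;2560;2823;3018;3019;3073;
3723];[::327;403;652;792;900;1031;1107;1108;1666;1728;1990;2060;2640;3021;3074;
3398];[::216;324;448;656;710;788;1152;1245;1303;1415;1742;2194;2371;2505;3075;3150;
3396];[::128;221;468;716;1291;1668;2305;2589;2955;3076];[::220;335;586;717;1171;
1347;1421;2051;2125;2434;2703;3011;3138];[::278;337;467;539;587;716;1094;1095;1291;
1480;1601;1885;1943;2000;2126;2372;2373;2758;2835;2955;3077;3351;3463;3659];[::513;
1096;1217;1616;1671;2112;2205;2948;3079];[::333;642;796;966;1037;1097;1217;1346;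
1670;1671;1866;2050;2319;2374;2627;2761;2948;3078];[::82;155;392;513;913;966;1038;
1096;1217;1346;1408;1670;1671;2321;2374;2948;3078;3079;3464;3652;3714];[::258;835;
1116;2377;2565;2626;3081];[::89;529;658;660;835;910;968;1174;1364;1861;2068;2187;
2243;2316;2497;2565;3600];[::320;413;471;660;908;968;969;1024;1672;1673;1860;1984;
2243;2564;2688;2950;3654];[::67;450;604;970;1154;1308;2127;2182;2435];[::321;388;
605;663;720;1092;1478;1731;2071;2183;3584;3846];[::142;281;389;720;774;971;1093;
1424;1554;1806;2070;2129;2435;3273];[::533;723;973;1603;1677;2202;3014;3145];[::153;
261;534;592;593;646;722;843;899;1296;1297;1351;1547;1603;1924;2250;2251;2441;2561;
2690;2752;3014;3086;3333;3456];[::147;218;1679;2325;2586;2634;2825;3087;3778];[::70;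
146;323;537;706;1349;1735;2114;2635;2691;3012;3143];[::268;408;848;1607;1933;2507;
2637;3008];[::91;139;268;270;328;449;640;848;978;1220;1684;1803;1859;1932;2048;
2388;3211;3400];[::80;212;1164;1304;1474;2503;2580;3207];[::80;81;283;331;520;641;
1035;1166;1412;1413;2049;2117;2449;2578;2699;2755;2888;3094;3592;3904];[::132;256;
407;596;1053;1111;1609;1796;1920;2252;3420];[::65;132;256;349;519;666;714;844;1300;
1608;2074;2122;2313;2433;2562;2887;3137;3843;3976];[::74;131;783;1690;1738;1795;
1929;2076;2442;3098;3146];[::205;265;514;668;783;784;839;1218;1429;1543;1619;2191;
2247;2572;2633;2820;2821;3525;3648];[::143;275;585;705;834;1050;1098;2512;2762];
[::87;144;198;276;524;664;772;1230;1289;1538;1600;1807;1862;1938;2180;2455;2512;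
2566;2819;3215;3596;3598];[::199;276;524;834;896;1228;1230;1289;1538;1600;1807;1938;
2072;2113;2242;2304;2567;2644;2762;3215;3596;3598];[::85;143;275;346;394;525;585;
705;896;1098;1155;1409;1538;1600;1807;2113;2304;2512;2567;2643;2644;2819;3215;
3596]];
[::[::264;650;960;1115;1167;1297;1354;1433;1541;1542;1664;1929;2058;2368;3335];[::93;
94;150;462;515;592;837;898;1166;1167;1297;1354;1540;1541;1542;1602;1929;2177;2244;
2368;2579;3335;3841];[::69;192;1160;1357;2061;2560];[::130;286;402;456;457;532;654;
961;1107;1236;1357;1358;1547;1548;1624;1665;1733;1856;2115;2329;2369;2436;2438;2823;
3073];[::64;156;274;714;833;900;1360;1728;2308;2695];[::327;526;579;715;716;792;
1231;1283;1418;1604;1728;1993;2201;2432;2643;2695;2696;2697;2895;2947;3074];[::140;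
324;1028;1613;1921;2119;2585;2754;3329];[::80;257;324;540;543;858;963;1028;1152;
1415;1416;1613;1989;2119;2120;2371];[::128;220;223;392;778;897;965;1042;1096;1482;
1668;1792;2305;2373;3076];[::205;336;513;580;796;1217;1284;1285;1501;1748;1819;1923;
2112;2207;2949;3080];[::258;470;583;660;1117;1288;1486;1860;1984;2068;2190;2626;
2951];[::67;204;450;605;723;776;1093;1154;1479;1731;2070;2184;2572;2756;2818;2880;
3086;3393];[::76;152;260;647;1181;1603;1816;1924;1925;2628;2963;3394];[::75;262;322;
534;535;595;846;847;1026;1182;1351;1551;2055;2057;2630;2690;2752;3089;3147;3456];
[::71;270;536;537;706;918;978;1164;1281;1349;1472;1682;1987;2176;2439;2587;2691;
3144];[::71;73;148;149;271;401;458;459;646;978;1163;1164;1349;1472;1682;1737;1935;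
1987;2052;2054;2114;2176;2326;2327;2440;2639;2828;2945;3144];[::90;141;517;1221;
1344;1554;2698;2817;2884;3588];[::143;273;408;449;518;578;790;904;905;1035;1036;
1112;1153;1344;1685;1805;1859;2142;2311;2563;2698;2886;3008];[::136;283;333;334;522;
600;601;832;1037;1226;1345;1413;1474;2117;2178;2503;2580;2755;3207;3594];[::83;135;
137;212;213;333;335;523;1037;1039;1169;1227;1414;1474;2118;2503;2505;2580;2703;
2755;3209;3782];[::132;519;1111;1301;1422;1423;1611;1688;1858;2774;3206];[::65;133;
718;848;1224;1370;1796;1920;2074;2256;2393;2433];[::132;133;256;348;351;519;666;
667;717;908;1055;1111;1223;1224;1301;1729;1797;1798;1858;2179;2433;2502;2624;2889;
3137;3206];[::132;256;348;466;519;520;667;719;849;1052;1111;1225;1301;1611;1796;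
1798;2127;2257;2393;2433;2502;2624;2889;3137;3206;3593;3979];[::77;266;1743;1931;
2195;2247;2249;2499;2577;2821;2822;3203;3339];[::131;268;344;452;1620;2247;2249;
2635;2820;2822;2944;3339;3648];[::78;131;452;669;726;986;1157;1280;1544;1795;2077;
2078;2247;2446;2634;2821;3203;3586;3648];[::131;345;452;514;670;786;840;986;1048;
1049;1156;1157;1218;1280;1544;1620;2247;2446;2499;2634;2635;2822;2944;3099;3203;
3280;3339;3526;3586];[::146;528;896;1477;2113;2568;3271];[::86;276;834;896;1292;
1538;1600;2180;2304;3102;3418]];
[::[::459;650;771;1115;1222;1757;1811;1871;2058;2179;2248;2369;2514;2574;3219;3279;
3409;3591;3661;3912];[::336;408;770;840;961;1040;1474;1544;1665;2368;2369;2515;2705;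
2827;2887;2956;2957;3073;3590;3591;3843];[::193;651;710;842;1233;1307;1414;1546;
1797;1856;2500;3144;3205;3852];[::192;338;339;399;600;710;781;842;1043;1102;1103;
1355;1414;1485;1622;1667;1797;2188;2560;2706;2707;2896;3075;3205;3265];[::329;583;
834;965;1104;2197;2372;2768;2950;2951;3021;3907];[::582;652;714;788;835;965;1286;
1356;1357;1729;1821;1935;2060;2122;2243;2373;3021;3137;3342;3907];[::328;388;1032;
1092;1298;1358;1670;2121;2580;2581;2582;2696;2756;2816;3078;3331;3521];[::212;389;
654;857;858;907;967;1093;1245;1359;1671;1740;1741;1922;2580;2627;2696;3149;3330;
3331;3460;3461;3856];[::220;393;647;1732;1792;1885;1999;2260;2376;2588;2904;3719];
[::69;220;334;393;538;539;587;646;647;778;853;854;899;1038;1097;1240;1420;1482;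
1792;1793;2054;2186;2437;2496;2703;2833;3080;3201;3406];[::584;644;704;796;1218;
1288;1348;1745;1867;1926;1996;2052;2112;2630;2700;2882;3081;3153;3335;3776];[::153;
262;332;645;705;851;911;1219;1349;1408;1555;1614;1615;1867;1927;2113;2318;2319;
2700;2762;2882;3405;3587;3776];[::85;130;1289;1750;1924;2064;2247;2568;2834;2953;
3392;3910];[::321;413;779;838;1025;1361;1434;1483;1542;1674;2246;2453;2498;2499;
3272;3333];[::202;323;453;605;1217;1309;1423;1805;2379;2570;2644;2691;2760;2880;
2881;3395;3525;3585];[::276;279;322;452;453;512;658;719;848;1026;1096;1156;1217;
1362;1552;1987;2127;2256;2257;2509;2644;2820;2880;3027;3143;3212;3584];[::148;150;
194;264;720;1028;1424;1677;1738;1858;2442;2562;2752;2753;2959;3267;3397;3663;3975];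
[::194;325;590;720;843;902;972;973;1424;1606;1607;1859;2202;2310;2632;2693;2753;
3397;3457;3975];[::217;396;1030;1100;1472;2117;2586;2694;2765;2947;3086;3399;3606];
[::73;217;326;327;533;534;535;708;914;975;1031;1282;1352;1618;1809;1990;2116;2117;
2382;2383;2441;2512;2694;2695;2946;3145;3399;3841];[::90;139;404;406;581;786;846;
976;1154;1224;1284;1285;1344;1550;1862;1933;2048;2049;2194;2313;2507;2566;2567;2819;
3009;3712];[::198;404;406;450;581;640;786;976;1111;1284;1550;1681;1862;1863;2048;
2194;2254;2255;2385;2566;2636;2637;2698;2888;2948;2949;3089;3523;3652];[::208;642;
712;1300;1302;1477;1682;2240;2241;2699;2758;2759;3463;3715];[::208;281;283;390;522;
642;643;773;832;833;979;1094;1164;1226;1346;1347;1477;1536;1873;2180;2240;2386;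
2446;2447;2699;2759;2829;3090;3533;3905];[::66;256;402;462;1106;1166;1297;1478;1610;
2072;2314;2434;2624;2830;2889;2961;3328;3329;3665;3916];[::66;136;521;664;775;1052;
1369;1419;1684;1686;1800;1860;2183;2252;2314;2389;2435;2889;2961;3736];[::66;402;
462;592;664;981;1166;1225;1296;1730;1860;2182;2252;2434;2435;2565;2624;2830;3095;
3328;3846];[::196;348;463;521;592;715;845;1167;1225;1296;1297;1419;1478;1479;1549;
1800;1860;1861;1921;2183;2434;2564;2565;2624;2625;2830;2831;3095;3139];[::134;204;
517;782;913;985;1044;1090;1221;1280;1486;1616;1868;1869;2321;2573;2634;2755;3098;
3649];[::266;577;669;782;1091;1220;1221;1486;1617;1799;1869;2077;2249;2394;2755;
2884;2944;3588;3648;3741;3984];[::204;340;456;517;723;985;1090;1220;1280;1427;1487;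
1616;1868;1869;2190;2191;2321;2503;2572;2573;2885;3099;3207;3459;3588;3648];[::75;
204;340;387;456;517;576;577;669;723;841;985;1090;1280;1281;1486;1487;1798;1799;
1868;1869;2190;2191;2249;2321;2572;2573;2754;2884;2885;3207;3649;3984];[::83;143;
273;344;345;395;454;525;660;706;707;897;1049;1099;1228;1229;1410;1480;1601;1807;
2115;2245;2763;2892;2893;3215;3527;3596;3597;3658;3779]]]%num.
Definition kcode : seq (seq (seq N)) := [::[::[::0]];
[::[::1;192;2560];[::0;769];[::3;448;2816];[::2;64;2432]];
[::[::1;68;961;1665;1794;2498];[::0;261;515;1473;2306;2368;3072];[::3;324;386;1667;
1921;2117;2754;3075];[::2;64;519;962;2370];[::5;199;2112;2627;3077];[::4;643;897;
964;1601;3200];[::7;67;1092;1216;2181];[::6;129;196;835;1285;1539;2626]];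
[::[::1;68;130;192;585;904;1157;1542;1665;2115;2369;3073;3202;3264];[::0;455;646;
769;1602;1664;2306;2368;3072;3587;3841];[::3;200;324;386;448;1545;1667;1921;2117;
2754;2816;3075];[::2;710;776;962];[::5;137;259;1346;1923;2881;3010];[::4;521;774;
1601;1792;2182;2434;3200;3969];[::7;198;264;450;773;1154;2375;2632;2756;3584];[::6;
72;1670;1793;1984;2183;2243;2688;3330];[::8;194;256;1221;1729;2433;3137;3328];[::9;
71;262;452;576;1218;1795;2630;2753;3203;3648]];
[::[::1;192;389;905;961;1794;2369;2560;3202];[::0;197;326;580;712;769;2120;2565;
2694;2883;3841];[::3;386;448;583;774;963;1090;1287;2182;3458];[::2;390;459;644;776;
962;1094;2052;2629;3074;3136];[::5;203;388;520;1027;1281;1987;2114;2889;3077];[::4;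
136;137;193;519;581;778;899;1088;1223;2561;3076;3394];[::7;198;266;267;641;770;
1474;2178;2240;2375;2820;3079];[::6;74;195;260;393;449;578;775;837;1282;1344;1541;
1670;2563];[::8;9;194;391;453;582;650;771;836;969;1095;1157;1540;2624];[::9;194;
391;582;650;1095;1157;1540;1858;2059;2433;2562;2821;3266];[::10;11;711;1218;1280;
2119;2379;2564;2753;3648];[::11;329;385;514;1218;2379]]]%num.
Definition wcode : seq (seq (seq N)) := [::[::[::];[::];[::];[::];[::];[::0];[::];[::];[::];[::];[::];[::];[::];[::];[::];
[::]];
[::[::];[::1];[::2561;2752];[::2561;2752];[::65;194;2624];[::65;1920;2624];[::];[::];
[::];[::];[::0];[::769;960;2368];[::641];[::];[::2];[::];[::3];[::768;3840];[::];
[::]];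
[::[::1;707;2055];[::70;193;899;1857;1924];[::771;1729;2119;2179;3328];[::640;2946];
[::835;1539;1922;2626;3392];[::1155];[::7;450;1025;1092;3139];[::5;199;513;580;1408;
2050;2627;2881];[::71;1280;1795];[::1219;1602;3587];[::832;1091;3842];[::2;64;519;
579;2241;3651];[::];[::];[::66;964;1093;1601;1792;2496];[::4;643];[::643;897;1093;
1287;1792;2496];[::128;897;964;1792;2051;2496;3200]];
[::[::1;68;192;585;1542;1794;1856;2055;2115;3073;3202];[::136;193;645;777;899;1026;
1088;1857;1924;2561];[::132;194;902;1606;1729;1796;1920;2310;2562;2624;3137];[::392;
516;1153;1282;1344;2048;2817;2884];[::1922;1984;2626;3330];[::1670;2183;3392];[::451;
834;896;1409;1538;1600;2113;2180];[::197;329;582;772;834;1155;1409;2113;2180;2242;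
2819];[::198;1731;1985;2880];[::198;264;450;773;1731;2181;2566;2689;2818;3139;3584];
[::1923;2627;2881];[::137;259;513;704;1094;1217;1346;2050;2881];[::];[::];[::1222];
[::3651;3905];[::324;1152;2311;3075;3206];[::201;263;520;1027;1158;1281;1987;2176;
3141;3649];[::4;964;1601;3200;3969];[::4;1093;1287;2496;3138;3200;3969];[::4;66;
1347;1601;1792;2496;3138;3200;3969]];
[::[::327;707;905;961;1031;1856;2115;2180;2369;2757;3202];[::1;192;389;518;586;905;
961;1031;1291;1856;2115;2180;2560];[::193;581;899;1223;1603;2307;3076];[::136;137;
384;710;1088;1603;1668;2307;2561;3076];[::1858;2562];[::8;9;256;771;2059;2821;3080];
[::837;1344;1541;2245;2817];[::74;75;449;578;1344;1541;1670;1859;2563];[::1922];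
[::834;2439;3205;3720];[::];[::];[::131;1280;1795];[::1280;1606;2181];[::196;385;711;
1280;1606;1795;2119;2379;2564];[::197;580;2177;2694];[::1219;1602;2306;2565;2694];
[::580;769;1030;1219;1602;1664;2120;2306;2694];[::198;387;832;1091;2240;2375];[::198;
1091;2566];[::7;198;387;584;1156;1474;2049;2178;2240];[::579;962;1283;2370];[::199;
644;1728;2432];[::199;261;459;579;833;962;1283;1728;2052;2241;2370;3136];[::68;257;
583;774;963;2053;3075];[::68;448;583;774;1152;1287;2053;2182;2625];[::5;203;323;
520;1027;1092;1410;2114;2176;2889;2945];[::5;203;388;520;768;1987;2114;3077]]]%num.

Definition decode (c : N) : positive * positive :=
  (N.succ_pos (N.div c 64), N.succ_pos (N.modulo c 64)).
Definition decodes (t : seq (seq (seq N))) (n : nat) : seq vec := map (map decode) (nth [::] t n).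

Definition gens : nat -> seq vec := decodes dcode.
Definition kgens : nat -> seq vec := decodes kcode.
Definition wgens : nat -> seq vec := decodes wcode.
Definition rk (n : nat) : nat := if n is n'.+1 then size (nth [::] dcode n') else 1.

(** * Search for a contraction by elimination *)

Definition ptree := PositiveMap.t (PositiveMap.t (vec * vec)).
Definition pfind (t : ptree) (q : positive * positive) : option (vec * vec) :=
  if PositiveMap.find q.1 t is Some t1 then PositiveMap.find q.2 t1 else None.
Definition padd (t : ptree) (q : positive * positive) (vc : vec * vec) : ptree :=
  PositiveMap.add q.1
    (PositiveMap.add q.2 vc
       (if PositiveMap.find q.1 t is Some t1 then t1 else PositiveMap.empty _)) t.

Fixpoint reduce (fuel : nat) (t : ptree) (v c : vec) : vec * vec :=
  if fuel is f.+1 then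
    if v is q :: _ then
      if pfind t q is Some vc then reduce f t (vxor v vc.1) (vxor c vc.2) else (v, c)
    else (v, c)
  else (v, c).

(** An echelon form of the image, keyed by smallest term, each row stored with a preimage. Basis
    elements are treated from the largest down. *)
Definition pivots (rw : tree) (b : vec) : ptree :=
  foldr (fun p t => let vc := reduce 2000 t (tget rw p) [:: p] in
                    if vc.1 is q :: _ then padd t q vc else t) (PositiveMap.empty _) b.

(** A vector is led by its smallest term. If q leads a boundary, [contraction] solves for q in terms
    of larger elements, already treated; any other q goes to 0. This is compatible with dd s + s dd
    = 1: [pivots] drops p exactly when p leads a cycle, so all preimages lie in the span of the
    elements leading no cycle. There dd is injective, which forces s dd to be the identity on that
    span. This explains the choice of order; what is relied on is the outcome of [contr_check]. *)
Definition contraction (rw : tree) (b0 b1 : vec) : tree :=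
  let piv := pivots rw b1 in
  foldr (fun q t =>
    if pfind piv q is Some vc then tset t q (vsum (vc.2 :: map (tget t) (behead vc.1))) else t)
    tempty b0.

(** Retabulating over the basis makes the values outside it empty by construction. *)
Definition contr_of (d : tree) (n : nat) : tree :=
  table (tget (contraction d (basis (rk n)) (basis (rk n.+1)))) (basis (rk n)).
Definition contr (n : nat) : tree := contr_of (rows (gens n)) n.

Definition square_check (d : tree) (L : seq vec) : bool := all (fun v => veq (tapp d v) [::]) L.
Definition contr_check (d0 d1 s0 s1 : tree) (r : nat) : bool :=
  all (fun q => veq (tapp d1 (tget s1 q)) (vxor [:: q] (tapp s0 (tget d0 q)))) (basis r).

(* Passing the tables on from degree to degree lets them be evaluated only once. *)
Fixpoint exact_check (k n : nat) (d s : tree) : bool :=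
  if k is k'.+1 then
    let d' := rows (gens n.+1) in
    let s' := contr_of d' n.+1 in
    [&& square_check d (gens n.+1), contr_check d d' s s' (rk n.+1) & exact_check k' n.+1 d' s']
  else true.

Lemma exact_checkP k n i : exact_check k n (rows (gens n)) (contr n) -> (i < k)%N ->
  square_check (rows (gens (n + i))) (gens (n + i).+1) &&
  contr_check (rows (gens (n + i))) (rows (gens (n + i).+1)) (contr (n + i)) (contr (n + i).+1) (rk (n + i).+1).
Proof.
elim: k n i => [|k IHk] n [|i] //=; first by rewrite addn0 => /and3P[-> -> _].
by move=> /and3P[_ _ /IHk ck] ik; rewrite addnS -addSn; apply: ck.
Qed.

Lemma exact13 : exact_check 13 0 (rows (gens 0)) (contr 0).
Proof. by vm_compute. Qed.

Lemma size_gens n : size (gens n) = rk n.+1. Proof. by rewrite size_map. Qed.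

Lemma gens_out n : (13 < n)%N -> gens n = [::].
Proof. by move=> n13; rewrite /gens /decodes nth_default. Qed.

Lemma all_lt (p : pred nat) m n : all p (iota 0 m) -> (n < m)%N -> p n.
Proof. by move=> /allP pP nm; apply: pP; rewrite mem_iota. Qed.

Lemma gens_gens n : all (fun v => veq (tapp (rows (gens n)) v) [::]) (gens n.+1).
Proof.
have [n13|n13] := ltnP n 13; last by rewrite [gens n.+1]gens_out.
by have /andP[] := exact_checkP exact13 n13.
Qed.

Lemma gens_minimal n : all (all (fun q => ~~ Pos.eqb q.1 1)) (gens n).
Proof.
have [n14|n14] := ltnP n 14; last by rewrite gens_out.
apply: (@all_lt (fun n => all (all (fun q => ~~ Pos.eqb q.1 1)) (gens n))) n14.
by vm_compute.
Qed.

Lemma contr_out n q : ~~ has (peq q) (basis (rk n)) -> tget (contr n) q = [::].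
Proof. by rewrite tget_table => /negbTE ->. Qed.

Lemma contr0P :
  all (fun q => veq (tapp (rows (gens 0)) (tget (contr 0) q))
                    (if Pos.eqb q.1 1 then [::] else [:: q])) (basis (rk 0)).
Proof. by vm_compute. Qed.

Lemma contrP n : (n.+1 < 14)%N ->
  all (fun q => veq (tapp (rows (gens n.+1)) (tget (contr n.+1) q))
                    (vxor [:: q] (tapp (contr n) (tget (rows (gens n)) q)))) (basis (rk n.+1)).
Proof. by rewrite ltnS => n13; have /andP[] := exact_checkP exact13 n13. Qed.

Definition commutes (f : vec -> vec) (d d' : tree) (L L' : seq vec) : bool :=
  all2 (fun x y => veq (tapp d x) (tapp d' (f y))) L L'.
Definition chain_check (i : nat) : bool :=
  commutes id (rows (gens i)) (rows (wgens i)) (wgens i.+1) (gens (i + 6)%N).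
Definition twist_check (i : nat) : bool :=
  commutes frobv (rows (gens i)) (rows (kgens i)) (kgens i.+1) (gens i).

Lemma chain_checkP i : (i < 4)%N -> chain_check i.
Proof. by move=> i4; apply: (fun H => @all_lt chain_check 4 i H i4); vm_compute. Qed.
Lemma twist_checkP i : (i < 4)%N -> twist_check i.
Proof. by move=> i4; apply: (fun H => @all_lt twist_check 4 i H i4); vm_compute. Qed.

(** * The classes Y, W, g, e and their relations *)

Section Classes.
Variables (F : fieldType) (E : finGroupType) (al be : E -> F).
Hypothesis F2 : forall x : F, x + x = 0.
Hypothesis alM : forall g h, al (g * h)%g = al g + al h.
Hypothesis beM : forall g h, be (g * h)%g = be g + be h + al g ^+ 4 * al h.
Hypothesis al16 : forall g, al g ^+ 16 = al g.
Hypothesis be4 : forall g, be g ^+ 4 = be g + al g ^+ 5.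
Local Notation c := (mono al be).
Variable mu : positive -> E -> F.
Hypothesis mu_mono : forall m m', inm m' -> \sum_h mu m h * c m' h = (Pos.eqb m m')%:R.
Hypothesis mono_mu : forall h h', \sum_(p <- exps) c (mon p.1 p.2) h * mu (mon p.1 p.2) h' = (h == h')%:R.
Hypothesis mu_out : forall m h, ~~ inm m -> mu m h = 0.

Local Notation cob := (@cob F E).
Local Notation cocyc := (@cocyc F E).
Local Notation xs := (xs al).
Local Notation xl := (xl al).

Definition cl n (l : seq positive) : seq E -> F :=
  cls (@act F E rk) (@s F E al be mu rk contr) (one F E rk) (lin (@co F E rk) (@ind F rk n l)).

Let cocyc_l n l : (n < 14)%N -> cocyc n (cl n l).
Proof. exact: (cocyc_cl F2 alM beM al16 be4 mu_mono mono_mu mu_out size_gens erefl gens_minimal contr_out contr0P contrP). Qed.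

Let xs_l n t f l l' : cob n.+1 (fun z => f z + cl n.+1 l z) ->
  all (fun i => i < 4)%N t -> (size t + n.+1 <= 14)%N -> xsteps rk gens n.+1 t l = l' ->
  cob (size t + n.+1) (fun z => xs t f z + cl (size t + n.+1) l' z).
Proof. exact: (xs_rep F2 alM beM al16 be4 mu_mono mono_mu mu_out size_gens erefl gens_minimal contr_out contr0P contrP). Qed.

Let one_l t l' : all (fun i => i < 4)%N t -> (size t <= 14)%N -> xsteps rk gens 0 t [:: 1%positive] = l' ->
  cob (size t) (fun z => xs t (fun _ => 1) z + cl (size t) l' z).
Proof. exact: (xs_one F2 alM beM al16 be4 mu_mono mono_mu mu_out size_gens erefl gens_minimal contr_out contr0P contrP). Qed.

Let ess_l n f wt g l' lam : cob n.+1 (fun z => f z + cl n.+1 l' z) -> (n < 14)%N ->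
  ess_check rk gens n wt g l' -> lam ^+ 15 = 1 ->
  exists k, cob n.+1 (fun z => f z + xcup (xl lam) k z).
Proof. exact: (ess_rep F2 alM beM al16 be4 mu_mono mono_mu mu_out size_gens erefl gens_minimal contr_out contr0P contrP). Qed.

Let xs_neq0 n t l (j : 'I_(rk (size t + n.+1))) : (n.+1 < 14)%N -> all (fun i => i < 4)%N t ->
  odd (count (Pos.eqb (Pos.of_succ_nat j)) (xsteps rk gens n.+1 t l)) ->
  ~ cob (size t + n.+1) (xs t (cl n.+1 l)).
Proof. exact: (xs_cl_neq0 F2 alM beM al16 be4 mu_mono mono_mu mu_out size_gens erefl gens_gens gens_minimal contr_out contr0P contrP). Qed.

Lemma cl_refl n l : cob n (fun z => cl n l z + cl n l z).
Proof. by apply: cob_ext (cob0 F E n) => z _; rewrite F2. Qed.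

Lemma all_lt_eq (f g : nat -> bool) m n :
  all (fun j => f j == g j) (iota 0 m) -> (n < m)%N -> f n = g n.
Proof. by move=> fg /(all_lt fg)/eqP. Qed.

Lemma YW : cob 10 (fun z => scup 4 (cl 4 [:: 6%positive]) (cl 6 [:: 6%positive]) z + cl 10 [:: 27; 28]%positive z).
Proof.
have k0 (j : 'I_(rk 6)) : @ind F rk 6 [:: 6%positive] j =
    \sum_(x <- nth [::] (wgens 0) j) (Pos.eqb x.2 1 && Pos.eqb x.1 1)%:R.
  rewrite -unit_genE // /ind; congr (nat_of_bool _)%:R.
  apply: (@all_lt_eq (fun j => odd (count (Pos.eqb (Pos.of_succ_nat j)) [:: 6%positive]))
    (fun j => unit_gen (nth [::] (wgens 0) j))) (ltn_ord j).
  by vm_compute.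
apply: (scup_cl F2 alM beM al16 be4 mu_mono mono_mu mu_out size_gens erefl gens_minimal contr_out contr0P contrP
  k0 (n := 4)) => //.
- by move=> [|[|[|[|]]]].
- by move=> i; apply: chain_checkP.
move=> j; rewrite (ind_pull F2).
congr (@ind F rk 10 _ j); by vm_compute.
Qed.

(** The twist of Y is the class of generator 5, which is needed to compute the twisted summand in
    [ess_phi]. *)
Lemma kgens_frob :
  cob 4 (fun z => cl 4 [:: 5%positive] z + cl 4 [:: 6%positive] z ^+ 4).
Proof.
have k0 (j : 'I_(rk 0)) :
    \sum_(x <- nth [::] (kgens 0) j) (Pos.eqb x.2 1 && Pos.eqb x.1 1)%:R = 1 :> F.
  rewrite -unit_genE // -[1]/(true%:R); congr (nat_of_bool _)%:R.
  by apply: (@all_lt (fun j => unit_gen (nth [::] (kgens 0) j)) (rk 0)); [vm_compute|].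
apply: (frob_cl F2 alM beM al16 be4 mu_mono mono_mu mu_out size_gens erefl gens_minimal contr_out contr0P contrP
  k0 (n := 4)) => //.
- by move=> [|[|[|[|]]]].
- by move=> i; apply: twist_checkP.
move=> j; rewrite (ind_pull F2).
transitivity (@ind F rk 4 [:: 6%positive] j).
  by rewrite /ind; case: (odd _); rewrite ?expr1n ?expr0n.
congr (@ind F rk 4 _ j); by vm_compute.
Qed.

Lemma cl_nil n z : cl n [::] z = 0.
Proof. by apply: big1 => i _; apply: big1 => h _; apply: mulr0. Qed.

Lemma cl_cat n l l' z : cl n l z + cl n l' z = cl n (l ++ l') z.
Proof.
rewrite /cl /Bar.cls /lin /extend -big_split; apply: eq_bigr => i _; rewrite -big_split.
apply: eq_bigr => h _; rewrite [LHS](esym (mulrDr _ _ _)); congr (_ * _).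
by rewrite /ind count_cat -!natr_odd // natrD.
Qed.

Lemma frob_xs00 f z : xs [:: 0; 0]%N f z ^+ 4 = xs [:: 2; 2]%N (fun l => f l ^+ 4) z.
Proof.
by case: z => [|a [|b [|d z]]]; rewrite /= ?expr0n // ?mulr0 ?exprMn ?frobD // expr0n.
Qed.

(* The lists [wt_of] come from the action of F^* by [(a, b) -> (lam a, lam^5 b)]: the cocycle
   giving the multiple of [xl lam] has the coordinate [lam ^+ wt k] on the [k]-th generator. *)
Definition wt_of (t : seq nat) (k : positive) : nat := nth 0 t (Pos.to_nat k).-1.

Definition ess n (f : seq E -> F) : Prop :=
  forall lam, lam ^+ 15 = 1 -> exists k, cob n (fun z => f z + xcup (xl lam) k z).

Local Notation Y := (cl 4 [:: 6%positive]).
Local Notation W := (cl 6 [:: 6%positive]).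
Local Notation g := (cl 10 [:: 27%positive]).
Local Notation ee := (cl 14 [:: 33%positive]).

Lemma g_products k : (k < 4)%N ->
  cob 14 (fun z => xs [:: k; k; k; (k.+1 %% 4)%N] g z + cl 14 (if odd k then [::] else [:: 33%positive]) z).
Proof.
move=> k4; have t4 : all (fun i => i < 4)%N [:: k; k; k; (k.+1 %% 4)%N] by rewrite /= k4 ltn_mod.
apply: (@xs_l 9 _ g _ _ (cl_refl _ _) t4 isT).
case: k k4 {t4} => [|[|[|[|k]]]] // _; by vm_compute.
Qed.

Lemma ee_neq0 : ~ cob 14 ee.
Proof.
move=> ee0; have i33 : (32 < rk 14)%N by [].
have h33 : odd (count (Pos.eqb 33) (xsteps rk gens 10 [:: 0; 0; 0; 1]%N [:: 27%positive])) by vm_compute.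
apply: (@xs_neq0 9 [:: 0; 0; 0; 1]%N [:: 27%positive] (Ordinal i33) isT isT h33).
by apply: (cob_eq F2 _ ee0); apply: cob_sym; exact: (g_products (k := 0) isT).
Qed.

(** The factors come in the order x_0 x_1 x_0 x_0 since psi will supply the first two and phi the
    last two. *)
Lemma YW_product : cob 14 (fun z => xs [:: 0; 1; 0; 0]%N (scup 4 Y W) z + ee z).
Proof.
have e4 : xsteps rk gens 10 [:: 0; 1; 0; 0]%N [:: 27; 28]%positive = [:: 33%positive] by vm_compute.
exact: (@xs_l 9 [:: 0; 1; 0; 0]%N _ _ _ YW isT isT e4).
Qed.

Lemma xs_01kk k : (0 < k < 4)%N -> cob 4 (xs [:: 0; 1; k; k]%N (fun _ => 1)).
Proof.
have x0 i : xsteps rk gens 0 [:: 0; 1; i; i]%N [:: 1%positive] = [::] -> (i < 4)%N ->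
    cob 4 (xs [:: 0; 1; i; i]%N (fun _ => 1)).
  move=> i0 i4; have ii : all (fun i => i < 4)%N [:: 0; 1; i; i]%N by rewrite /= i4.
  by apply: cob_ext (one_l ii isT i0) => z _; rewrite cl_nil addr0.
have f1 : xsteps rk gens 0 [:: 0; 1; 1; 1]%N [:: 1%positive] = [::] by vm_compute.
have f2 : xsteps rk gens 0 [:: 0; 1; 2; 2]%N [:: 1%positive] = [::] by vm_compute.
have f3 : xsteps rk gens 0 [:: 0; 1; 3; 3]%N [:: 1%positive] = [::] by vm_compute.
case: k => [|[|[|[|k]]]] k4; first discriminate k4; last discriminate k4.
- exact: x0 f1 isT.
- exact: x0 f2 isT.
- exact: x0 f3 isT.
Qed.

Lemma ess_theta : ess 4 (xs [:: 0; 0; 0; 1]%N (fun _ => 1)).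
Proof.
move=> lam lam15.
have e5 : xsteps rk gens 0 [:: 0; 0; 0; 1]%N [:: 1%positive] = [:: 10%positive] by vm_compute.
(* The cofactor is lam^14 times the class of the second generator of degree 3: only the second
   weight of the list is used here. *)
have chk : ess_check rk gens 3 (wt_of [:: 11; 14; 12; 3; 13; 7; 1; 4; 0; 5]%N) [:: 2]%positive
  [:: 10]%positive by vm_compute.
have o5 := @one_l [:: 0; 0; 0; 1]%N _ isT isT e5.
exact: (@ess_l 3 _ _ _ _ _ o5 isT chk lam15).
Qed.

Lemma ess_g : ess 10 g.
Proof.
move=> lam lam15.
have chk : ess_check rk gens 9
  (wt_of [:: 6; 9; 7; 13; 8; 8; 2; 2; 11; 11; 14; 14; 12; 3; 1; 4; 10; 0; 5; 5; 5]%N)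
  [:: 1; 2; 10; 12; 18]%positive [:: 27]%positive by vm_compute.
exact: (@ess_l 9 _ _ _ _ _ (cl_refl _ _) isT chk lam15).
Qed.

Lemma ess_phi : ess 6 (fun z => xs [:: 0; 0]%N Y z + xs [:: 0; 0]%N Y z ^+ 4).
Proof.
move=> lam lam15.
have chk : ess_check rk gens 5 (wt_of [:: 3; 12; 6; 9; 7; 13; 11; 14; 5; 10; 0; 0; 0]%N)
  [:: 7; 8; 12; 13]%positive [:: 14; 15]%positive by vm_compute.
apply: (@ess_l 5 _ _ _ _ _ _ isT chk lam15).
have Y4 : cob 4 (fun z => Y z ^+ 4 + cl 4 [:: 5%positive] z) by apply: cob_sym; apply: kgens_frob.
have e6 : xsteps rk gens 4 [:: 0; 0]%N [:: 6%positive] = [:: 13; 14]%positive by vm_compute.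
have e7 : xsteps rk gens 4 [:: 2; 2]%N [:: 5%positive] = [:: 13; 15]%positive by vm_compute.
have A := @xs_l 3 [:: 0; 0]%N Y _ _ (cl_refl _ _) isT isT e6.
have B := @xs_l 3 [:: 2; 2]%N _ _ _ Y4 isT isT e7.
apply: cob_ext (cobD A B) => z sz.
(* Generator 13 occurs both in x_0^2 Y and in its twist and cancels, leaving 14 and 15. *)
rewrite addrACA cl_cat; congr (_ + _ + _); last first.
  apply: eq_lin => j; rewrite /ind; move: (Pos.eqb _) => p /=.
  by case: (p 13%positive); case: (p 14%positive); case: (p 15%positive).
exact: esym (frob_xs00 Y z).
Qed.

Lemma ess_psi : ess 8 (xs [:: 0; 1]%N W).
Proof.
move=> lam lam15.
have chk : ess_check rk gens 7
  (wt_of [:: 1; 1; 4; 4; 2; 2; 8; 8; 7; 7; 13; 13; 11; 11; 14; 14; 5; 10; 0; 0]%N)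
  [:: 2; 7; 15]%positive [:: 16]%positive by vm_compute.
apply: (@ess_l 7 _ _ _ _ _ _ isT chk lam15).
have e8 : xsteps rk gens 6 [:: 0; 1]%N [:: 6%positive] = [:: 16%positive] by vm_compute.
exact: (@xs_l 5 [:: 0; 1]%N W _ _ (cl_refl _ _) isT isT e8).
Qed.

Lemma classes : exists Y W g ee : seq E -> F,
  [/\ cocyc 4 Y, cocyc 6 W, cocyc 10 g & ~ cob 14 ee] /\
  [/\ forall k, (k < 4)%N -> cob 14 (fun z => xs [:: k; k; k; (k.+1 %% 4)%N] g z + if odd k then 0 else ee z),
      cob 14 (fun z => xs [:: 0; 1; 0; 0]%N (scup 4 Y W) z + ee z) &
      forall k, (0 < k < 4)%N -> cob 4 (xs [:: 0; 1; k; k]%N (fun _ => 1))] /\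
  [/\ ess 4 (xs [:: 0; 0; 0; 1]%N (fun _ => 1)), ess 10 g,
      ess 6 (fun z => xs [:: 0; 0]%N Y z + xs [:: 0; 0]%N Y z ^+ 4) &
      ess 8 (xs [:: 0; 1]%N W)].
Proof.
exists Y, W, g, ee; split; last split.
- by split; [exact: cocyc_l | exact: cocyc_l | exact: cocyc_l | exact: ee_neq0].
- split; [move=> k k4 | exact: YW_product | exact: xs_01kk].
  by apply: cob_ext (g_products k4) => z _; case: (odd k); rewrite ?cl_nil.
- by split; [exact: ess_theta | exact: ess_g | exact: ess_phi | exact: ess_psi].
Qed.
End Classes.

(** * Existence of the basis dual to the monomials *)

Section Interpolation.
Variables (F : fieldType).

Definition lagrange (rs : seq F) (a : F) : {poly F} :=
  \prod_(x <- rs | x != a) ((a - x)^-1 *: ('X - x%:P)).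

Lemma lagrangeE rs a y : y \in rs -> (lagrange rs a).[y] = (y == a)%:R.
Proof.
move=> yr; rewrite /lagrange horner_prod; have [->|ya] := eqVneq y a.
  rewrite big1 // => x xa; rewrite hornerZ hornerXsubC mulVf // subr_eq0 eq_sym //.
elim: rs yr => // x rs IHrs; rewrite inE big_cons => /predU1P[<-|yr].
  by rewrite ya hornerZ hornerXsubC subrr mulr0 mul0r.
by rewrite IHrs //; case: ifP; rewrite ?mulr0.
Qed.

Lemma size_lagrange rs a : uniq rs -> a \in rs -> (size (lagrange rs a) <= size rs)%N.
Proof.
move=> ur ar; rewrite /lagrange -big_filter.
have -> : size rs = (size [seq x <- rs | x != a]).+1.
  rewrite size_filter -(count_predC (pred1 a)) count_uniq_mem // ar add1n; congr _.+1.
elim: [seq x <- rs | x != a] => [|x s IHs]; first by rewrite big_nil size_poly1.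
rewrite big_cons -scalerAl (leq_trans (size_scale_leq _ _)) //.
by rewrite (leq_trans (size_polyMleq _ _)) // size_XsubC.
Qed.
End Interpolation.

Section DualBasis.
Variables (F : fieldType) (E : finGroupType) (al be : E -> F).
Hypothesis al16 : forall g, al g ^+ 16 = al g.
Hypothesis be4 : forall g, be g ^+ 4 = be g + al g ^+ 5.
Hypothesis inj : forall g h, al g = al h -> be g = be h -> g = h.
Hypothesis cardE : #|E| = 64%N.
Local Notation c := (mono al be).

Let als := undup [seq al h | h <- enum E].
Let bes a := undup [seq be h | h <- enum E & al h == a].
(** The function that is 1 at h and 0 elsewhere is an interpolation polynomial in a times one in b
    over the fibre of a; [mu m h] is its coefficient at monomial m. The degrees fit because a has at
    most 16 values and b at most 4 on each fibre. *)
Let mu (m : positive) (h : E) : F :=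
  if inm m then (lagrange als (al h))`_(ex m) * (lagrange (bes (al h)) (be h))`_(ey m) else 0.

Let size_als : (size als <= 16)%N.
Proof.
have sp : size ('X^16 - 'X : {poly F}) = 17%N by rewrite size_polyDl ?size_polyXn // size_polyN size_polyX.
rewrite -ltnS -sp; apply: max_poly_roots; rewrite ?undup_uniq -?size_poly_eq0 ?sp //.
apply/allP => x; rewrite mem_undup => /mapP[h _ ->].
by rewrite rootE !hornerE al16 subrr.
Qed.

Let size_bes a : (size (bes a) <= 4)%N.
Proof.
pose p : {poly F} := 'X^4 - ('X + (a ^+ 5)%:P).
have sp : size p = 5%N.
  by rewrite /p size_polyDl ?size_polyXn // size_polyN size_XaddC.
rewrite -ltnS -sp; apply: max_poly_roots; rewrite ?undup_uniq -?size_poly_eq0 ?sp //.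
apply/allP => x; rewrite mem_undup => /mapP[h]; rewrite mem_filter => /andP[/eqP ha _] ->.
by rewrite rootE /p !hornerE be4 ha subrr.
Qed.

Let mono_mu h h' : \sum_(p <- exps) c (mon p.1 p.2) h * mu (mon p.1 p.2) h' = (h == h')%:R.
Proof.
transitivity ((lagrange als (al h')).[al h] * (lagrange (bes (al h')) (be h')).[be h]).
  have hals : al h' \in als by rewrite mem_undup map_f ?mem_enum.
  have hbes : be h' \in bes (al h') by rewrite mem_undup map_f // mem_filter eqxx mem_enum.
  rewrite (@horner_coef_wide _ 16); last exact: leq_trans (size_lagrange (undup_uniq _) hals) size_als.
  rewrite (@horner_coef_wide _ 4); last exact: leq_trans (size_lagrange (undup_uniq _) hbes) (size_bes _).
  rewrite mulrC big_distrl big_exps -[iota 0 4]/(index_iota 0 4) big_mkord; apply: eq_bigr => j _.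
  rewrite big_distrr -[iota 0 16]/(index_iota 0 16) big_mkord; apply: eq_bigr => i _ /=.
  have pe : (i : nat, j : nat) \in exps by rewrite mem_exps /= !ltn_ord.
  have [ei ej] : ex (mon i j) = i /\ ey (mon i j) = j.
    by rewrite /ex /ey /mon /idx; split; move: (ltn_ord i) (ltn_ord j); lia.
  by rewrite /mu (mon_inm pe) /mono ei ej; ring.
rewrite lagrangeE; last by rewrite mem_undup map_f ?mem_enum.
have [aE|] := eqVneq (al h) (al h'); last first.
  by move=> ah; rewrite mul0r; case: eqP => // hh; rewrite hh eqxx in ah.
rewrite mul1r lagrangeE; last by rewrite mem_undup map_f // mem_filter aE eqxx mem_enum.
by congr (nat_of_bool _)%:R; apply/eqP/eqP => [bE|-> //]; apply: inj.
Qed.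

(** [mono_mu] is a one-sided inverse relation between matrices. They are square, as there are 64
    monomials and 64 group elements, so the product in the other order is also 1. *)
Lemma dual_basis : exists mu : positive -> E -> F,
  [/\ forall m m', inm m' -> \sum_h mu m h * c m' h = (Pos.eqb m m')%:R,
      forall h h', \sum_(p <- exps) c (mon p.1 p.2) h * mu (mon p.1 p.2) h' = (h == h')%:R
    & forall m h, ~~ inm m -> mu m h = 0].
Proof.
exists mu; split=> // [m m' m'i|m h mi]; last by rewrite /mu (negbTE mi).
have [mi|mi] := boolP (inm m); last first.
  rewrite big1 => [|h _]; last by rewrite /mu (negbTE mi) mul0r.
  by case: Pos.eqb_spec => // mm; rewrite mm m'i in mi.
pose pe (i : 'I_#|E|) := nth (0, 0)%N exps i.
pose C := \matrix_(i < #|E|, j < #|E|) c (mon (pe j).1 (pe j).2) (enum_val i).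
pose U := \matrix_(i < #|E|, j < #|E|) mu (mon (pe i).1 (pe i).2) (enum_val j).
have sz : size exps = #|E| by rewrite cardE.
have CU : C *m U = 1%:M.
  apply/matrixP => i j; rewrite !mxE -(inj_eq enum_val_inj) -mono_mu (big_nth (0, 0)%N) sz big_mkord.
  by apply: eq_bigr => k _; rewrite !mxE.
have [[p pin ->] [p' p'in ->]] := (inm_mon mi, inm_mon m'i).
have pP q : q \in exps -> {i | pe i = q}.
  by move=> qe; have qi : (index q exps < #|E|)%N by [rewrite -sz index_mem]; exists (Ordinal qi); apply: nth_index.
have [[i iE] [j jE]] := (pP p pin, pP p' p'in).
have /matrixP/(_ i j) := mulmx1C CU; rewrite !mxE => UC.
transitivity ((i == j)%:R : F).
  rewrite -UC (reindex_onto enum_val enum_rank) /= => [|h _]; last exact: enum_rankK.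
  rewrite (eq_bigl xpredT) => [|k]; last by rewrite enum_valK eqxx.
  by apply: eq_bigr => k _; rewrite !mxE iE jE.
congr (nat_of_bool _)%:R; case: Pos.eqb_spec => [mm|mm]; last by apply/eqP => ij; case: mm; rewrite -iE ij jE.
apply/eqP/val_inj/eqP; rewrite -(nth_uniq (0, 0)%N (s := exps)) ?sz ?ltn_ord //.
rewrite -/(pe i) -/(pe j) iE jE.
move: mm pin p'in; rewrite !mem_exps; case: (p) (p') => a b [a' b'] /=.
move=> mm /andP[a16 b4] /andP[a16' b4']; apply/eqP; congr (_, _); move: mm; rewrite /mon; lia.
Qed.
End DualBasis.

(** * Descent to the prime field *)

Section Trace.
Variable F : finFieldType.
Hypothesis cardF : #|F| = 16%N.

Lemma exp16 (x : F) : x ^+ 16 = x.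
Proof. by rewrite -cardF expf_card. Qed.

Lemma addrr_F16 (x : F) : x + x = 0.
Proof.
have N1 : -1 = 1 :> F by rewrite -[LHS]exp16 -signr_odd expr0.
by rewrite -{2}[x]mul1r -N1 mulN1r subrr.
Qed.

Lemma exp15 (x : F) : x != 0 -> x ^+ 15 = 1.
Proof. by move=> x0; apply: (mulfI x0); rewrite -exprS exp16 mulr1. Qed.

Lemma sqrD_F16 (x y : F) : (x + y) ^+ 2 = x ^+ 2 + y ^+ 2.
Proof. by rewrite sqrrD mulr2n addrr_F16 addr0. Qed.

Definition tr (x : F) : F := x + x ^+ 2 + (x ^+ 2) ^+ 2 + ((x ^+ 2) ^+ 2) ^+ 2.

Lemma trD x y : tr (x + y) = tr x + tr y.
Proof. by rewrite /tr !sqrD_F16; ring. Qed.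

Lemma tr_sqr x : tr (x ^+ 2) = tr x.
Proof. by rewrite /tr -[((((x ^+ 2) ^+ 2) ^+ 2) ^+ 2)]exprM -!exprM exp16; ring. Qed.

Lemma sqr_tr x : tr x ^+ 2 = tr x.
Proof. by rewrite -[RHS]tr_sqr /tr !sqrD_F16. Qed.

Lemma tr01 x : tr x = 0 \/ tr x = 1.
Proof.
have /eqP : tr x * (tr x - 1) = 0 by rewrite mulrBr mulr1 -expr2 sqr_tr subrr.
by rewrite mulf_eq0 subr_eq0 => /orP[] /eqP ->; [left | right].
Qed.

Lemma tr0 : tr 0 = 0. Proof. by rewrite /tr !expr0n /= !addr0. Qed.

Lemma trM x y : tr x * tr y = tr (tr x * y).
Proof. by case: (tr01 x) => ->; rewrite ?mul0r ?tr0 ?mul1r. Qed.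

(** Multiplication by some u with u^k different from 1 permutes the field and scales the sum by
    u^k. *)
Lemma sum_pow k : (0 < k < 15)%N -> \sum_(a : F) a ^+ k = 0.
Proof.
move=> /andP[k0 k15].
have [u u0 uk] : exists2 u : F, u != 0 & u ^+ k != 1.
  apply/exists_inP; rewrite -negb_forall_in; apply/negP => /forall_inP all1.
  have sp : size ('X^k - 1 : {poly F}) = k.+1 by rewrite size_XnsubC.
  have : (size (enum (predC1 (0%R : F))) < size ('X^k - 1 : {poly F})%R)%N.
    apply: max_poly_roots; rewrite ?enum_uniq -?size_poly_eq0 ?sp //.
    apply/allP => x; rewrite mem_enum => /all1/eqP xk.
    by rewrite rootE !hornerE xk subrr.
  by rewrite sp -cardE cardC1 cardF ltnS leqNgt k15.
have /eqP : (u ^+ k - 1) * \sum_(a : F) a ^+ k = 0.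
  rewrite mulrBl mul1r big_distrr [X in _ - X](reindex_inj (mulfI u0)) /=.
  by rewrite -sumrB big1 // => a _; rewrite exprMn subrr.
by rewrite mulf_eq0 subr_eq0 (negbTE uk) => /eqP.
Qed.

(** After reducing by a^16 = a, the powers of a that occur are 15, 1, 3 and 7, and only the first
    has a nonzero sum. Thus a class whose scaled traces all vanish is itself zero. *)
Lemma tr_inversion x : \sum_(a : F) a ^+ 14 * tr (a * x) = x.
Proof.
transitivity ((\sum_(a : F) a ^+ 15) * x + (\sum_(a : F) a ^+ 1) * x ^+ 2 +
              (\sum_(a : F) a ^+ 3) * x ^+ 4 + (\sum_(a : F) a ^+ 7) * x ^+ 8).
  rewrite !big_distrl -!big_split; apply: eq_bigr => a _ /=.
  have -> : a ^+ 14 * tr (a * x) =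
      a ^+ 15 * x + a ^+ 16 * x ^+ 2 + a ^+ 16 * a ^+ 2 * x ^+ 4 + a ^+ 16 * a ^+ 6 * x ^+ 8.
    by rewrite /tr; ring.
  by rewrite exp16; ring.
rewrite (@sum_pow 1) // (@sum_pow 3) // (@sum_pow 7) // !mul0r !addr0 (bigD1 0) //= expr0n add0r.
rewrite (eq_bigr (fun _ => 1)) => [|a a0]; last exact: exp15.
rewrite sumr_const cardC1 cardF -[RHS]mul1r; congr (_ * _).
by rewrite /= (_ : 15 = 1 + (7 + 7))%N // mulrnDr mulrnDr addrr_F16 addr0.
Qed.
End Trace.

(** * Traces of classes and their products over F_2 *)

Section Assembly.
Variable F : finFieldType.
Hypothesis cardF : #|F| = 16%N.
Variables (E : finGroupType) (al be : E -> F).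
Hypothesis alM : forall g h, al (g * h)%g = al g + al h.
Hypothesis beM : forall g h, be (g * h)%g = be g + be h + al g ^+ 4 * al h.
Hypothesis be4 : forall g, be g ^+ 4 = be g + al g ^+ 5.
Hypothesis inj : forall g h, al g = al h -> be g = be h -> g = h.
Hypothesis cardE : #|E| = 64%N.
Hypothesis alT : forall a, exists h, al h = a.

Let F2 := addrr_F16 cardF.
Local Notation cob := (@cob F E).
Local Notation cocyc := (@cocyc F E).
Local Notation xs := (xs al).
Local Notation xk := (xk al).
Local Notation xl := (xl al).
Local Notation tr := (@tr F).

Let al16 h : al h ^+ 16 = al h. Proof. exact: exp16. Qed.
Let xkM i := @xkM F E al F2 alM i.

Definition nx (i : nat) : nat := (i.+1 %% 4)%N.

Lemma xk_sqr i h : (i < 4)%N -> xk i h ^+ 2 = xk (nx i) h.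
Proof. by rewrite /Free.xk -exprM; case: i => [|[|[|[|]]]] // _; rewrite /nx /= exp16. Qed.

(** The square is taken of the values, not as a cup product: it twists the coefficients and shifts
    the indices of the x_i cyclically. *)
Lemma xs_sqr t f g l : all (fun i => i < 4)%N t -> (forall z, f z ^+ 2 = g z) ->
  xs t f l ^+ 2 = xs (map nx t) g l.
Proof.
move=> + fg; elim: t l => //= i t IHt l /andP[i4 t4]; case: l => [|a [|b l]] /=; rewrite ?expr0n //.
by rewrite exprMn sqrD_F16 // !xk_sqr // IHt.
Qed.

Lemma xs_eq t f g l : f =1 g -> xs t f l = xs t g l.
Proof. by move=> fg; elim: t l => //= i t IHt [|a [|b l]] //=; rewrite IHt. Qed.

Lemma scup_xs p t f g l : scup (size t + p) (xs t f) g l = xs t (scup p f g) l.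
Proof.
elim: t l => //= i t IHt [|a [|b l]]; rewrite /scup /= ?mul0r //.
by rewrite -mulrA; congr (_ * _); apply: (IHt (b :: l)).
Qed.

Lemma cocyc_xs n t f : cocyc n f -> cocyc (size t + n) (xs t f).
Proof. by move=> cf; elim: t => //= i t IHt; apply: (cocyc_xcup F2 (xkM i)). Qed.

Lemma cocyc_one : cocyc 0 (fun _ => 1).
Proof. by split=> // -[|a [|b [|]]] //= _; rewrite addr0 F2. Qed.

Lemma cocyc_sqr n f : cocyc n f -> cocyc n (fun l => f l ^+ 2).
Proof. by apply: (cocyc_morph (phi := fun x => x ^+ 2)); [apply: expr0n | apply: sqrD_F16]. Qed.

Definition trc (c : F) (f : seq E -> F) (l : seq E) : F := tr (c * f l).

Let phi0 c : tr (c * 0) = 0. Proof. by rewrite mulr0 tr0. Qed.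
Let phiD c : {morph (fun x => tr (c * x)) : x y / x + y}.
Proof. by move=> x y; rewrite mulrDr trD. Qed.

Lemma cocyc_trc n c f : cocyc n f -> cocyc n (trc c f).
Proof. exact: (cocyc_morph (phi := fun x => tr (c * x)) (phi0 c) (phiD c)). Qed.

Definition binary (f : seq E -> F) : Prop := forall l, f l = 0 \/ f l = 1.

(** Cohomology over F_2 requires a bounding cochain with values 0 and 1. The trace of a bounding
    cochain over [F] is one, which gives [cob_trc]. *)
Definition cob2 n (f : seq E -> F) : Prop :=
  exists2 C : seq E -> F, invariant C /\ binary C & forall l, size l = n.+1 -> f l = bnd C l.

Lemma cob_trc n c f : cob n f -> cob2 n (trc c f).
Proof.
move=> [C iC CP]; exists (trc c C) => [|l sl].
  by split=> [g l|l]; [rewrite /trc iC | apply: tr01].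
by rewrite /trc CP // (bnd_morph (phi := fun x => tr (c * x)) _ _ (phi0 c) (phiD c)).
Qed.

Lemma cob2D n f g : cob2 n f -> cob2 n g -> cob2 n (fun l => f l + g l).
Proof.
move=> [C [iC bC] CP] [C' [iC' bC'] CP']; exists (fun l => C l + C' l) => [|l sl].
  split=> [a l|l]; first by rewrite iC iC'.
  by case: (bC l) (bC' l) => [->|->] [->|->]; rewrite ?add0r ?addr0 ?F2; [left|right|right|left].
by rewrite bndD CP ?CP'.
Qed.

Lemma cob2_ext n f g : (forall l, size l = n.+1 -> f l = g l) -> cob2 n f -> cob2 n g.
Proof. by move=> fg [C iC CP]; exists C => // l sl; rewrite -fg ?CP. Qed.

Lemma cob2_cob n f : cob2 n f -> cob n f.
Proof. by case=> C [iC _] CP; exists C. Qed.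

Lemma scup_trc p c c' f g l : scup p (trc c f) (trc c' g) l = trc c' (scup p (trc c f) g) l.
Proof. by rewrite /scup /trc trM // mulrCA. Qed.

Variables (Y W g ee : seq E -> F).
Hypothesis cY : cocyc 4 Y.
Hypothesis cW : cocyc 6 W.
Hypothesis cg : cocyc 10 g.
Hypothesis ee_neq0 : ~ cob 14 ee.
Hypothesis theta_g : forall k, (k < 4)%N ->
  cob 14 (fun z => xs [:: k; k; k; (k.+1 %% 4)%N] g z + if odd k then 0 else ee z).
Hypothesis xYW : cob 14 (fun z => xs [:: 0; 1; 0; 0]%N (scup 4 Y W) z + ee z).
Hypothesis xx_one : forall k, (0 < k < 4)%N -> cob 4 (xs [:: 0; 1; k; k]%N (fun _ => 1)).

Definition th0 := xs [:: 0; 0; 0; 1]%N (fun _ => 1).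
Definition ph0 := xs [:: 0; 0]%N Y.
Definition ps0 := xs [:: 0; 1]%N W.

Lemma theta_g_sum a : a + a ^+ 4 = 1 ->
  cob 14 (fun l => scup 4 (trc a th0) g l + ee l).
Proof.
move=> aE.
have A0 : cob 14 (fun z => a * (xs [:: 0; 0; 0; 1]%N g z + ee z)) := cobZ a (theta_g (k := 0) isT).
have A1 : cob 14 (fun z => a ^+ 2 * (xs [:: 1; 1; 1; 2]%N g z + 0)) := cobZ _ (theta_g (k := 1) isT).
have A2 : cob 14 (fun z => a ^+ 4 * (xs [:: 2; 2; 2; 3]%N g z + ee z)) := cobZ _ (theta_g (k := 2) isT).
have A3 : cob 14 (fun z => a ^+ 8 * (xs [:: 3; 3; 3; 0]%N g z + 0)) := cobZ _ (theta_g (k := 3) isT).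
apply: cob_ext (cobD (cobD A0 A1) (cobD A2 A3)) => l _.
have sc t : scup (size t + 0) (xs t (fun _ => 1)) g l = xs t g l.
  rewrite scup_xs; apply: xs_eq => z; by rewrite /scup mul1r drop0.
have sq t z : all (fun i => i < 4)%N t ->
    xs t (fun _ => 1) z ^+ 2 = xs (map nx t) (fun _ => 1) z.
  by move=> t4; apply: xs_sqr => // _; rewrite expr1n.
have -> : scup 4 (trc a th0) g l = a * xs [:: 0; 0; 0; 1]%N g l + a ^+ 2 * xs [:: 1; 1; 1; 2]%N g l +
    a ^+ 4 * xs [:: 2; 2; 2; 3]%N g l + a ^+ 8 * xs [:: 3; 3; 3; 0]%N g l.
  have sq1 z : xs [:: 0; 0; 0; 1]%N (fun _ => 1) z ^+ 2 = xs [:: 1; 1; 1; 2]%N (fun _ => 1) z by exact: sq.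
  have sq2 z : xs [:: 1; 1; 1; 2]%N (fun _ => 1) z ^+ 2 = xs [:: 2; 2; 2; 3]%N (fun _ => 1) z by exact: sq.
  have sq3 z : xs [:: 2; 2; 2; 3]%N (fun _ => 1) z ^+ 2 = xs [:: 3; 3; 3; 0]%N (fun _ => 1) z by exact: sq.
  have sc4 t : size t = 4 -> xs t g l = xs t (fun _ => 1) (take 5 l) * g (drop 4 l).
    by move=> t4; rewrite -sc addn0 t4.
  rewrite !sc4 // -sq3 -sq2 -sq1 /scup /trc /tr /th0; ring.
rewrite -[X in _ = _ + X](mul1r (ee l)) -aE; ring.
Qed.

Lemma cob2_theta_eta a c : a + a ^+ 4 = 1 ->
  cob2 14 (fun l => scup 4 (trc a th0) (trc c g) l + trc c ee l).
Proof.
move=> aE; apply: cob2_ext (cob_trc c (theta_g_sum aE)) => l _.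
by rewrite scup_trc /trc phiD.
Qed.

Lemma cob_xs_one t U : cocyc 10 U -> cob 4 (xs t (fun _ => 1)) -> size t = 4 -> cob 14 (xs t U).
Proof.
move=> cU ct st; apply: cob_ext (cob_scupr (p := 3) F2 ct cU) => l _.
have := scup_xs 0 t (fun _ => 1) U l; rewrite addn0 st => ->.
by apply: xs_eq => z; rewrite /scup mul1r drop0.
Qed.

Lemma phi_W : 
  cob 14 (fun l => xs [:: 0; 1]%N (scup 6 (trc 1 ph0) W) l + ee l).
Proof.
pose Y1 l := Y l ^+ 2; pose Y2 l := Y1 l ^+ 2; pose Y3 l := Y2 l ^+ 2.
have [c1 c2 c3] : [/\ cocyc 4 Y1, cocyc 4 Y2 & cocyc 4 Y3].
  by have c1 := cocyc_sqr cY; have c2 := cocyc_sqr c1; split=> //; apply: cocyc_sqr c2.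
have B k U : cocyc 4 U -> (0 < k < 4)%N -> cob 14 (xs [:: 0; 1; k; k]%N (scup 4 U W)).
  by move=> cU /xx_one k4; apply: cob_xs_one => //; apply: (cocyc_scup F2 cU cW).
apply: cob_ext (cobD xYW (cobD (B 1 _ c1 isT) (cobD (B 2 _ c2 isT) (B 3 _ c3 isT)))) => l _.
have sq k U V z : (k < 4)%N -> (forall z, U z ^+ 2 = V z) -> xs [:: k; k] U z ^+ 2 = xs [:: nx k; nx k] V z.
  by move=> k4 UV; apply: xs_sqr => //=; rewrite k4.
have -> : xs [:: 0; 1]%N (scup 6 (trc 1 ph0) W) l = xs [:: 0; 1]%N (fun z =>
    xs [:: 0; 0]%N (scup 4 Y W) z + xs [:: 1; 1]%N (scup 4 Y1 W) z +
    xs [:: 2; 2]%N (scup 4 Y2 W) z + xs [:: 3; 3]%N (scup 4 Y3 W) z) l.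
  apply: xs_eq => z; rewrite -!scup_xs /scup /trc /tr mul1r /ph0.
  by rewrite (sq 0 _ Y1) // (sq 1 _ Y2) // (sq 2 _ Y3) // !mulrDl.
rewrite !(xsD al F2); ring.
Qed.

(** x_0 and then x_1 are moved in front of phi, after which [phi_W] applies. *)
Lemma cob_phi_ps0 : cob 14 (fun l => scup 6 (trc 1 ph0) ps0 l + ee l).
Proof.
have cph : cocyc 6 (trc 1 ph0) by apply: cocyc_trc; apply: (cocyc_xs [:: 0; 0]%N cY).
apply: (cob_trans F2) phi_W.
have H1 := xcup_comm F2 (xkM 0) cph (cocyc_xs [:: 1]%N cW).
have H2 := cob_xcup F2 (xkM 0) (xcup_comm F2 (xkM 1) cph cW).
apply: cob_ext (cobD H1 H2) => l _.
have mid (x y z : F) : x + y + (y + z) = x + z by rewrite addrA -(addrA x) F2 addr0.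
by rewrite xcupD //; apply: mid.
Qed.

Lemma cob2_phi_psi c : cob2 14 (fun l => scup 6 (trc 1 ph0) (trc c ps0) l + trc c ee l).
Proof.
apply: cob2_ext (cob_trc c cob_phi_ps0) => l _.
by rewrite scup_trc /trc phiD.
Qed.

Lemma cob_sum (J : Type) (r : seq J) n (f : J -> seq E -> F) :
  (forall j, cob n (f j)) -> cob n (fun l => \sum_(j <- r) f j l).
Proof.
move=> fc; elim: r => [|j r IHr].
  by apply: cob_ext (cob0 F E n) => l _; rewrite big_nil.
by apply: cob_ext (cobD (fc j) IHr) => l _; rewrite big_cons.
Qed.

Lemma trc_ee_neq0 : exists c, ~ cob 14 (trc c ee).
Proof.
apply: NNPP => all0; apply: ee_neq0.
have cc c : cob 14 (trc c ee) by apply: NNPP => nc; apply: all0; exists c.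
apply: cob_ext (cob_sum (index_enum F) (fun c => cobZ (c ^+ 14) (cc c))) => l _.
exact: tr_inversion.
Qed.

(** On lists with entries in H the product with [xl lam] is zero already as a cochain, so the
    cochain that bounds the difference bounds f there. *)
Lemma trc_essential n f c (H : pred E) lam : ess al n f -> lam != 0 -> {in H, forall h, xl lam h = 0} ->
  exists2 C : seq E -> F, invariant C /\ binary C &
    forall l, size l = n.+1 -> all H l -> trc c f l = bnd C l.
Proof.
move=> ef lam0 H0; have [k [C iC CP]] := ef lam (exp15 cardF lam0).
exists (trc c C) => [|l sl lH].
  by split=> [g' l|l]; [rewrite /trc iC | apply: tr01].
transitivity (tr (c * bnd C l)); last exact: (bnd_morph (phi := fun x => tr (c * x)) _ _ (phi0 c) (phiD c)).
rewrite -CP //; congr (tr (c * _)); case: l lH {sl} => [|a [|b l]] /=; rewrite ?addr0 //.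
by move=> /and3P[aH bH _]; rewrite !H0 // addr0 mul0r addr0.
Qed.

Lemma trc_ph0 a l : a + a ^+ 4 = 1 -> trc a (fun z => ph0 z + ph0 z ^+ 4) l = trc 1 ph0 l.
Proof.
move=> aE; rewrite /trc mul1r -[in RHS](mul1r (ph0 l)) -aE mulrDr mulrDl !trD //; congr (_ + _).
rewrite -[RHS](tr_sqr cardF) -[RHS](tr_sqr cardF) -exprM exprMn -[in LHS](exp16 cardF a); congr tr; ring.
Qed.

(** At a group element with a = 1 the relation reads b^4 = b + 1. *)
Lemma exists_trace_one : exists a : F, a + a ^+ 4 = 1.
Proof.
by have [h h1] := alT 1; exists (be h); rewrite be4 h1 expr1n addrA F2 add0r.
Qed.
End Assembly.

(** * Passage to inhomogeneous cochains over F_2 *)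

Section Inhomogeneous.
Variables (gT : finGroupType) (G : {group gT}) (F : fieldType).
Hypothesis F2 : forall x : F, x + x = 0.
Local Notation E := (subg_of G).

(** Additive only on the values 0 and 1, hence the hypotheses [bin] below. *)
Definition bit (x : F) : 'F_2 := (x != 0)%:R.

Lemma F_2D (x : 'F_2) : x + x = 0. Proof. by case: x => -[|[|]] //= i; apply: val_inj. Qed.

Lemma bitD x y : x = 0 \/ x = 1 -> y = 0 \/ y = 1 -> bit (x + y) = bit x + bit y.
Proof.
rewrite /bit; case=> ->; case=> ->; rewrite ?add0r ?addr0 ?eqxx ?oner_eq0 /= ?add0r ?addr0 //.
by rewrite F2 eqxx F_2D.
Qed.

Lemma bitM x y : bit (x * y) = bit x * bit y.
Proof. by rewrite /bit mulf_eq0 negb_or; case: (x != 0); case: (y != 0); rewrite ?mulr0 ?mul0r ?mulr1. Qed.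

Lemma bit_inj x y : x = 0 \/ x = 1 -> y = 0 \/ y = 1 -> bit x = bit y -> x = y.
Proof. by rewrite /bit; case=> ->; case=> ->; rewrite ?eqxx ?oner_eq0. Qed.

Definition bin (T : Type) (f : T -> F) := forall l, f l = 0 \/ f l = 1.

Lemma bin_bnd (f : seq E -> F) : bin f -> bin (bnd f).
Proof.
move=> bf l; elim: l f bf => [|a l IHl] f bf /=; first by left.
have [] := IHl (fun z => f (a :: z)) (fun z => bf _); case: (bf l) => -> ->;
  rewrite ?add0r ?addr0 ?F2; by [left | right].
Qed.

Lemma bit_bnd (f : seq E -> F) l : bin f -> bit (bnd f l) = bnd (fun z => bit (f z)) l.
Proof.
elim: l f => [|a l IHl] f bf /=; first by rewrite /bit eqxx.
by rewrite bitD ?IHl //; apply: (bin_bnd (fun z => bf (a :: z))).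
Qed.

(** The successive products g, g x_1, g x_1 x_2 and so on, which turn an inhomogeneous argument into
    a homogeneous one; [steps] takes the quotients back. *)
Fixpoint walk (g : E) (s : seq gT) : seq E :=
  g :: (if s is x :: s' then walk (g * subg G x)%g s' else [::]).

Fixpoint steps (l : seq E) : seq gT :=
  if l is a :: ((b :: _) as l') then sgval (a^-1 * b)%g :: steps l' else [::].

Lemma size_walk g s : size (walk g s) = (size s).+1.
Proof. by elim: s g => //= x s IHs g; rewrite IHs. Qed.

Lemma walk_mul h g s : walk (h * g)%g s = map (mulg h) (walk g s).
Proof. by elim: s g => //= x s IHs g; rewrite -IHs mulgA. Qed.

Lemma steps_cons a b l : steps (a :: b :: l) = sgval (a^-1 * b)%g :: steps (b :: l).
Proof. by []. Qed.

Lemma walk_steps a l : walk a (steps (a :: l)) = a :: l.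
Proof.
elim: l a => // b l IHl a; rewrite steps_cons -{2}(IHl b).
by rewrite -[LHS]/(a :: walk (a * subg G (sgval (a^-1 * b)%g)) (steps (b :: l)))%g sgvalK mulKVg.
Qed.

Lemma walk_cons g x s : walk g (x :: s) = g :: walk (g * subg G x)%g s.
Proof. by []. Qed.

Lemma steps_walk g s : all (mem G) s -> steps (walk g s) = s.
Proof.
elim: s g => // x s IHs g /andP[xG sG]; rewrite walk_cons -{2}(IHs (g * subg G x)%g sG).
have -> : steps (g :: walk (g * subg G x)%g s) =
    sgval (g^-1 * (g * subg G x))%g :: steps (walk (g * subg G x)%g s) by case: (s).
by rewrite mulKg subgK.
Qed.

Lemma steps_in l : all (mem G) (steps l).
Proof. by elim: l => // a [|b l] // IHl; apply/andP; split; [exact: subgP | exact: IHl]. Qed.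

Lemma steps_mulg h l : steps (map (mulg h) l) = steps l.
Proof.
elim: l => // a [|b l] // IHl.
by rewrite 2!map_cons !steps_cons -map_cons IHl invMg -mulgA mulKg.
Qed.

Lemma size_steps l : size (steps l) = (size l).-1.
Proof. by elim: l => // a [|b l] // IHl; rewrite steps_cons [size _]/=; exact: congr1 IHl. Qed.

Lemma take_walk n g s : take n.+1 (walk g s) = walk g (take n s).
Proof. by elim: s n g => [|x s IHs] [|n] g //=; rewrite ?take0 -?IHs. Qed.

Lemma drop_walk n g s : (n <= size s)%N -> exists h, drop n (walk g s) = walk h (drop n s).
Proof.
elim: s n g => [|x s IHs] [|n] g //=; try by exists g.
by move=> /IHs; apply.
Qed.

Lemma walk_all (H : {set gT}) g s : H \subset G -> group_set H -> sgval g \in H -> all (mem H) s ->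
  all (fun e => sgval e \in H) (walk g s).
Proof.
move=> HG /group_setP[_ HM]; elim: s g => [|x s IHs] g /= gH; first by rewrite gH.
move=> /andP[xH sH]; rewrite gH IHs //=.
by rewrite subgK ?HM // (subsetP HG).
Qed.

(** Omitting the first point of a walk moves its start, omitting an inner point multiplies two
    neighbouring steps, omitting the last point truncates: these are the terms of [dcob]. *)
Lemma bnd_walk (f : seq E -> 'F_2) n g s : all (mem G) s -> size s = n.+1 ->
  bnd f (walk g s) = f (walk (g * subg G (head 1%g s))%g (behead s)) +
   \sum_(i < n) f (walk g (take i s ++ (nth 1%g s i * nth 1%g s i.+1)%g :: drop i.+2 s)) +
   f (walk g (take n s)).
Proof.
elim: n f g s => [|n IHn] f g [|x s] //= /andP[xG sG] [sz].
  by case: s sz sG => // _ _; rewrite /= big_ord0 !addr0.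
rewrite (IHn _ _ s) // big_ord_recl -!addrA; congr (_ + (_ + _)).
case: s sz sG => // y s sz /andP[yG sG] /=; rewrite drop0; congr (f (_ :: walk _ _)).
by rewrite -mulgA subgM.
Qed.

Lemma sign_F2 k : (-1) ^+ k = 1 :> 'F_2.
Proof. by have -> : -1 = 1 :> 'F_2; [apply: val_inj | apply: expr1n]. Qed.

Lemma dcob_walk n (C : seq E -> F) s : invariant C -> bin C -> all (mem G) s -> size s = n.+1 ->
  dcob n (fun s => bit (C (walk 1 s))) s = bit (bnd C (walk 1 s)).
Proof.
move=> iC bC sG sz; rewrite bit_bnd // (bnd_walk _ _ sG sz) /dcob sign_F2 mul1r.
congr (_ + _ + _).
  by rewrite mul1g -[subg G _]mulg1 walk_mul iC.
by apply: eq_bigr => i _; rewrite sign_F2 mul1r.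
Qed.

Lemma dcob_ext n (c c' : cochain gT 'F_2) s : all (mem G) s -> size s = n.+1 ->
  (forall t, all (mem G) t -> c t = c' t) -> dcob n c s = dcob n c' s.
Proof.
move=> sG sz cc; rewrite /dcob.
have tG k : all (mem G) (take k s) by apply/allP => x /mem_take /(allP sG).
have dG k : all (mem G) (drop k s) by apply/allP => x /mem_drop /(allP sG).
congr (_ + _ + _ * _); first by rewrite -drop1 cc.
  apply: eq_bigr => i _; rewrite cc // all_cat tG /= dG andbT.
  by rewrite groupM //; apply: (allP sG); apply: mem_nth; rewrite sz ltnS ?ltn_ord // ltnW.
exact: cc.
Qed.

Definition inhom (f : seq E -> F) : cochain gT 'F_2 := fun s => bit (f (walk 1 s)).

Lemma cocycle_inhom n f : bin f -> cocyc n f -> cocycle G n (inhom f).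
Proof.
move=> bf [iF cf] s /andP[/eqP sz sG]; rewrite dcob_walk // cf ?size_walk ?sz //.
by rewrite /bit eqxx.
Qed.

Lemma coboundary_inhom (H : {group gT}) n (f C : seq E -> F) : H \subset G ->
  invariant C -> bin C ->
  (forall l, size l = n.+2 -> all (fun e => sgval e \in H) l -> f l = bnd C l) ->
  coboundary H n.+1 (inhom f).
Proof.
move=> HG iC bC fC; exists (inhom C) => s /andP[/eqP sz sH].
have sG : all (mem G) s by apply/allP => x /(allP sH); apply: (subsetP HG).
rewrite dcob_walk // -fC ?size_walk ?sz //.
by apply: walk_all; rewrite ?groupP ?group1.
Qed.

Lemma cup_inhom p f g s : invariant g -> (p <= size s)%N ->
  cup p (inhom f) (inhom g) s = inhom (scup p f g) s.
Proof.
move=> iG ps; rewrite /cup /inhom /scup bitM take_walk; congr (_ * bit _).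
have [h ->] := drop_walk 1 ps.
by rewrite -[h]mulg1 walk_mul iG.
Qed.

(** The direction that transports nonvanishing: a bounding cochain over F_2 is lifted to the values
    0 and 1 of [F] and read on the steps of a list. *)
Lemma coboundary_cob n f : bin f -> invariant f -> coboundary G n.+1 (inhom f) -> cob n.+1 f.
Proof.
move=> bf iF [c cP]; pose C l : F := (c (steps l) != 0)%:R.
have iC : invariant C by move=> g l; rewrite /C steps_mulg.
have bC : bin C by move=> l; rewrite /C; case: (_ != 0); [right | left].
exists C => // -[|a l] // [sl].
have wE : a :: l = map (mulg a) (walk 1 (steps (a :: l))) by rewrite -walk_mul mulg1 walk_steps.
have sG := steps_in (a :: l); have sz : size (steps (a :: l)) = n.+1 by rewrite size_steps.
rewrite wE iF (bnd_invariant iC); move: (steps _) sG sz => s sG sz {wE}.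
apply: bit_inj => //; first exact: bin_bnd.
have /cP : tuple_in G n.+1 s by rewrite /tuple_in sz eqxx.
rewrite -(dcob_walk iC bC sG sz) => sE; apply: etrans sE _; apply: dcob_ext => // t tG.
by rewrite /C steps_walk // /bit; case: (c t) => -[|[|]] // i; apply: val_inj; rewrite /= ?eqxx ?oner_eq0.
Qed.
End Inhomogeneous.

(** * Linear relations on proper subgroups *)

Section Proper.
Variable F : finFieldType.
Hypothesis cardF : #|F| = 16%N.
Variables (E : finGroupType) (al be : E -> F).
Hypothesis alM : forall g h, al (g * h)%g = al g + al h.
Hypothesis beM : forall g h, be (g * h)%g = be g + be h + al g ^+ 4 * al h.
Hypothesis be4 : forall g, be g ^+ 4 = be g + al g ^+ 5.
Hypothesis inj : forall g h, al g = al h -> be g = be h -> g = h.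
Let F2 := addrr_F16 cardF.

(** A fibre of a embeds by b into the roots of a polynomial of degree 4, so 64 elements need all 16
    values. *)
Lemma surjective_al : #|E| = 64%N -> forall a, exists h, al h = a.
Proof.
move=> cE; pose V := al @: [set: E].
have fiber a : (#|[set h | al h == a]| <= 4)%N.
  pose p : {poly F} := 'X^4 - ('X + (a ^+ 5)%:P).
  have sp : size p = 5%N by rewrite /p size_polyDl ?size_polyXn // size_polyN size_XaddC.
  have bi : {in [set h | al h == a] &, injective be}.
    by move=> x y; rewrite !inE => /eqP xa /eqP ya; apply: inj; rewrite xa.
  rewrite -(card_in_imset bi) cardE -ltnS -sp; apply: max_poly_roots; rewrite ?enum_uniq -?size_poly_eq0 ?sp //.
  apply/allP => x; rewrite mem_enum => /imsetP[h]; rewrite inE => /eqP ha ->.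
  by rewrite rootE /p !hornerE be4 ha subrr.
have cV : (64 <= \sum_(a in V) 4)%N.
  rewrite -cE -cardsT -sum1_card (partition_big al (mem V)) => [|h _]; last by apply: imset_f; rewrite inE.
  apply: leq_sum => a _; rewrite sum1_card; apply: leq_trans (fiber a).
  by apply: subset_leq_card; apply/subsetP => h ha; rewrite inE; case/andP: ha.
have VT : V = setT.
  apply/eqP; rewrite eqEcard subsetT cardsT cardF.
  by move: cV; rewrite sum_nat_const -[64%N]/(16 * 4)%N leq_pmul2r.
by move=> a; have : a \in V by [rewrite VT inE]; case/imsetP => h _ ->; exists h.
Qed.

Let al1 : al 1%g = 0.
Proof. by apply: (addrI (al 1%g)); rewrite -alM mulg1 addr0. Qed.
Let alV h : al h^-1%g = al h.
Proof. by apply: (addrI (al h)); rewrite -alM mulgV al1 F2. Qed.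

(* Squaring maps [E] onto its centre, so [al] cannot be onto on a proper subgroup. *)
Lemma al_proper (H : {group E}) : H \proper [set: E] -> al @: H != setT.
Proof.
move=> /properP[_ [x _ xH]]; apply: contra xH => /eqP HT.
have HP a : exists2 h, h \in H & al h = a.
  by have : a \in al @: H by [rewrite HT inE]; case/imsetP => h hH ->; exists h.
have Z z : al z = 0 -> z \in H.
  move=> z0; have w4 : be z ^+ 4 = be z by rewrite be4 z0 expr0n addr0.
  (* The square of h has second coordinate a(h)^5 = b(z)^10, and this is b(z) because b(z)^4 =
     b(z). *)
  have [h hH ha] := HP (be z ^+ 2).
  suff -> : z = (h * h)%g by rewrite groupM.
  apply: inj; first by rewrite alM z0 F2.
  rewrite beM F2 add0r -exprSr ha -exprM.
  by rewrite (exprD _ 4 6) (exprD _ 4 2) w4 -exprS -exprS w4.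
have [h hH ha] := HP (al x).
by rewrite -(mulKVg h x) groupM // Z // alM alV ha F2.
Qed.

Let chi (x : F) : int := if x == 0 then 1 else -1.

Let chiD x y : chi (tr (x + y)) = chi (tr x) * chi (tr y).
Proof.
rewrite trD //; have [->|->] := tr01 cardF x; have [->|->] := tr01 cardF y;
by rewrite /chi ?addr0 ?add0r ?F2 ?eqxx ?oner_eq0.
Qed.

(** Translation by v0 permutes V and reverses the sign of the sum. *)
Let chi_sum (V : {set F}) (lam v0 : F) : (forall v, (v0 + v \in V) = (v \in V)) -> tr (lam * v0) != 0 ->
  \sum_(v in V) chi (tr (lam * v)) = 0.
Proof.
move=> V0 l0; set S := \sum_(v in V) _.
have SN : S = - S.
  rewrite {1}/S (reindex_inj (addrI v0)) (eq_bigl (mem V)) //.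
  rewrite -mulN1r big_distrr; apply: eq_bigr => v _ /=.
  by rewrite mulrDr chiD {1}/chi (negbTE l0).
by move: SN; lia.
Qed.

Lemma tr_onto (v : F) : v != 0 -> exists lam, tr (lam * v) != 0.
Proof.
move=> v0; apply/existsP; rewrite -negb_forall; apply/negP => /forallP t0.
have := tr_inversion cardF 1; rewrite big1 => [/esym/eqP|a _]; first by rewrite oner_eq0.
by have /eqP := t0 (a / v); rewrite divfK // mulr1 => ->; rewrite mulr0.
Qed.

(** The image V of H is a proper additive subgroup of the field. If no nonzero lam annihilated it,
    the character sum over all lam in F and v in V would equal the order of V when summed first over
    V, and 16 when summed first over lam. *)
Lemma annihilator (H : {group E}) : H \proper [set: E] ->
  exists2 lam, lam != 0 & {in H, forall h, xl al lam h = 0}.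
Proof.
move=> /al_proper VT; set V := al @: H in VT.
have VD v0 v : v0 \in V -> (v0 + v \in V) = (v \in V).
  move=> /imsetP[h hH ->]; apply/imsetP/imsetP => -[k kH kE].
    by exists (h^-1 * k)%g; rewrite ?groupM ?groupV // alM alV -kE addrA F2 add0r.
  by exists (h * k)%g; rewrite ?groupM // alM kE.
suff [lam l0 lV] : exists2 lam, lam != 0 & {in V, forall v, tr (lam * v) = 0}.
  exists lam => // h hH; rewrite -(lV (al h)) ?imset_f //.
  by rewrite /Free.xl /tr !big_cons big_nil addr0 -!exprM !addrA.
apply: NNPP => nope.
have some lam : lam != 0 -> exists2 v0, v0 \in V & tr (lam * v0) != 0.
  move=> l0; case: (boolP [exists v in V, tr (lam * v) != 0]) => [/exists_inP //|].
  rewrite negb_exists_in => /forall_inP lV; case: nope; exists lam => // v /lV.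
  by rewrite negbK => /eqP.
have V0 : 0 \in V by rewrite -al1 imset_f.
have chi1 : chi (tr 0) = 1 by rewrite tr0 // /chi eqxx.
have S1 : \sum_(lam : F) \sum_(v in V) chi (tr (lam * v)) = #|V|%:R.
  rewrite (bigD1 0) //= [X in _ + X]big1 => [|lam /some[v0 v0V l0]]; last first.
    by apply: chi_sum l0 => v; apply: VD.
  rewrite addr0 (eq_bigr (fun _ => 1)) => [|v _]; last by rewrite mul0r chi1.
  by rewrite sumr_const.
have S2 : \sum_(lam : F) \sum_(v in V) chi (tr (lam * v)) = 16%:R.
  rewrite exchange_big (bigD1 0) //= [X in _ + X]big1 => [|v /andP[_ /tr_onto[lam l0]]]; last first.
    rewrite -[RHS](@chi_sum setT v lam) => [||]; rewrite ?[v * _]mulrC //.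
      by apply: eq_big => [a|a _]; rewrite ?inE // mulrC.
    by move=> a; rewrite !inE.
  rewrite addr0 (eq_bigr (fun _ => 1)) => [|a _]; last by rewrite mulr0 chi1.
  by rewrite sumr_const cardF.
case/negP: VT; rewrite eqEcard subsetT cardsT cardF.
by move: S1; rewrite S2 => /eqP; rewrite eqr_nat => /eqP <-.
Qed.
End Proper.

(** * Essential products from coordinates on the group *)

Section Coordinates.
Variables (gT : finGroupType) (G : {group gT}) (F : finFieldType).
Hypothesis cardF : #|F| = 16%N.
Variables al be : gT -> F.
Hypothesis alM : {in G &, forall g h, al (g * h)%g = al g + al h}.
Hypothesis beM : {in G &, forall g h, be (g * h)%g = be g + be h + al g ^+ 4 * al h}.
Hypothesis be4 : {in G, forall g, be g ^+ 4 = be g + al g ^+ 5}.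
Hypothesis inj : {in G &, forall g h, al g = al h -> be g = be h -> g = h}.
Hypothesis cardG : #|G| = 64%N.

Lemma essential_products :
  exists (theta eta phi psi : cochain gT 'F_2),
    [/\ essential G 4 theta, essential G 10 eta,
        essential G 6 phi & essential G 8 psi] /\
    ~ coboundary G 14 (Defs.cup 4 theta eta) /\
    coboundary G 14 (fun s => Defs.cup 6 phi psi s - Defs.cup 4 theta eta s).
Proof.
pose E := subg_of G; pose a (e : E) := al (sgval e); pose b (e : E) := be (sgval e).
have F2 := addrr_F16 cardF.
have aM g h : a (g * h)%g = a g + a h by apply: alM; apply: subgP.
have bM g h : b (g * h)%g = b g + b h + a g ^+ 4 * a h by apply: beM; apply: subgP.
have b4 g : b g ^+ 4 = b g + a g ^+ 5 by apply: be4; apply: subgP.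
have abI g h : a g = a h -> b g = b h -> g = h.
  by move=> ag bg; apply: val_inj; apply: inj ag bg; apply: subgP.
have cE : #|E| = 64%N by rewrite -cardG -[RHS](card_injm (injm_subg G)) // im_subg cardsT.
have aT := surjective_al cardF b4 abI cE.
have a16 g : a g ^+ 16 = a g by apply: exp16.
have [mu [mu1 mu2 mu3]] := dual_basis a16 b4 abI cE.
have [Y [W [g [ee [[cY cW cg ee0] [[thg xYW xx1] [e4 e10 e6 e8]]]]]]] := classes F2 aM bM a16 b4 mu1 mu2 mu3.
have [a0 a0E] := exists_trace_one cardF b4 aT.
have [c cN] := trc_ee_neq0 cardF ee0.
pose th := trc a0 (th0 a); pose et := trc c g.
pose ph := trc 1 (ph0 a Y); pose ps := trc c (ps0 a W).
have bt x f : bin (trc x f : seq E -> F) by move=> l; apply: tr01.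
have [[bth bet] [bph bps]] : (bin th /\ bin et) /\ (bin ph /\ bin ps) by split; split; apply: bt.
have binS p (f f' : seq E -> F) : bin f -> bin f' -> bin (scup p f f').
  move=> bf bf' l; rewrite /scup; case: (bf (take p.+1 l)) => ->; rewrite ?mul0r ?mul1r; last exact: bf'.
  by left.
have cocyc_th : cocyc 4 th by apply: cocyc_trc => //; apply: (cocyc_xs cardF aM [:: 0; 0; 0; 1]%N (cocyc_one cardF E)).
have cocyc_et : cocyc 10 et by apply: cocyc_trc.
have cocyc_ph : cocyc 6 ph by apply: cocyc_trc => //; apply: (cocyc_xs cardF aM [:: 0; 0]%N cY).
have cocyc_ps : cocyc 8 ps by apply: cocyc_trc => //; apply: (cocyc_xs cardF aM [:: 0; 1]%N cW).
have essP n x f f' : (forall l, trc x f l = f' l) -> cocyc n.+1 f' -> bin f' -> ess a n.+1 f ->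
    essential G n.+1 (inhom f').
  move=> ff' cf bf ef; split=> [|H HG]; first exact: cocycle_inhom.
  pose H' := (@sgval gT G @*^-1 H)%G.
  have H'P (e : E) : (e \in H') = (sgval e \in H) by rewrite !inE.
  have H'T : H' \proper [set: E].
    have /properP[_ [y yG yH]] := HG; apply/properP; split; first exact: subsetT.
    by exists (subg G y); rewrite ?H'P ?subgK //; apply: in_setT.
  have [lam l0 lH] := annihilator cardF aM bM b4 abI H'T.
  have [C [iC bC] CP] := trc_essential cardF x ef l0 lH.
  apply: (coboundary_inhom F2 (proper_sub HG) iC bC) => l sl lH'.
  by rewrite -ff' CP //; apply: sub_all lH' => e; rewrite -H'P.
exists (inhom th), (inhom et), (inhom ph), (inhom ps); split; last split.
- split.
  + exact: (essP 3 a0 (th0 a) th (fun _ => erefl) cocyc_th (bt _ _) e4).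
  + exact: (essP 9 c g et (fun _ => erefl) cocyc_et (bt _ _) e10).
  + exact: (essP 5 a0 _ ph (fun l => trc_ph0 cardF a Y l a0E) cocyc_ph (bt _ _) e6).
  + exact: (essP 7 c (ps0 a W) ps (fun _ => erefl) cocyc_ps (bt _ _) e8).
- move=> cN'; apply: cN.
  have iet : invariant et by case: cocyc_et.
  have ith : invariant th by case: cocyc_th.
  have bte := binS 4 _ _ bth bet.
  have cte : coboundary G 14 (inhom (scup 4 th et)).
    have [c0 c0P] := cN'; exists c0 => s sG; rewrite -c0P //.
    by rewrite cup_inhom //; case/andP: sG => /eqP ->.
  have te := cob2_cob (cob2_theta_eta cardF thg c a0E).
  apply: (@cob_eq F E F2 14 (scup 4 th et) (trc c ee) te).
  exact: (coboundary_cob F2 bte (scup_invariant 4 ith iet) cte).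
have mid (x y z : F) : x + z + (y + z) = x + y by rewrite addrACA F2 addr0.
(* Both products differ from [trc c ee] by coboundaries over F_2; adding the two relations cancels
   it. *)
have := cob2D cardF (cob2_phi_psi cardF aM cY cW xYW xx1 c) (cob2_theta_eta cardF thg c a0E).
move=> [C [iC bC] CP].
have oppE (x : 'F_2) : - x = x by apply/esym/eqP; rewrite -addr_eq0 F_2D.
have [|C0 C0P] := coboundary_inhom F2 (H := G) (subxx G) iC bC (n := 13) (f := bnd C).
  by [].
exists C0 => s sG; rewrite -C0P //; have /andP[/eqP sz _] := sG.
have [iet ips] : invariant et /\ invariant ps by case: cocyc_et; case: cocyc_ps.
rewrite !cup_inhom ?sz // /inhom -CP ?size_walk ?sz // mid oppE bitD //; exact: binS.
Qed.
End Coordinates.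

(** * Sylow 2-subgroups of SU_3(4) *)

Definition o0 : 'I_3 := @Ordinal 3 0 isT.
Definition o1 : 'I_3 := @Ordinal 3 1 isT.
Definition o2 : 'I_3 := @Ordinal 3 2 isT.

Lemma ord3_ind (P : 'I_3 -> Prop) : P o0 -> P o1 -> P o2 -> forall i, P i.
Proof.
move=> P0 P1 P2 [[|[|[|//]]] i3].
- by rewrite (_ : Ordinal i3 = o0) //; apply: val_inj.
- by rewrite (_ : Ordinal i3 = o1) //; apply: val_inj.
by rewrite (_ : Ordinal i3 = o2) //; apply: val_inj.
Qed.

Lemma sum3 (V : zmodType) (f : 'I_3 -> V) : \sum_i f i = f o0 + f o1 + f o2.
Proof.
rewrite !big_ord_recl big_ord0 addr0 addrA.
by congr (f _ + f _ + f _); apply: val_inj.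
Qed.

Lemma prod3 (R : comNzRingType) (f : 'I_3 -> R) : \prod_i f i = f o0 * f o1 * f o2.
Proof.
rewrite !big_ord_recl big_ord0 mulr1 mulrA.
by congr (f _ * f _ * f _); apply: val_inj.
Qed.

Section Unitary.
Variable F : finFieldType.
Hypothesis cardF : #|F| = 16%N.
Let F2 := addrr_F16 cardF.

Definition mx3 (a b c d e f g h i : F) : 'M[F]_3 :=
  \matrix_(r, s) nth 0 (nth [::] [:: [:: a; b; c]; [:: d; e; f]; [:: g; h; i]] r) s.

Lemma mx3_eta (A : 'M[F]_3) :
  A = mx3 (A o0 o0) (A o0 o1) (A o0 o2) (A o1 o0) (A o1 o1) (A o1 o2) (A o2 o0) (A o2 o1) (A o2 o2).
Proof. by apply/matrixP; do 2! (elim/ord3_ind); rewrite mxE. Qed.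

Lemma conjD (x y : F) : (x + y) ^+ 4 = x ^+ 4 + y ^+ 4.
Proof. by rewrite !(exprM _ 2 2) !sqrD_F16. Qed.

Lemma conjK (x : F) : x ^+ 4 ^+ 4 = x.
Proof. by rewrite -exprM exp16. Qed.

Lemma opp_char2 (x : F) : - x = x.
Proof. by apply/esym/eqP; rewrite -addr_eq0 F2. Qed.

Definition adj m n (A : 'M[F]_(m, n)) : 'M[F]_(n, m) := (map_mx (fun x : F => x ^+ 4) A)^T.

Lemma adjM m n p (A : 'M[F]_(m, n)) (B : 'M[F]_(n, p)) : adj (A *m B) = adj B *m adj A.
Proof.
rewrite /adj -trmx_mul; congr trmx; apply/matrixP => i j; rewrite !mxE.
rewrite (big_morph (fun x => x ^+ 4) conjD (expr0n _ _)).
by apply: eq_bigr => k _; rewrite !mxE exprMn.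
Qed.

Lemma adjK m n (A : 'M[F]_(m, n)) : adj (adj A) = A.
Proof. by apply/matrixP => i j; rewrite !mxE conjK. Qed.

Lemma adj1 n : adj 1%:M = 1%:M :> 'M[F]_n.
Proof.
by apply/matrixP => i j; rewrite !mxE eq_sym; case: (_ == _); rewrite ?expr1n ?expr0n.
Qed.

(** The Hermitian form in a basis whose outer vectors are isotropic; in it the unipotent elements
    become the triangular matrices [tmx]. *)
Definition J : 'M[F]_3 := mx3 0 0 1 0 1 0 1 0 0.
Definition tmx (a b : F) : 'M[F]_3 := mx3 1 0 0 a 1 0 b (a ^+ 4) 1.

Lemma mulJJ : J *m J = 1%:M.
Proof.
by apply/matrixP; do 2! (elim/ord3_ind); rewrite !mxE sum3 !mxE /= ?mulr0 ?mulr1 ?addr0 ?add0r.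
Qed.

Lemma adjJ : adj J = J.
Proof. by apply/matrixP; do 2! (elim/ord3_ind); rewrite !mxE /= ?expr0n ?expr1n. Qed.

Lemma tmxM a b a' b' : tmx a b *m tmx a' b' = tmx (a + a') (b + b' + a ^+ 4 * a').
Proof.
by apply/matrixP; do 2! (elim/ord3_ind); rewrite !mxE sum3 !mxE /= ?conjD; ring.
Qed.

Lemma mulJ_adj (T : 'M[F]_3) i j : (T *m J *m adj T) i j =
  T i o0 * T j o2 ^+ 4 + T i o1 * T j o1 ^+ 4 + T i o2 * T j o0 ^+ 4.
Proof. by rewrite !mxE sum3 !mxE !sum3 !mxE /=; ring. Qed.

Lemma tmx_unitary a b : b ^+ 4 = b + a ^+ 5 -> tmx a b *m J *m adj (tmx a b) = J.
Proof.
move=> b4; apply/matrixP; do 2! (elim/ord3_ind); rewrite mulJ_adj !mxE /= ?conjK ?expr0n ?expr1n ?b4 /=;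
  rewrite ?mul0r ?mulr0 ?mul1r ?mulr1 ?addr0 ?add0r ?F2 //.
by rewrite -exprSr addrACA F2 F2 addr0.
Qed.

Lemma det_tmx a b : \det (tmx a b) = 1.
Proof.
rewrite det_trig; last by apply/is_trig_mxP; do 2! (elim/ord3_ind) => //; rewrite mxE.
by rewrite prod3 !mxE /= !mulr1.
Qed.

(** Pairing with the first row fixes the last column, the determinant fixes the middle diagonal
    entry, pairing the last two rows gives the entry a^4, and the norm of the last row is the
    relation between b and a. *)
Lemma unitary_tmx (T : 'M[F]_3) : T *m J *m adj T = J -> row o0 T = row o0 1%:M -> \det T = 1 ->
  T = tmx (T o1 o0) (T o2 o0) /\ T o2 o0 ^+ 4 = T o2 o0 + T o1 o0 ^+ 5.
Proof.
move=> TJ T0 dT.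
have [r00 r01 r02] : [/\ T o0 o0 = 1, T o0 o1 = 0 & T o0 o2 = 0].
  by move/rowP: T0 => T0; split; [have := T0 o0 | have := T0 o1 | have := T0 o2]; rewrite !mxE.
have entry i j : T i o0 * T j o2 ^+ 4 + T i o1 * T j o1 ^+ 4 + T i o2 * T j o0 ^+ 4 = J i j.
  by rewrite -TJ mulJ_adj.
have r12 : T o1 o2 = 0.
  by have := entry o1 o0; rewrite r00 r01 r02 !mxE /= expr0n expr1n !mulr0 !add0r mulr1.
have r22 : T o2 o2 = 1.
  by have := entry o2 o0; rewrite r00 r01 r02 !mxE /= expr0n expr1n !mulr0 !add0r mulr1.
have r11 : T o1 o1 = 1.
  move: dT; rewrite det_trig.
    by rewrite prod3 r00 r22 mulr1 mul1r.
  by apply/is_trig_mxP; do 2! (elim/ord3_ind).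
have r21 : T o2 o1 = T o1 o0 ^+ 4.
  have := entry o2 o1; rewrite r12 r22 r11 !mxE /= expr0n expr1n mulr0 add0r mulr1 mul1r.
  by move/eqP; rewrite addr_eq0 opp_char2 => /eqP.
split.
  by rewrite {1}(mx3_eta T) r00 r01 r02 r11 r12 r21 r22.
have := entry o2 o2; rewrite r22 r21 !mxE /= expr1n mulr1 mul1r conjK -exprSr.
by move/eqP; rewrite addrC addr_eq0 opp_char2 => /eqP.
Qed.
End Unitary.

(** * Hermitian geometry over the field of 16 elements *)

Section Hermitian.
Variable F : finFieldType.
Hypothesis cardF : #|F| = 16%N.
Let F2 := addrr_F16 cardF.

Lemma card_roots4 (d : F) : (#|[set x : F | (x ^+ 4 == x + d)%R]| <= 4)%N.
Proof.
pose p : {poly F} := 'X^4 - ('X + d%:P).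
have sp : size p = 5%N by rewrite /p size_polyDl ?size_polyXn // size_polyN size_XaddC.
rewrite cardE -ltnS -sp; apply: max_poly_roots; rewrite ?enum_uniq -?size_poly_eq0 ?sp //.
by apply/allP => x; rewrite mem_enum inE rootE /p !hornerE subr_eq0.
Qed.

Lemma trace_F4 (x : F) : (x + x ^+ 4) ^+ 4 = x + x ^+ 4.
Proof. by rewrite conjD // conjK // addrC. Qed.

Lemma trace_one : exists c : F, c + c ^+ 4 = 1.
Proof.
have [x x0] : exists x : F, x + x ^+ 4 != 0.
  apply/existsP; rewrite -negb_forall; apply/negP => /forallP x0.
  have := card_roots4 0; rewrite (_ : [set x | _] = setT) ?cardsT ?cardF //.
  by apply/setP => x; rewrite !inE addr0 eq_sym -subr_eq0 opp_char2 //; exact: x0.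
exists (x / (x + x ^+ 4)).
by rewrite expr_div_n trace_F4 -mulrDl divff.
Qed.

(** The map x + x^4 sends the field into this set with fibres of at most 4 elements, so the set has
    at least 16 / 4 elements; being roots of X^4 - X bounds it from above. *)
Lemma card_F4 : #|[set x : F | x ^+ 4 == x]| = 4%N.
Proof.
set K := [set x | _]; have K4 : (#|K| <= 4)%N.
  by have := card_roots4 0; rewrite (_ : [set x | x ^+ 4 == x + 0] = K) //; apply/setP => x; rewrite !inE addr0.
apply/eqP; rewrite eqn_leq K4 /=.
have : (16 <= \sum_(d in K) 4)%N.
  rewrite -cardF -cardsT -sum1_card (partition_big (fun x : F => x + x ^+ 4) (mem K)) => [|x _]; last first.
    by have : x + x ^+ 4 \in K by [rewrite inE trace_F4]; exact.
  apply: leq_sum => d _; rewrite sum1_card; apply: leq_trans (card_roots4 d).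
  apply: subset_leq_card; apply/subsetP => x xP; rewrite inE; case/andP: xP => _ /eqP <-.
  by rewrite addrA F2 add0r.
by rewrite sum_nat_const -[16%N]/(4 * 4)%N leq_pmul2r.
Qed.

Lemma conjMK (x y : F) : (x * y ^+ 4) ^+ 4 = y * x ^+ 4.
Proof. by rewrite exprMn conjK // mulrC. Qed.

Lemma conjKM (x y : F) : (x ^+ 4 * y ^+ 4) ^+ 4 = x * y.
Proof. by rewrite -exprMn conjK. Qed.

Definition dot (x y : 'rV[F]_3) : F :=
  x 0 o0 * y 0 o0 ^+ 4 + x 0 o1 * y 0 o1 ^+ 4 + x 0 o2 * y 0 o2 ^+ 4.

(** Besides v the basis has an isotropic w with product 1 with v, and in the middle the conjugate of
    the cross product of v and w. *)
Lemma hyperbolic_basis (v : 'rV[F]_3) : v != 0 -> dot v v = 0 ->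
  exists M : 'M[F]_3, M *m adj M = J F /\ row o0 M = v.
Proof.
move=> v0 vv.
have [y0 [y1 [y2 yv]]] : exists y0 y1 y2, y0 * v 0 o0 ^+ 4 + y1 * v 0 o1 ^+ 4 + y2 * v 0 o2 ^+ 4 = 1.
  have [v00|n0] := eqVneq (v 0 o0) 0; last first.
    by exists (v 0 o0 ^- 4), 0, 0; rewrite mulVf ?expf_neq0 // !mul0r !addr0.
  have [v01|n1] := eqVneq (v 0 o1) 0; last first.
    by exists 0, (v 0 o1 ^- 4), 0; rewrite mulVf ?expf_neq0 // !mul0r addr0 add0r.
  exists 0, 0, (v 0 o2 ^- 4); rewrite mulVf ?expf_neq0 ?mul0r ?add0r //.
  by apply: contra v0 => /eqP v02; apply/eqP/rowP; elim/ord3_ind; rewrite mxE.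
set a0 := v 0 o0 in yv; set a1 := v 0 o1 in yv; set a2 := v 0 o2 in yv.
rewrite /dot -/a0 -/a1 -/a2 in vv.
have [c cE] := trace_one.
pose n := y0 * y0 ^+ 4 + y1 * y1 ^+ 4 + y2 * y2 ^+ 4.
have n4 : n ^+ 4 = n by rewrite /n !conjD // !conjMK.
have vy : a0 * y0 ^+ 4 + a1 * y1 ^+ 4 + a2 * y2 ^+ 4 = 1.
  have := congr1 (fun x => x ^+ 4) yv; rewrite !conjD // !conjMK expr1n; exact.
(* Adding t v to y changes its norm by t + t^4, and c has been chosen so that this equals the norm
   n. *)
pose t := c * n.
have tE : t + t ^+ 4 = n by rewrite /t exprMn n4 -mulrDl cE mul1r.
pose w0 := y0 + t * a0; pose w1 := y1 + t * a1; pose w2 := y2 + t * a2.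
have wv : w0 * a0 ^+ 4 + w1 * a1 ^+ 4 + w2 * a2 ^+ 4 = 1.
  rewrite -[RHS]yv -[RHS]addr0 -[X in _ = _ + X](mulr0 t) -vv /w0 /w1 /w2; ring.
have ww : w0 * w0 ^+ 4 + w1 * w1 ^+ 4 + w2 * w2 ^+ 4 = 0.
  transitivity (n + t ^+ 4 * (y0 * a0 ^+ 4 + y1 * a1 ^+ 4 + y2 * a2 ^+ 4) +
     t * (a0 * y0 ^+ 4 + a1 * y1 ^+ 4 + a2 * y2 ^+ 4) + t * t ^+ 4 * (a0 * a0 ^+ 4 + a1 * a1 ^+ 4 + a2 * a2 ^+ 4)).
    rewrite /n /w0 /w1 /w2 !conjD // ![(t * _) ^+ 4]exprMn; ring.
  by rewrite yv vy vv mulr0 !mulr1 addr0 -addrA [t ^+ 4 + t]addrC tE F2.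
clearbody w0 w1 w2.
have vw : a0 * w0 ^+ 4 + a1 * w1 ^+ 4 + a2 * w2 ^+ 4 = 1.
  have := congr1 (fun x => x ^+ 4) wv; rewrite !conjD // !conjMK expr1n; exact.
pose m0 := a1 * w2 - a2 * w1; pose m1 := a2 * w0 - a0 * w2; pose m2 := a0 * w1 - a1 * w0.
pose c0 := a1 ^+ 4 * w2 ^+ 4 - a2 ^+ 4 * w1 ^+ 4; pose c1 := a2 ^+ 4 * w0 ^+ 4 - a0 ^+ 4 * w2 ^+ 4.
pose c2 := a0 ^+ 4 * w1 ^+ 4 - a1 ^+ 4 * w0 ^+ 4.
have [c0E c1E c2E] : [/\ c0 ^+ 4 = m0, c1 ^+ 4 = m1 & c2 ^+ 4 = m2].
  by rewrite /c0 /c1 /c2 /m0 /m1 /m2 !opp_char2 //; split; rewrite conjD // !conjKM.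
have [m0E m1E m2E] : [/\ m0 ^+ 4 = c0, m1 ^+ 4 = c1 & m2 ^+ 4 = c2].
  by rewrite -c0E -c1E -c2E !conjK.
exists (mx3 a0 a1 a2 c0 c1 c2 w0 w1 w2); split; last first.
  by apply/rowP; elim/ord3_ind; rewrite !mxE.
apply/matrixP; do 2! (elim/ord3_ind); rewrite !mxE sum3 !mxE /= ?c0E ?c1E ?c2E //.
- rewrite /m0 /m1 /m2; ring.
- rewrite /c0 /c1 /c2; ring.
(* The norm of a cross product is the Gram determinant of its factors, here 0 - 1. *)
- have -> : c0 * m0 + c1 * m1 + c2 * m2 =
    (a0 * a0 ^+ 4 + a1 * a1 ^+ 4 + a2 * a2 ^+ 4) * (w0 * w0 ^+ 4 + w1 * w1 ^+ 4 + w2 * w2 ^+ 4) -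
    (a0 * w0 ^+ 4 + a1 * w1 ^+ 4 + a2 * w2 ^+ 4) * (w0 * a0 ^+ 4 + w1 * a1 ^+ 4 + w2 * a2 ^+ 4).
    rewrite /c0 /c1 /c2 /m0 /m1 /m2; ring.
  by rewrite vv ww vw wv mulr0 mulr1 add0r opp_char2.
- rewrite /c0 /c1 /c2; ring.
- rewrite /m0 /m1 /m2; ring.
Qed.
End Hermitian.

(** * A 2-group fixes an isotropic vector *)

Section FixedVector.
Variable F : finFieldType.
Hypothesis cardF : #|F| = 16%N.
Let F2 := addrr_F16 cardF.
Local Notation gT := {'GL_3[F]}.

Lemma SU3P (g : gT) : reflect (adj (GLval g) *m GLval g = 1%:M /\ \det (GLval g) = 1) (g \in SU3 F 4).
Proof. by rewrite inE; apply: (iffP andP) => -[/eqP gg /eqP dg]; split=> //; apply/eqP. Qed.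

Lemma SU3_group_set : group_set (SU3 F 4).
Proof.
apply/group_setP; split=> [|g h /SU3P[gg dg] /SU3P[hh dh]].
  by apply/SU3P; rewrite GL_1E det1 adj1 mulmx1.
apply/SU3P; rewrite GL_MxE det_mulmx dg dh mulr1; split=> //.
by rewrite adjM // -mulmxA [adj (GLval g) *m _]mulmxA gg mul1mx hh.
Qed.
Definition SU3_group : {group gT} := Group SU3_group_set.

Definition vact (v : 'rV[F]_3) (g : gT) : 'rV[F]_3 := v *m GLval g.
Lemma vact1 v : vact v 1%g = v. Proof. exact: mulmx1. Qed.
Lemma vactM v g h : vact v (g * h)%g = vact (vact v g) h. Proof. exact: mulmxA. Qed.
Canonical vaction := TotalAction vact1 vactM.

Lemma dotE (x y : 'rV[F]_3) : dot x y = (x *m adj y) 0 0.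
Proof. by rewrite mxE sum3 !mxE. Qed.

Lemma dot_SU3 x y g : g \in SU3 F 4 -> dot (vact x g) (vact y g) = dot x y.
Proof.
move=> /SU3P[/mulmx1C gg _]; rewrite !dotE adjM // -mulmxA [GLval g *m _]mulmxA.
by rewrite gg mul1mx.
Qed.

Let swap_mx : 'M[F]_3 := mx3 0 1 0 1 0 0 0 0 1.
Let swapK : swap_mx *m swap_mx = 1%:M.
Proof.
by apply/matrixP; do 2! (elim/ord3_ind); rewrite !mxE sum3 !mxE /= ?mulr0 ?mulr1 ?addr0 ?add0r.
Qed.

(** Swapping the first two coordinates fixes exactly the isotropic vectors (x, x, 0), since z^5 = 0
    is forced on the third coordinate. There are 16 of them, and an involution preserves the parity
    of the count. *)
Lemma even_isotropic : ~~ odd #|[set v : 'rV[F]_3 | dot v v == 0]|.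
Proof.
set T := [set v | _]; have [swap_unit _] := mulmx1_unit swapK.
pose g : gT := FinRing.unit 'M[F]_3 swap_unit.
have gE v : vact v g = \row_k [:: v 0 o1; v 0 o0; v 0 o2]`_k.
  by apply/rowP; elim/ord3_ind; rewrite /vact !mxE sum3 !mxE /= ?mulr0 ?mulr1 ?addr0 ?add0r.
have g2 : (g ^+ 2)%g = 1%g by apply: val_inj; apply: swapK.
have pg : (2.-group <[g]>)%g by rewrite /pgroup (pnat_dvd (n := 2)) // order_dvdn g2.
have aT : [acts <[g]>, on T | vaction]%g.
  rewrite cycle_subG; apply/astabsP => v; rewrite /= !inE /dot gE !mxE /=.
  by rewrite [v 0 o1 * _ + _]addrC.
have := pgroup_fix_mod pg aT; rewrite !modn2.
pose f (x : F) : 'rV[F]_3 := \row_k [:: x; x; 0]`_k.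
have fI : injective f by move=> x y /rowP/(_ o0); rewrite !mxE.
rewrite (_ : 'Fix_(T | vaction)(<[g]>)%g = f @: setT); last first.
  apply/setP => v; rewrite inE afix_cycle; apply/andP/imsetP => [[vT /afix1P vg]|[x _ ->]].
    exists (v 0 o0); rewrite ?inE //.
    have v01 : v 0 o1 = v 0 o0 by move/rowP: vg => /(_ o0); rewrite /= gE mxE.
    have v02 : v 0 o2 = 0.
      move: vT; rewrite inE /dot v01 F2 add0r -exprS expf_eq0 => /andP[_ /eqP //].
    by apply/rowP; elim/ord3_ind; rewrite mxE.
  split; first by rewrite inE /dot !mxE /= mul0r addr0 F2.
  by apply/afix1P/rowP; elim/ord3_ind; rewrite /= gE !mxE.
by rewrite card_imset // cardsT cardF; case: (odd _).
Qed.

(** The number of isotropic vectors fixed by a 2-group is even by the previous count, and 0 is one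
    of them, so there is another. *)
Lemma fixed_isotropic (G : {group gT}) : (2.-group G)%g -> G \subset SU3 F 4 ->
  exists v : 'rV[F]_3, [/\ v != 0, dot v v = 0 & {in G, forall g, vact v g = v}].
Proof.
move=> pG sG; pose T := [set v : 'rV[F]_3 | dot v v == 0].
have aT : [acts G, on T | vaction]%g.
  by apply/actsP => g gG v; rewrite /= !inE dot_SU3 ?(subsetP sG).
have := pgroup_fix_mod pG aT; rewrite !modn2 (negbTE even_isotropic).
set X := ('Fix_(T | vaction)(G))%g => X_even.
have X0 : 0 \in X.
  by rewrite inE; apply/andP; split; [rewrite inE /dot !mxE !mul0r !addr0 | apply/afixP => g _; apply: mul0mx].
have [v] : exists v, v \in X :\ 0.
  apply/set0Pn/eqP => X1; move: X_even.
  by rewrite (cardsD1 0) X0 X1 cards0.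
rewrite in_setD1 => /andP[v0 /setIP[vT /afixP vG]]; exists v; split=> //.
  by move: vT; rewrite inE => /eqP.
Qed.
End FixedVector.

(** * The stabilizer of an isotropic vector *)

Section Stabilizer.
Variable F : finFieldType.
Hypothesis cardF : #|F| = 16%N.
Let F2 := addrr_F16 cardF.
Local Notation gT := {'GL_3[F]}.
Local Notation J := (J F).
Variables (v : 'rV[F]_3) (M Mi : 'M[F]_3).
Hypothesis MJ : M *m adj M = J.
Hypothesis Mv : row o0 M = v.
Hypothesis MiE : Mi = adj M *m J.
Let MMi : M *m Mi = 1%:M. Proof. by rewrite MiE mulmxA MJ mulJJ. Qed.
Let MiM : Mi *m M = 1%:M. Proof. exact: mulmx1C MMi. Qed.
Let aMi : adj Mi = J *m M. Proof. by rewrite MiE adjM // adjJ adjK. Qed.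

Definition coord (g : gT) : 'M[F]_3 := M *m (GLval g : 'M[F]_3) *m Mi.
Definition al_of (g : gT) : F := coord g o1 o0.
Definition be_of (g : gT) : F := coord g o2 o0.

Lemma coordM g h : coord (g * h)%g = coord g *m coord h.
Proof.
by rewrite /coord GL_MxE !mulmxA -(mulmxA _ Mi M) MiM mulmx1.
Qed.

Definition stab : {set gT} := [set g in SU3 F 4 | vact v g == v].

Lemma stabE g : (g \in stab) = (g \in SU3 F 4) && (vact v g == v).
Proof. by rewrite in_set. Qed.

Lemma stab_group_set : group_set stab.
Proof.
apply/group_setP; split=> [|g h].
  by rewrite stabE vact1 eqxx andbT; apply: (group1 (SU3_group cardF)).
rewrite !stabE => /andP[gS /eqP gv] /andP[hS /eqP hv].
by rewrite vactM gv hv eqxx andbT; apply: (groupM (G := SU3_group cardF)).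
Qed.
Definition stab_group : {group gT} := Group stab_group_set.

Lemma coord_stab g : g \in stab ->
  coord g = tmx (al_of g) (be_of g) /\ be_of g ^+ 4 = be_of g + al_of g ^+ 5.
Proof.
rewrite stabE => /andP[/SU3P[/mulmx1C gg dg] /eqP gv].
apply: unitary_tmx => //.
- rewrite /coord !adjM // aMi !mulmxA -(mulmxA _ J J) mulJJ mulmx1 -(mulmxA _ Mi M) MiM mulmx1.
  by rewrite -(mulmxA M) gg mulmx1 MJ.
- by rewrite /coord !row_mul Mv -[v *m _]/(vact v g) gv -Mv -row_mul MMi.
by rewrite /coord !det_mulmx dg mulr1 -det_mulmx MMi det1.
Qed.

Lemma coord_inj g h : coord g = coord h -> g = h.
Proof.
move=> /(congr1 (fun A => Mi *m A *m M)); rewrite /coord !mulmxA MiM !mul1mx -!mulmxA MiM !mulmx1.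
by move=> gh; apply: val_inj; apply: gh.
Qed.

Lemma stab_coord a b : b ^+ 4 = b + a ^+ 5 -> exists2 g, g \in stab & coord g = tmx a b.
Proof.
move=> b4; pose A : 'M[F]_3 := Mi *m tmx a b *m M.
have dA : \det A = 1 by rewrite /A !det_mulmx det_tmx mulr1 -det_mulmx MiM det1.
have uA : A \is a GRing.unit by rewrite -[_ \is a _]/(A \in unitmx) unitmxE dA unitr1.
have AA : A *m adj A = 1%:M.
  rewrite /A !adjM // aMi !mulmxA -(mulmxA _ M (adj M)) MJ.
  by rewrite -(mulmxA Mi) -(mulmxA Mi) tmx_unitary // -(mulmxA Mi) mulJJ mulmx1 MiM.
pose g : gT := FinRing.unit 'M[F]_3 uA; exists g; last first.
  by rewrite /coord -[GLval g]/A /A !mulmxA MMi mul1mx -mulmxA MMi mulmx1.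
rewrite stabE; apply/andP; split; first by apply/SU3P; split=> //; apply: mulmx1C AA.
rewrite -Mv /vact -[GLval g]/A -row_mul /A !mulmxA MMi mul1mx row_mul.
suff -> : row o0 (tmx a b) = row o0 1%:M by rewrite -row_mul mul1mx.
by apply/rowP; elim/ord3_ind; rewrite !mxE.
Qed.

Lemma tmx_inj (a b a' b' : F) : tmx a b = tmx a' b' -> a = a' /\ b = b'.
Proof. by move/matrixP => e; split; [have := e o1 o0 | have := e o2 o0]; rewrite !mxE. Qed.

(** Replacing b by b + c a^5 with c + c^4 = 1 turns b^4 = b + a^5 into the equation of the subfield
    of 4 elements and leaves a free: 16 times 4. *)
Lemma card_stab : #|stab| = 64%N.
Proof.
have [c cE] := trace_one cardF; pose K := [set x : F | x ^+ 4 == x].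
have c4 : c ^+ 4 = c + 1 by rewrite -cE addrA F2 add0r.
pose f (g : gT) := (al_of g, be_of g + c * al_of g ^+ 5).
have a20 (x : F) : (x ^+ 5) ^+ 4 = x ^+ 5 by rewrite -exprM (exprD _ 16 4) exp16 // -exprS.
have fI : {in stab &, injective f}.
  move=> g h /coord_stab[gE _] /coord_stab[hE _] [ga gb]; apply: coord_inj.
  by rewrite gE hE ga; congr (tmx _ _); apply: (addIr (c * al_of g ^+ 5)); rewrite gb ga.
rewrite -(card_in_imset fI); have -> : f @: stab = setX setT K.
  apply/setP => -[a k]; rewrite !inE /=; apply/imsetP/idP => [[g gS [_ ->]]|/eqP kK].
    have [_ b4] := coord_stab gS.
    rewrite conjD // exprMn a20 b4 -addrA; apply/eqP; congr (_ + _).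
    by rewrite -{1}[al_of g ^+ 5]mul1r -cE -mulrDl -addrA F2 addr0.
  have [|g gS gE] := @stab_coord a (k + c * a ^+ 5).
    rewrite conjD // exprMn a20 kK -addrA; congr (_ + _).
    by rewrite c4; ring.
  exists g => //; have [ga gb] : al_of g = a /\ be_of g = k + c * a ^+ 5.
    by have [gT _] := coord_stab gS; apply: tmx_inj; rewrite -gT.
  by rewrite /f ga gb -addrA F2 addr0.
by rewrite cardsX cardsT cardF card_F4.
Qed.
End Stabilizer.

Local Open Scope group_scope.
Local Open Scope ring_scope.

Lemma sylow_SU3_coordinates (F : finFieldType) (cardF : #|F| = 16%N) (G : {group {'GL_3[F]}}) :
  G \in ('Syl_2(SU3 F 4))%g -> exists al be : {'GL_3[F]} -> F,
    [/\ {in G &, forall g h, al (g * h)%g = al g + al h},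
        {in G &, forall g h, be (g * h)%g = be g + be h + al g ^+ 4 * al h},
        {in G, forall g, be g ^+ 4 = be g + al g ^+ 5},
        {in G &, forall g h, al g = al h -> be g = be h -> g = h} & #|G| = 64%N].
Proof.
rewrite inE -[SU3 F 4]/(gval (SU3_group cardF)) => /[dup] sylG /and3P[sG pG _].
have [v [v0 vv vG]] := fixed_isotropic cardF pG sG.
have [M [MJ Mv]] := hyperbolic_basis cardF v0 vv.
have GQ : G \subset stab v.
  by apply/subsetP => g gG; rewrite stabE (subsetP sG) //= vG.
pose Mi := adj M *m J F.
pose al g := al_of M Mi g; pose be g := be_of M Mi g.
have cP g : g \in G -> coord M Mi g = tmx (al g) (be g) /\ be g ^+ 4 = be g + al g ^+ 5.
  by move=> /(subsetP GQ); apply: (coord_stab cardF MJ Mv erefl).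
have prod g h : g \in G -> h \in G ->
    al (g * h)%g = al g + al h /\ be (g * h)%g = be g + be h + al g ^+ 4 * al h.
  move=> gG hG; apply: tmx_inj; rewrite -tmxM //.
  have [<- _] := cP _ (groupM gG hG); have [<- _] := cP g gG; have [<- _] := cP h hG.
  exact: (coordM MJ erefl).
exists al, be; split.
- by move=> g h gG hG; have [] := prod g h gG hG.
- by move=> g h gG hG; have [] := prod g h gG hG.
- by move=> g gG; have [] := cP g gG.
- move=> g h gG hG ga gb; apply: (coord_inj MJ erefl).
  by have [-> _] := cP g gG; have [-> _] := cP h hG; rewrite ga gb.
have cQ := card_stab cardF MJ Mv erefl.
(* The order of SU_3(4) is not computed: the stabilizer contains G and is itself a 2-subgroup of
   order 64, which bounds the order of G from both sides. *)
apply/eqP; rewrite eqn_leq -{1}cQ subset_leq_card //=.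
rewrite (card_Hall sylG) -cQ; apply: dvdn_leq; first by rewrite part_gt0.
have pQ : (2.-nat #|stab v|)%N by rewrite cQ.
rewrite -(part_pnat_id pQ) partn_dvd // ?cardG_gt0 //.
have sQ : stab_group cardF v \subset SU3_group cardF by apply/subsetP => g; rewrite stabE => /andP[].
exact: cardSg sQ.
Qed.

Theorem theorem1p1 (F : finFieldType) (hF : #|F| = 16%N)
  (G : {group {'GL_3[F]}}) (hG : G \in 'Syl_2(SU3 F 4)) :
  exists (theta eta phi psi : cochain {'GL_3[F]} 'F_2),
    [/\ essential G 4 theta, essential G 10 eta,
        essential G 6 phi & essential G 8 psi] /\
    ~ coboundary G 14 (cup 4 theta eta) /\
    coboundary G 14 (fun s => cup 6 phi psi s - cup 4 theta eta s).
Proof.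
have [al [be [alM beM be4 inj cG]]] := sylow_SU3_coordinates hF hG.
exact: (essential_products hF alM beM be4 inj cG).
Qed.
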